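(* Let $Y$ be a Young set, let $H$ be a finite abelian group, and consider the Hopf algebras $\mathcal M=\mathcal M^\Delta_{Y,H}$ and $\mathcal B=\mathcal B^\Delta_{Y,H}$ with characters $\zeta_{\mathcal M},\zeta_{\mathcal B}$ defined in the context. The Hopf-algebra morphism $\Psi_{\mathcal M}:\mathcal M\to\operatorname{Sym}_{\mathbb Z}$ induced by the character $\zeta_{\mathcal M}$ is given, for each finite set $N$, each function $F\in\operatorname{Fun}(Y_N,\widehat H)$, and each representation $\gamma$ of $\operatorname{Aut}F$, by $$\Psi_{\mathcal M}(\gamma)=\sum_{\alpha\in\operatorname{Comp}_{\#N}}\big(\dim\operatorname{Hom}_{\operatorname{Aut}F}(\rho_{F,\alpha},\gamma)\big)M_\alpha.$$ The Hopf-algebra morphism $\Psi_{\mathcal B}:\mathcal B\to\operatorname{Sym}_{\mathbb Z}$ induced by the character $\zeta_{\mathcal B}$ is given, for each $F\in\operatorname{Fun}(Y_N,\widehat H)$, by $$\Psi_{\mathcal B}(\pi_F)=\sum_{\alpha\in\operatorname{Comp}_{\#N}}(\#\operatorname{Comp}_{F,\alpha})M_\alpha.$$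
   Context: Young sets. $\mathrm{Set}^{\mathrm{inj}}$ is the category of finite sets and injective maps, $\mathrm{Set}^\times$ the groupoid of finite sets and bijections. A Young set is a functor $Y:\mathrm{Set}^{\mathrm{inj}}\to\mathrm{Set}^{\mathrm{inj}}$, $N\mapsto Y_N$, with $Y_\emptyset=\emptyset$ and $Y_K\cap Y_L=Y_{K\cap L}$ for all subsets $K,L$ of the same finite set $N$; for $K\subseteq N$, $Y_K$ is regarded as a subset of $Y_N$ via the injection induced by inclusion. For an injection $w$ we write $w$ also for $Y_w$. For $N=K\sqcup L$ put $Y_{K,L}=Y_K\sqcup Y_L\subseteq Y_N$. For $K\subseteq N$, $K^c=N\setminus K$. Representations. $\Bbbk$ is an algebraically closed field of characteristic zero; representations are finite-dimensional over $\Bbbk$; $R(G)$ is the Grothendieck group of $\operatorname{Rep}(G)$, free abelian on $\operatorname{Irr}(G)$, and $R(G)\otimes_{\mathbb Z}R(G')\cong R(G\times G')$. $\operatorname{Fun}(Y_N,H)$ is the group of functions $Y_N\to H$. $\widehat H$ is a set of representatives of the (one-dimensional, since $H$ is abelian) irreducible representations of $H$, $\operatorname{triv}_H$ the trivial one. For a function $F\in\operatorname{Fun}(Y_N,\widehat H)$, $\operatorname{supp}F=\{y:F(y)\ne\operatorname{triv}_H\}$ and $\pi_F$ is the irreducible representation $f\mapsto\bigotimes_{y\in Y_N}F(y)(f(y))$ of $\operatorname{Fun}(Y_N,H)$. For a bijection $w:N\to M$, $(wF)(y)=F(w^{-1}y)$; $\operatorname{Aut}F=\{w\in S_N:wF=F\}$,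 $S_N$ being the symmetric group of $N$. Given $F_K\in\operatorname{Fun}(Y_K,\widehat H)$, $F_L\in\operatorname{Fun}(Y_L,\widehat H)$, $F_K\sqcup F_L\in\operatorname{Fun}(Y_{K\sqcup L},\widehat H)$ equals $F_K$ on $Y_K$, $F_L$ on $Y_L$, and $\operatorname{triv}_H$ elsewhere. $F_\emptyset$ is the empty function on $Y_\emptyset$. $\mathcal M=\mathcal M^\Delta_{Y,H}$: the free abelian group $\big(\bigoplus_{N,\,F\in\operatorname{Fun}(Y_N,\widehat H)}R(\operatorname{Aut}F)\big)_{\mathrm{Set}^\times}$, where one imposes $\gamma=\operatorname{Ad}_w\gamma$ for bijections $w:N\to M$, $\operatorname{Ad}_w:R(\operatorname{Aut}F)\to R(\operatorname{Aut}wF)$, $\gamma\mapsto\gamma(w^{-1}\cdot w)$; $R(\operatorname{Aut}F)$ in degree $\#N$; multiplication the sum of $R(\operatorname{Aut}F_K)\otimes R(\operatorname{Aut}F_L)\cong R(\operatorname{Aut}F_K\times\operatorname{Aut}F_L)\xrightarrow{\operatorname{ind}}R(\operatorname{Aut}(F_K\sqcup F_L))$; unit the trivial representation of $\operatorname{Aut}F_\emptyset$; comultiplication (for $H$ abelian) $$\Delta_{\mathcal M}\gamma=\sum_K\operatorname{ind}_{(\operatorname{Aut}F)_K}^{\operatorname{Aut}(F|_{Y_K})\times\operatorname{Aut}(F|_{Y_{K^c}})}\operatorname{res}^{\operatorname{Aut}F}_{(\operatorname{Aut}F)_K}\gamma,$$ over representatives $K$ of the $\operatorname{Aut}F$-orbits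 of subsets of $N$, where $(\operatorname{Aut}F)_K=\{w\in\operatorname{Aut}F:wK=K\}$ is embedded by $w\mapsto(w|_K,w|_{K^c})$; counit sending the trivial representation of $\operatorname{Aut}F_\emptyset$ to $1$ and vanishing in positive degree. This is a connected graded commutative cocommutative Hopf algebra. Character: for $\gamma\in\operatorname{Irr}(\operatorname{Aut}F)$, $\zeta_{\mathcal M}(\gamma)=1$ if $\operatorname{supp}F=\emptyset$ and $\gamma$ is trivial, and $0$ otherwise. $\mathcal B=\mathcal B^\Delta_{Y,H}$: the free abelian group $\big(\bigoplus_NR(\operatorname{Fun}(Y_N,H))\big)_{\mathrm{Set}^\times}$, with basis the classes of the $\pi_F$ modulo $\pi_F=\pi_{wF}$ for bijections $w$; $\pi_F$ in degree $\#N$; $\pi_{F_K}\pi_{F_L}=\pi_{F_K\sqcup F_L}$; unit $\pi_{F_\emptyset}$; $\Delta_{\mathcal B}\pi_F=\sum_{K\subseteq N}\pi_{F|_{Y_K}}\otimes\pi_{F|_{Y_{K^c}}}$ ($H$ abelian); counit $1$ on $\pi_{F_\emptyset}$, $0$ on other $\pi_F$. This is a connected graded commutative cocommutative Hopf algebra. Character: $\zeta_{\mathcal B}(\pi_F)=1$ if $\operatorname{supp}F=\emptyset$, and $0$ otherwise. $\zeta_{\mathcal M}$ and $\zeta_{\mathcal B}$ are algebra homomorphisms to $\mathbb Z$. $\operatorname{Sym}_{\mathbb Z}$ is the graded Hopf algebra of symmetric functions in $x_1,x_2,\dots$ over $\mathbb Z$; the morphism induced by a character $\zeta:\mathcal H\to\mathbb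 Z$ of a connected graded cocommutative Hopf algebra is the unique homomorphism of graded Hopf algebras $\Psi:\mathcal H\to\operatorname{Sym}_{\mathbb Z}$ with $\Psi(x)(1,0,0,\dots)=\zeta(x)$ for all $x$ (Aguiar–Bergeron–Sottile). Compositions. $\operatorname{Comp}_n$ is the set of integer compositions of $n$ (ordered lists of positive integers with sum $n$). For $\alpha=(\alpha_1,\dots,\alpha_\ell)$, $M_\alpha=\sum_{i_1<\dots<i_\ell}x_{i_1}^{\alpha_1}\cdots x_{i_\ell}^{\alpha_\ell}$ is the monomial quasisymmetric function. For $\alpha\in\operatorname{Comp}_{\#N}$, $\operatorname{Comp}_{N,\alpha}$ is the set of ordered lists $\kappa=(K_1,\dots,K_\ell)$ of mutually disjoint nonempty subsets of $N$ with union $N$ and $\#K_i=\alpha_i$ for each $i$; $Y_\kappa=\bigsqcup_iY_{K_i}\subseteq Y_N$. $\operatorname{Comp}_{F,\alpha}=\{\kappa\in\operatorname{Comp}_{N,\alpha}:\operatorname{supp}F\cap Y_\kappa=\emptyset\}$, on which $\operatorname{Aut}F$ acts by $w(K_1,\dots,K_\ell)=(wK_1,\dots,wK_\ell)$; $\rho_{F,\alpha}$ is the corresponding permutation representation of $\operatorname{Aut}F$ on $\Bbbk^{\operatorname{Comp}_{F,\alpha}}$. *)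

(* Defs.v *)
From HB Require Import structures.
From mathcomp Require Import all_boot all_order all_algebra all_fingroup all_field all_character.
From mathcomp Require Import boolp freeg mpoly.

Set Implicit Arguments.
Unset Strict Implicit.
Unset Printing Implicit Defensive.

Import GRing.Theory.
Local Open Scope ring_scope.

Section Quotient.

Variables (V : zmodType) (P : V -> Prop).

Inductive spanned : V -> Prop :=
| spanned_gen x : P x -> spanned x
| spanned0 : spanned 0
| spannedB x y : spanned x -> spanned y -> spanned (x - y).

Definition span_pred : {pred V} := [pred x | `[< spanned x >]].

Fact span_closed : zmod_closed span_pred.
Proof.
split; first by rewrite inE; apply/asboolP; exact: spanned0.
move=> x y; rewrite !inE => /asboolP px /asboolP py.
by apply/asboolP; apply: spannedB.
Qed.

HB.instance Definition _ := GRing.isZmodClosed.Build V span_pred span_closed.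

Definition zquot : zmodType := {ideal_quot span_pred}.

End Quotient.

Section Presentation.

Variable X : Type.

Definition fgen (x : X) : {freeg {classic X}} := << (x : {classic X}) >>.

Variable P : {freeg {classic X}} -> Prop.

Definition presented : zmodType := zquot P.

Definition pgen (x : X) : presented := \pi_(zquot P)%qT (fgen x).

(* The additive map defined on presented by the values f on the generators,
   computed on a representative; it is meaningful when f kills the relations P. *)
Definition plift (A : zmodType) (f : X -> A) (u : presented) : A :=
  let r : {freeg {classic X}} := generic_quotient.repr u in
  \sum_(x <- dom r) f x *~ coeff x r.

End Presentation.

Section Tensor.

Variables (A B : zmodType).

Inductive tens_rel : {freeg {classic (A * B)}} -> Prop :=
| TensRelL a a' b :
    tens_rel (fgen (a + a', b) - fgen (a, b) - fgen (a', b))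
| TensRelR a b b' :
    tens_rel (fgen (a, b + b') - fgen (a, b) - fgen (a, b')).

Definition tens : zmodType := presented tens_rel.

Definition tpure (a : A) (b : B) : tens := pgen tens_rel (a, b).

Definition tlift (C : zmodType) (f : A -> B -> C) : tens -> C :=
  @plift _ tens_rel C (fun ab => f ab.1 ab.2).

End Tensor.

Definition tmap (A B A' B' : zmodType) (f : A -> A') (g : B -> B') :
  tens A B -> tens A' B' := tlift (fun a b => tpure (f a) (g b)).

Definition invf (A : zmodType) (B : Type) (f : A -> B) (y : B) : A :=
  if pselect (exists x, f x = y) is left e then projT1 (cid e) else 0.

Section Product.

Variables (I : Type) (V : I -> zmodType).

Definition dprodz : Type := forall i, V i.

HB.instance Definition _ := gen_eqMixin dprodz.
HB.instance Definition _ := gen_choiceMixin dprodz.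

Let add (f g : dprodz) : dprodz := fun i => f i + g i.
Let opp (f : dprodz) : dprodz := fun i => - f i.
Let zero : dprodz := fun i => 0.

Fact dprodz_addA : associative add.
Proof. by move=> f g h; apply: functional_extensionality_dep => i; exact: addrA. Qed.
Fact dprodz_addC : commutative add.
Proof. by move=> f g; apply: functional_extensionality_dep => i; exact: addrC. Qed.
Fact dprodz_add0 : left_id zero add.
Proof. by move=> f; apply: functional_extensionality_dep => i; exact: add0r. Qed.
Fact dprodz_addN : left_inverse zero opp add.
Proof. by move=> f; apply: functional_extensionality_dep => i; exact: addNr. Qed.

HB.instance Definition _ :=
  GRing.isZmodule.Build dprodz dprodz_addA dprodz_addC dprodz_add0 dprodz_addN.

End Product.

(* The antipode is not recorded: a connected graded bialgebra has exactly one,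
   and morphisms of bialgebras preserve it. *)
Record gbialg := GBialg {
  gb_car :> zmodType;
  gb_homog : nat -> gb_car -> Prop;
  gb_mul : gb_car -> gb_car -> gb_car;
  gb_one : gb_car;
  gb_comul : gb_car -> tens gb_car gb_car;
  gb_counit : gb_car -> int }.

Record graded_hopf_morphism (A B : gbialg) (f : A -> B) : Prop := GHMorphism {
  ghm_additive : {morph f : x y / x + y >-> x + y};
  ghm_homog : forall n x, gb_homog n x -> gb_homog n (f x);
  ghm_mul : {morph f : x y / gb_mul x y >-> gb_mul x y};
  ghm_one : f (gb_one A) = gb_one B;
  ghm_comul : forall x, gb_comul (f x) = tmap f f (gb_comul x);
  ghm_counit : forall x, gb_counit (f x) = gb_counit x }.

(* A formal power series of bounded degree in x_0, x_1, ... is given by its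
   truncations to Z[x_0, ..., x_(n-1)], n in nat, so Sym is the inverse limit
   of the graded rings of symmetric polynomials in n variables. *)
Definition pfam := dprodz (fun n => {mpoly int[n]} : zmodType).

Definition set_last0 n (p : {mpoly int[n.+1]}) : {mpoly int[n]} :=
  p \mPo [tuple (if unlift ord_max i is Some j then 'X_j else 0) | i < n.+1].

Definition is_symfun (f : pfam) : Prop :=
  [/\ forall n, f n \is symmetric,
      forall n, set_last0 (f n.+1) = f n
    & exists d, forall n, (msize (f n) <= d)%N].

Definition symfun_pred : {pred pfam} := [pred f | `[< is_symfun f >]].

Lemma symfun_predP f : reflect (is_symfun f) (f \in symfun_pred).
Proof. by rewrite inE; exact: asboolP. Qed.

Lemma set_last0B n : {morph @set_last0 n : p q / p - q}.
Proof. by move=> p q; rewrite /set_last0 raddfB. Qed.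

Fact symfun_closed : zmod_closed symfun_pred.
Proof.
split.
  apply/symfun_predP; split=> [n|n|]; rewrite ?rpred0 //.
    by rewrite /set_last0 [LHS]raddf0.
  by exists 0%N => n; rewrite msize0.
move=> f g /symfun_predP[sf cf [d df]] /symfun_predP[sg cg [e eg]].
apply/symfun_predP; split=> [n|n|]; first exact: rpredB.
  by rewrite [LHS]set_last0B cf cg.
exists (maxn d e) => n; apply: leq_trans (msizeD_le _ _) _.
by rewrite msizeN geq_max !leq_max df eg orbT.
Qed.

HB.instance Definition _ :=
  GRing.isZmodClosed.Build pfam symfun_pred symfun_closed.

Record symfun := SymFun { sym_val : pfam; _ : sym_val \in symfun_pred }.

Definition sym_trunc (f : symfun) n : {mpoly int[n]} := sym_val f n.
Coercion sym_trunc : symfun >-> Funclass.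

HB.instance Definition _ := [isSub for sym_val].
HB.instance Definition _ := [Choice of symfun by <:].
HB.instance Definition _ := [SubChoice_isSubZmodule of symfun by <:].

Fact symfun1_subproof : (fun n => 1 : {mpoly int[n]}) \in symfun_pred.
Proof.
apply/symfun_predP; split=> [n|n|]; rewrite ?rpred1 //.
  by rewrite /set_last0 rmorph1.
by exists 1%N => n; rewrite msize1.
Qed.

Fact symfunM_subproof (f g : symfun) : (fun n => f n * g n) \in symfun_pred.
Proof.
have /symfun_predP[sf cf [d df]] := valP f.
have /symfun_predP[sg cg [e eg]] := valP g.
apply/symfun_predP; split=> [n|n|].
- by apply: rpredM; [exact: sf | exact: sg].
- by rewrite -[RHS]/(sym_val f n * sym_val g n) -cf -cg; exact: rmorphM.
exists (d + e).+1 => n; apply: leq_trans (msizeM_le _ _) _.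
by rewrite ltnS leq_add.
Qed.

Definition sym_one : symfun := SymFun symfun1_subproof.
Definition sym_mul (f g : symfun) : symfun := SymFun (symfunM_subproof f g).

(* Series in two sets of variables, truncated to m variables x and n variables y. *)
Definition pfam2 := dprodz (fun mn : nat * nat => {mpoly int[mn.1 + mn.2]} : zmodType).

Definition sym_ext (f g : symfun) : pfam2 := fun mn =>
  (f mn.1 \mPo [tuple 'X_(lshift mn.2 i) | i < mn.1])
  * (g mn.2 \mPo [tuple 'X_(rshift mn.1 j) | j < mn.2]).

(* Delta f = f(x, y), read in Sym (x) Sym through f (x) g |-> f(x) g(y). *)
Definition sym_comul (f : symfun) : tens symfun symfun :=
  invf (tlift sym_ext) (fun mn => f (mn.1 + mn.2)%N).

Definition SymHopf : gbialg := {|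
  gb_car := symfun;
  gb_homog d f := forall n, f n \is d.-homog;
  gb_mul := sym_mul;
  gb_one := sym_one;
  gb_comul := sym_comul;
  gb_counit f := (f 0%N).@[fun=> 0] |}.

(* f(1, 0, 0, ...) *)
Definition sym_ev1 (f : SymHopf) : int := (f 1%N).@[fun=> 1].

Definition induced_by (A : gbialg) (zeta : A -> int) (Psi : A -> SymHopf) : Prop :=
  graded_hopf_morphism Psi /\ forall x, sym_ev1 (Psi x) = zeta x.

Definition is_comp n (a : seq nat) := (0%N \notin a) && (sumn a == n).

Definition comps n : seq (seq nat) :=
  [seq a <- [seq [seq val i | i <- b] | b : n.-bseq 'I_n.+1] | is_comp n a].

Lemma comps_uniq n : uniq (comps n).
Proof.
apply: filter_uniq; rewrite map_inj_uniq ?enum_uniq // => b c.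
by move/(inj_map val_inj)/val_inj.
Qed.

Lemma mem_comps n a : (a \in comps n) = is_comp n a.
Proof.
rewrite mem_filter andb_idr // => /andP[a0 /eqP sa].
have hsz : (size a <= n)%N.
  rewrite -sa; elim: a a0 {sa} => //= x a IH; rewrite inE negb_or => /andP[x0 a0].
  by rewrite -add1n leq_add ?IH // lt0n eq_sym.
have hle x : x \in a -> (x < n.+1)%N.
  rewrite ltnS -sa; elim: a {a0 sa hsz} => //= y a IH; rewrite inE.
  by case/orP=> [/eqP->|/IH le]; rewrite ?leq_addr // (leq_trans le) ?leq_addl.
have hs : (size [seq inord x : 'I_n.+1 | x <- a] <= n)%N by rewrite size_map.
apply/imageP; exists (Bseq hs) => //=; rewrite -map_comp map_id_in // => x /hle hx.
exact: inordK.
Qed.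

(* M_a = \sum_(i_1 < ... < i_l) x_(i_1)^(a_1) ... x_(i_l)^(a_l) *)
Definition Mqsym (a : seq nat) : pfam := fun n =>
  \sum_(t : (size a).-tuple 'I_n | sorted ltn (map val t))
     \prod_(j < size a) 'X_(tnth t j) ^+ nth 0%N a j.

(* In the library a representation acts on row vectors on the right, and the
   product s * t of permutations is "s, then t"; hence representations of a
   group of permutations are left modules for the usual composition. *)

Section Reps.

Variable k : fieldType.

Section Groth.

Variables (gT : finGroupType) (G : {group gT}).
Implicit Types V W : representation k G.

Inductive groth_rel : {freeg {classic (representation k G)}} -> Prop :=
| GrothIso V W : mx_rsim V W -> groth_rel (fgen V - fgen W)
| GrothSes V (U : 'M_(rdegree V)) (modU : mxmodule V U) :
    groth_rel (fgen V - fgen (Representation (submod_repr modU))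
                      - fgen (Representation (factmod_repr modU))).

Definition Rgroup : zmodType := presented groth_rel.

Definition rcls V : Rgroup := pgen groth_rel V.

Definition rlift (A : zmodType) (f : representation k G -> A) : Rgroup -> A :=
  @plift _ groth_rel A f.

Definition homrep V W : {vspace 'M[k]_(rdegree V, rdegree W)} :=
  (\bigcap_(g in G) lker (linfun (fun A : 'M[k]_(rdegree V, rdegree W) =>
                                    V g *m A - A *m W g)))%VS.

Definition dimHom V W : nat := \dim (homrep V W).

Definition trivrep : representation k G.
Proof.
by exists 1%N; exists (fun=> 1%:M); split=> // x y _ _; rewrite mulmx1.
Defined.

End Groth.

Section Ext.

Variables (gT1 gT2 : finGroupType) (G1 : {group gT1}) (G2 : {group gT2}).

Section ExtRep.

Variables (V1 : representation k G1) (V2 : representation k G2).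

Fact ext_mx_repr :
  mx_repr (setX_group G1 G2) (fun g => tprod (V1 g.1) (V2 g.2)).
Proof.
split=> [|[x1 x2] [y1 y2]]; first by rewrite !repr_mx1 tprod1.
rewrite !in_setX /= => /andP[x1G x2G] /andP[y1G y2G].
by rewrite !repr_mxM // tprodE.
Qed.

Definition extrep : representation k (setX_group G1 G2) :=
  Representation (MxRepresentation ext_mx_repr).

End ExtRep.

Definition Rext (x : Rgroup G1) (y : Rgroup G2) : Rgroup (setX_group G1 G2) :=
  rlift (fun V => rlift (fun W => rcls (extrep V W)) y) x.

(* The inverse of the isomorphism R(G1) (x) R(G2) -> R(G1 x G2). *)
Definition Rsplit : Rgroup (setX_group G1 G2) -> tens (Rgroup G1) (Rgroup G2) :=
  invf (tlift Rext).

End Ext.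

Section Res.

Variables (gT : finGroupType) (G K : {group gT}) (sKG : K \subset G).

Definition Rres : Rgroup G -> Rgroup K :=
  rlift (fun V => rcls (Representation (subg_repr V sKG))).

End Res.

Section Ind.

Variables (gT aT : finGroupType) (G : {group gT}) (A : {group aT}).
Variables (f : {morphism G >-> aT}) (injf : ('injm f)%g).
Variable sfA : (f @* G)%g \subset A.

Section IndRep.

Variable V : representation k G.

Definition ind_index : finType :=
  ({C : {set aT} | C \in rcosets (f @* G)%g A} * 'I_(rdegree V))%type.

(* V (x)_{k[G]} k[A], in the basis of the e_i (x) x_C, where x_C = repr C
   represents the coset C: if x_C a = f(h) x_D then
   (e_i (x) x_C) a = (e_i h) (x) x_D. *)
Definition ind_mx (a : aT) : 'M[k]_#|ind_index| :=
  \matrix_(p, q)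
     let: (C, i) := enum_val p in
     let: (D, j) := enum_val q in
     \sum_(h in G | (f h * repr (val D) == repr (val C) * a)%g) V h i j.

Lemma ind_step (C : {set aT}) (a : aT) :
    C \in rcosets (f @* G)%g A -> a \in A ->
  exists E : {C : {set aT} | C \in rcosets (f @* G)%g A}, exists2 h, h \in G
    & forall (D : {C : {set aT} | C \in rcosets (f @* G)%g A}) h', h' \in G ->
        (f h' * repr (val D) == repr C * a)%g = (D == E) && (h' == h).
Proof.
case/rcosetsP=> c Ac ->{C} aA.
set x := repr _; have xA : x \in A.
  have /rcosetP[g fg ->] : x \in ((f @* G) :* c)%g by apply: mem_repr_rcoset.
  by rewrite groupM // (subsetP sfA).
have EA : ((f @* G) :* (x * a) \in rcosets (f @* G) A)%g.
  by apply/rcosetsP; exists (x * a)%g; rewrite ?groupM.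
have /rcosetP[g /morphimP[h _ hG ->] rE] :
    repr ((f @* G) :* (x * a))%g \in ((f @* G) :* (x * a))%g.
  exact: mem_repr_rcoset.
exists (exist (fun C : {set aT} => C \in rcosets (f @* G)%g A) _ EA); exists h^-1%g => [|D h' h'G]; first by rewrite groupV.
apply/eqP/andP=> [eq|[/eqP-> /eqP->]] /=; last by rewrite rE morphV // mulKg.
have DE : val D = ((f @* G) :* (x * a))%g.
  case/rcosetsP: (valP D) => d Ad defD.
  have : repr (val D) \in ((f @* G) :* d)%g by rewrite defD mem_repr_rcoset.
  move/rcoset_eqP => rD; rewrite defD -rD; apply/esym/rcoset_eqP.
  by rewrite -eq mem_rcoset mulgK mem_morphim.
split; first by apply/eqP/val_inj.
have eq1 : (f h' * f h = 1)%g.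
  by apply: (mulIg (x * a)%g); rewrite -mulgA -rE -DE eq mul1g.
have hh : (h' * h = 1)%g.
  by apply: (injmP injf); rewrite ?groupM ?group1 // morphM // eq1 morph1.
by apply/eqP; rewrite -[h'](mulgK h) hh mul1g.
Qed.

Fact ind_mx_repr : mx_repr A ind_mx.
Proof.
have step (p : ind_index) a : a \in A ->
  exists E, exists2 h, h \in G & forall q : ind_index,
    (\sum_(g in G | (f g * repr (val q.1) == repr (val p.1) * a)%g) V g p.2 q.2
      = if q.1 == E then V h p.2 q.2 else 0)
    /\ (f h * repr (val E) = repr (val p.1) * a)%g.
  move=> aA; have [E [h hG hE]] := ind_step (valP p.1) aA.
  exists E, h => // q; split; last first.
    by apply/eqP; rewrite hE // !eqxx.
  rewrite (eq_bigl (fun g => (q.1 == E) && (g == h))); last first.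
    move=> g; case gG: (g \in G); first by rewrite hE.
    by apply/esym/negbTE/negP => /andP[_ /eqP eg]; rewrite eg hG in gG.
  by case: eqP => _; rewrite ?big_pred0_eq // big_pred1_eq.
have ent a i j : ind_mx a i j = \sum_(g in G | (f g * repr (val (enum_val j).1)
     == repr (val (enum_val i).1) * a)%g) V g (enum_val i).2 (enum_val j).2.
  by rewrite mxE; case: (enum_val i) => C u; case: (enum_val j) => D v.
split=> [|a b aA bA]; apply/matrixP => i j.
  have [E [h hG hE]] := step (enum_val i) 1%g (group1 A).
  rewrite ent (hE _).1 mxE -(inj_eq enum_val_inj) -pair_eqE /pair_eq /=.
  have [/esym iE h1] : E = (enum_val i).1 /\ h = 1%g.
    have [E' [h' h'G hE']] := ind_step (valP (enum_val i).1) (group1 A).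
    have := hE' E h hG; rewrite (hE (enum_val i)).2 eqxx.
    have := hE' (enum_val i).1 1%g (group1 G).
    rewrite morph1 mul1g mulg1 eqxx => /esym/andP[/eqP -> /eqP ->].
    by move=> /esym/andP[/eqP-> /eqP->].
  rewrite iE h1 repr_mx1 mxE eq_sym.
  by case: eqP.
rewrite ent [RHS]mxE.
have [E [h hG hE]] := step (enum_val i) a aA.
pose q0 l : ind_index := (E, l).
pose p0 : ind_index := (E, (enum_val i).2).
have [E2 [h2 h2G hE2]] := ind_step (valP E) bA.
have [E3 [h3 h3G hE3]] := ind_step (valP (enum_val i).1) (groupM aA bA).
have [e23 eh] : E2 = E3 /\ (h * h2 = h3)%g.
  have /esym := hE3 E2 (h * h2)%g (groupM hG h2G).
  have := hE2 E2 h2 h2G; rewrite !eqxx => /eqP eq2.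
  rewrite morphM // -mulgA eq2 !mulgA (hE p0).2 eqxx.
  by case/andP=> /eqP-> /eqP->.
rewrite (eq_bigl (fun g => ((enum_val j).1 == E3) && (g == h3))); last first.
  move=> g; case gG: (g \in G); first by rewrite hE3.
  by apply/esym/negbTE/negP => /andP[_ /eqP eg]; rewrite eg h3G in gG.
transitivity (\sum_(l < rdegree V) ind_mx a i (enum_rank (q0 l))
                                   * ind_mx b (enum_rank (q0 l)) j).
  under [RHS]eq_bigr => l _.
    rewrite !ent !enum_rankK (hE _).1 /= eqxx.
    rewrite (eq_bigl (fun g => ((enum_val j).1 == E2) && (g == h2))); last first.
      move=> g; case gG: (g \in G); first by rewrite hE2.
      by apply/esym/negbTE/negP => /andP[_ /eqP eg]; rewrite eg h2G in gG.
    over.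
  rewrite e23; case: eqP => _; last first.
    by rewrite big_pred0_eq big1 // => l _; rewrite big_pred0_eq mulr0.
  rewrite big_pred1_eq -eh repr_mxM // mxE.
  by apply: eq_bigr => l _; rewrite big_pred1_eq.
rewrite [RHS](reindex (@enum_rank ind_index)) /=; last first.
  by apply: onW_bij; apply: enum_rank_bij.
rewrite [RHS](eq_bigr (fun p : ind_index =>
   ind_mx a i (enum_rank ((p.1, p.2) : ind_index))
   * ind_mx b (enum_rank ((p.1, p.2) : ind_index)) j)); last by case.
rewrite -[RHS](pair_bigA _ (fun C l => ind_mx a i (enum_rank ((C, l) : ind_index))
                       * ind_mx b (enum_rank ((C, l) : ind_index)) j)) /=.
rewrite [RHS](bigD1 E) //= [X in _ + X]big1 ?addr0 // => C CE.
apply: big1 => l _; rewrite ent enum_rankK (hE _).1 /= (negbTE CE).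
by rewrite mul0r.
Qed.

Definition indrep : representation k A := Representation (MxRepresentation ind_mx_repr).

End IndRep.

Definition Rind : Rgroup G -> Rgroup A := rlift (fun V => rcls (indrep V)).

End Ind.
End Reps.

(* Finite sets with underlying type in Set. The library's finType lives in the
   same universe as its algebraic structures, so that there is no direct sum over
   all N : finType; Set contains finite types of all cardinalities. *)
Record finSet := FinSet {
  fs_car :> Set;
  fs_bound : nat;
  fs_code : fs_car -> 'I_fs_bound;
  fs_decode : 'I_fs_bound -> fs_car;
  fs_codeK : cancel fs_code fs_decode }.

HB.instance Definition _ (N : finSet) :=
  Finite.copy (fs_car N) (can_type (@fs_codeK N)).

Definition mkFinSet (T : Set) (c : Finite T) : finSet :=
  let fT : finType := Finite.Pack c in
  @FinSet T #|fT| (@enum_rank fT) enum_val (@enum_rankK fT).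

Definition emptyF : finSet := mkFinSet (Finite.on void).
Definition sumF (N M : finSet) : finSet := mkFinSet (Finite.on (N + M)%type).
Definition subF (N : finSet) (K : {set N}) : finSet :=
  mkFinSet (Finite.on {x : N | x \in K}).

Definition inj (N M : finSet) := {w : {ffun N -> M} | injectiveb w}.

Definition inj_fun N M (w : inj N M) : N -> M := val w.
Coercion inj_fun : inj >-> Funclass.

Fact mkInj_subproof (N M : finSet) (f : N -> M) :
  injective f -> injectiveb (finfun f).
Proof. by move=> fI; apply/injectiveP => x y; rewrite !ffunE => /fI. Qed.

Definition mkInj (N M : finSet) (f : N -> M) (fI : injective f) : inj N M :=
  exist (fun w : {ffun N -> M} => injectiveb w) (finfun f) (mkInj_subproof fI).

Lemma mkInjE (N M : finSet) (f : N -> M) (fI : injective f) : mkInj fI =1 f.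
Proof. by move=> x; rewrite /inj_fun ffunE. Qed.

Lemma injP N M (w w' : inj N M) : w =1 w' -> w = w'.
Proof. by move=> ww'; apply/val_inj/ffunP. Qed.

Lemma inj_inj N M (w : inj N M) : injective w.
Proof. exact/injectiveP/(valP w). Qed.

Definition id_inj N : inj N N := mkInj (@inj_id N).
Definition comp_inj N M P (w : inj M P) (v : inj N M) : inj N P :=
  mkInj (inj_comp (@inj_inj _ _ w) (@inj_inj _ _ v)).

Definition incl (N : finSet) (K : {set N}) : inj (subF K) N :=
  mkInj (val_inj : injective (fun x : subF K => sval x)).
Definition inlI (N M : finSet) : inj N (sumF N M) :=
  mkInj ((fun x y (e : inl x = inl y) => let: erefl in _ = z := e
            return x = (if z is inl y' then y' else x) in erefl)
         : injective (fun x : N => inl x : sumF N M)).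
Definition inrI (N M : finSet) : inj M (sumF N M) :=
  mkInj ((fun x y (e : inr x = inr y) => let: erefl in _ = z := e
            return x = (if z is inr y' then y' else x) in erefl)
         : injective (fun x : M => inr x : sumF N M)).

Record bij (N M : finSet) := Bij {
  bij_fwd :> inj N M;
  bij_inv : inj M N;
  bijK : cancel bij_fwd bij_inv;
  bijKV : cancel bij_inv bij_fwd }.

Definition perm_inj_of (N : finSet) (w : {perm N}) : inj N N := mkInj (@perm_inj _ w).

Fact perm_bijK (N : finSet) (w : {perm N}) :
  cancel (perm_inj_of w) (perm_inj_of w^-1).
Proof. by move=> x; rewrite !mkInjE permK. Qed.

Fact perm_bijKV (N : finSet) (w : {perm N}) :
  cancel (perm_inj_of w^-1) (perm_inj_of w).
Proof. by move=> x; rewrite !mkInjE permKV. Qed.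

Definition perm_bij (N : finSet) (w : {perm N}) : bij N N :=
  Bij (perm_bijK w) (perm_bijKV w).

Record youngSet := YoungSet {
  ys :> finSet -> finSet;
  ymap : forall N M, inj N M -> inj (ys N) (ys M);
  ymap_id : forall N, ymap (id_inj N) = id_inj (ys N);
  ymap_comp : forall N M P (w : inj M P) (v : inj N M),
    ymap (comp_inj w v) = comp_inj (ymap w) (ymap v);
  ys_empty : #|{: ys emptyF}| = 0%N;
  ys_cap : forall (N : finSet) (K L : {set N}),
    ymap (incl K) @: [set: ys (subF K)] :&: ymap (incl L) @: [set: ys (subF L)]
      = ymap (incl (K :&: L)) @: [set: ys (subF (K :&: L))] }.

Section YoungTheory.

Variable Y : youngSet.

Definition ysub (N : finSet) (K : {set N}) : {set Y N} :=
  ymap Y (incl K) @: [set: Y (subF K)].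

Lemma ymap_id_eq (N : finSet) (w : inj N N) : w =1 id -> ymap Y w =1 id.
Proof.
move=> w1 y; rewrite (_ : w = id_inj N); first by rewrite ymap_id mkInjE.
by apply: injP => x; rewrite w1 mkInjE.
Qed.

Lemma ymap_comp_eq N M P (w : inj M P) (v : inj N M) (u : inj N P) :
  (forall x, u x = w (v x)) -> forall y, ymap Y u y = ymap Y w (ymap Y v y).
Proof.
move=> uE y; rewrite (_ : u = comp_inj w v); first by rewrite ymap_comp mkInjE.
by apply: injP => x; rewrite uE mkInjE.
Qed.

Lemma ymap_permK (N : finSet) (w : {perm N}) y :
  ymap Y (perm_inj_of w) (ymap Y (perm_inj_of w^-1) y) = y.
Proof.
rewrite -(@ymap_comp_eq _ _ _ _ _ (id_inj N)) ?ymap_id ?mkInjE // => x.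
by rewrite !mkInjE permKV.
Qed.

Lemma ymap_permKV (N : finSet) (w : {perm N}) y :
  ymap Y (perm_inj_of w^-1) (ymap Y (perm_inj_of w) y) = y.
Proof. by have := ymap_permK w^-1 y; rewrite invgK. Qed.

Lemma ymap_square N M P Q (a : inj N M) (b : inj M Q) (c : inj N P) (d : inj P Q) :
  (forall x, b (a x) = d (c x)) ->
  forall y, ymap Y b (ymap Y a y) = ymap Y d (ymap Y c y).
Proof.
move=> sq y; rewrite -(@ymap_comp_eq _ _ _ b a (comp_inj b a)) => [|x].
  by apply: ymap_comp_eq => x; rewrite mkInjE /= sq.
by rewrite mkInjE.
Qed.

End YoungTheory.

Section Colorings.

Variables (Y : youngSet) (X : finType) (triv : X).
Implicit Types N K L M : finSet.

Definition supp N (F : {ffun Y N -> X}) : {set Y N} := [set y | F y != triv].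

(* (w F)(y) = F (w^-1 y) *)
Definition wact N M (w : bij N M) (F : {ffun Y N -> X}) : {ffun Y M -> X} :=
  [ffun y => F (ymap Y (bij_inv w) y)].

Lemma wact1 N (F : {ffun Y N -> X}) : wact (perm_bij 1) F = F.
Proof.
apply/ffunP => y; rewrite ffunE; congr (F _).
by apply: ymap_id_eq => x; rewrite mkInjE invg1 perm1.
Qed.

Lemma wactM N (F : {ffun Y N -> X}) (s t : {perm N}) :
  wact (perm_bij (s * t)) F = wact (perm_bij t) (wact (perm_bij s) F).
Proof.
apply/ffunP => y; rewrite !ffunE; congr (F _).
by apply: ymap_comp_eq => x; rewrite !mkInjE invMg permM.
Qed.

Definition aut_set N (F : {ffun Y N -> X}) : {set {perm N}} :=
  [set w | wact (perm_bij w) F == F].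

Fact aut_group_set N (F : {ffun Y N -> X}) : group_set (aut_set F).
Proof.
apply/group_setP; split=> [|s t]; rewrite !inE ?wact1 // => /eqP sF /eqP tF.
by rewrite wactM sF tF.
Qed.

Definition autF N (F : {ffun Y N -> X}) : {group {perm N}} := Group (aut_group_set F).

Lemma autFP N (F : {ffun Y N -> X}) (w : {perm N}) :
  reflect (forall y, F (ymap Y (perm_inj_of w) y) = F y) (w \in autF F).
Proof.
rewrite inE; apply: (iffP eqP) => [wF y|wF].
  by rewrite -[in LHS]wF ffunE /= ymap_permKV.
by apply/ffunP => y; rewrite ffunE /= -[in RHS](ymap_permK w y) wF.
Qed.

Definition joinF K L (F : {ffun Y K -> X}) (G : {ffun Y L -> X}) :
    {ffun Y (sumF K L) -> X} :=
  [ffun y => if [pick u | ymap Y (inlI K L) u == y] is Some u then F u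
             else if [pick v | ymap Y (inrI K L) v == y] is Some v then G v
             else triv].

Definition restrF N (F : {ffun Y N -> X}) (K : {set N}) : {ffun Y (subF K) -> X} :=
  [ffun u => F (ymap Y (incl K) u)].

Definition emptyfun : {ffun Y emptyF -> X} := [ffun=> triv].

Section SumPerm.

Variables K L : finSet.

Definition sum_fun (v : {perm K}) (w : {perm L}) (x : sumF K L) : sumF K L :=
  match x with inl y => inl (v y) | inr z => inr (w z) end.

Fact sum_fun_inj v w : injective (sum_fun v w).
Proof.
by move=> [x|x] [y|y] //= [] e; rewrite (perm_inj e).
Qed.

Definition sum_perm (vw : {perm K} * {perm L}) : {perm (sumF K L)} :=
  perm (@sum_fun_inj vw.1 vw.2).

Variables (F : {ffun Y K -> X}) (G : {ffun Y L -> X}).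

Fact sum_permM : {in setX_group (autF F) (autF G) &,
  {morph sum_perm : x y / (x * y)%g >-> (x * y)%g}}.
Proof.
by move=> [v w] [v' w'] _ _; apply/permP => -[x|x]; rewrite permM !permE /= permM.
Qed.

Definition sum_morph : {morphism setX_group (autF F) (autF G) >-> {perm (sumF K L)}} :=
  Morphism sum_permM.

Fact sum_morph_inj : ('injm sum_morph)%g.
Proof.
apply/injmP => -[v w] [v' w'] _ _ e.
congr pair; apply/permP => x.
  by have := congr1 (fun s : {perm (sumF K L)} => s (inl x)) e; rewrite !permE => -[].
by have := congr1 (fun s : {perm (sumF K L)} => s (inr x)) e; rewrite !permE => -[].
Qed.

Fact sum_morph_sub :
  (sum_morph @* setX_group (autF F) (autF G))%g \subset autF (joinF F G).
Proof.
apply/subsetP => _ /morphimP[[v w] _ /setXP[/autFP vF /autFP wG] ->].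
apply/autFP => y; rewrite !ffunE.
set s := perm_inj_of _.
have sl u : ymap Y s (ymap Y (inlI K L) u)
          = ymap Y (inlI K L) (ymap Y (perm_inj_of v) u).
  by apply: ymap_square => x; rewrite !mkInjE permE.
have sr u : ymap Y s (ymap Y (inrI K L) u)
          = ymap Y (inrI K L) (ymap Y (perm_inj_of w) u).
  by apply: ymap_square => x; rewrite !mkInjE permE.
pose pl z u := ymap Y (inlI K L) u == z; pose pr z u := ymap Y (inrI K L) u == z.
case: (pickP (pl (ymap Y s y))) => [u /eqP eu|nu];
  case: (pickP (pl y)) => [u' /eqP eu'|nu'].
- move: eu; rewrite -eu' sl => /inj_inj ->; exact: vF.
- have := nu' (ymap Y (perm_inj_of v^-1) u); rewrite /pl; case: eqP => // -[].
  by apply: (@inj_inj _ _ (ymap Y s)); rewrite sl ymap_permK.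
- by have := nu (ymap Y (perm_inj_of v) u'); rewrite /pl -sl eu' eqxx.
case: (pickP (pr (ymap Y s y))) => [u /eqP eu|mu];
  case: (pickP (pr y)) => [u' /eqP eu'|mu'] //.
- move: eu; rewrite -eu' sr => /inj_inj ->; exact: wG.
- have := mu' (ymap Y (perm_inj_of w^-1) u); rewrite /pr; case: eqP => // -[].
  by apply: (@inj_inj _ _ (ymap Y s)); rewrite sr ymap_permK.
by have := mu (ymap Y (perm_inj_of w) u'); rewrite /pr -sr eu' eqxx.
Qed.

End SumPerm.
End Colorings.

Section RestrPerm.

Variables (Y : youngSet) (X : finType) (N : finSet).
Implicit Types (F : {ffun Y N -> X}) (K : {set N}) (w : {perm N}).

(* w|_K if w K = K, and the identity otherwise *)
Definition sub_perm K w : {perm (subF K)} :=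
  insubd (1%g : {perm (subF K)})
    [ffun x : subF K => insubd (x : {x | x \in K}) (w (sval x)) : subF K].

Lemma sub_permE K w (x : subF K) :
  (forall y, (w y \in K) = (y \in K)) -> sval (sub_perm K w x) = w (sval x).
Proof.
move=> wK; pose g (x : subF K) : subF K := insubd (x : {x | x \in K}) (w (sval x)).
have gE z : sval (g z) = w (sval z).
  by rewrite [LHS](insubdK (z : {x | x \in K})) // unfold_in wK (valP (z : {x | x \in K})).
have gI : injectiveb [ffun x => g x].
  apply/injectiveP => y z; rewrite !ffunE => /(congr1 (fun u : subF K => sval u)).
  by rewrite !gE => /perm_inj /val_inj.
by rewrite -gE -pvalE [pval _](insubdK (1%g : {perm (subF K)})) // ffunE.
Qed.

Definition stabF F K : {group {perm N}} := 'N_(autF F)(K | 'P)%G.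

Lemma stabF_sub F K : stabF F K \subset autF F.
Proof. exact: subsetIl. Qed.

Lemma stabF_mem F K w : w \in stabF F K -> forall y, (w y \in K) = (y \in K).
Proof. by case/setIP => _ wK y; rewrite -[RHS](astabs_act y wK). Qed.

Definition restr_pair K w := (sub_perm K w, sub_perm (~: K) w).

Fact restr_pairM F K :
  {in stabF F K &, {morph restr_pair K : v w / (v * w)%g >-> (v * w)%g}}.
Proof.
move=> v w vS wS; have [[vK wK] vwK] := (stabF_mem vS, stabF_mem wS, stabF_mem (groupM vS wS)).
apply: (congr2 pair); apply/permP => x; apply: val_inj;
  by rewrite permM /= !sub_permE ?permM // => y; rewrite !inE ?vK ?wK ?vwK.
Qed.

Definition restr_morph F K :
    {morphism stabF F K >-> {perm (subF K)} * {perm (subF (~: K))}} :=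
  Morphism (@restr_pairM F K).

Fact restr_morph_inj F K : ('injm (restr_morph F K))%g.
Proof.
apply/injmP => v w /stabF_mem vK /stabF_mem wK [eK eC]; apply/permP => x.
case xK: (x \in K).
  have := congr1 (fun s : {perm (subF K)} => sval (s (exist _ x xK))) eK.
  by rewrite !sub_permE.
have xC : x \in ~: K by rewrite inE xK.
have := congr1 (fun s : {perm (subF (~: K))} => sval (s (exist _ x xC))) eC.
by rewrite !sub_permE // => y; rewrite !inE ?vK ?wK.
Qed.

Lemma sub_perm_aut F (L : {set N}) w :
  w \in autF F -> (forall y, (w y \in L) = (y \in L)) ->
  sub_perm L w \in autF (restrF F L).
Proof.
move=> /autFP wF wL; apply/autFP => y; rewrite !ffunE -[RHS]wF; congr (F _).
by apply: ymap_square => x; rewrite !mkInjE sub_permE.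
Qed.

Fact restr_morph_sub F K :
  (restr_morph F K @* stabF F K)%g
    \subset setX_group (autF (restrF F K)) (autF (restrF F (~: K))).
Proof.
apply/subsetP => _ /morphimP[w _ wS ->]; have wF := subsetP (stabF_sub F K) w wS.
have wK := stabF_mem wS; rewrite inE !sub_perm_aut // => y.
by rewrite !inE wK.
Qed.

End RestrPerm.

Section PermRep.

Variables (k : fieldType) (aT : finGroupType) (G : {group aT}) (T : finType).
Variables (to : {action aT &-> T}) (S : {set T}) (GS : [acts G, on S | to]%g).

Definition permrep_mx (a : aT) : 'M[k]_#|S| :=
  \matrix_(i, j) (to (enum_val i) a == enum_val j)%:R.

Fact permrep_mx_repr : mx_repr G permrep_mx.
Proof.
split=> [|a b aG bG]; apply/matrixP => i j; rewrite !mxE.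
  by rewrite act1 (inj_eq enum_val_inj).
have iS : to (enum_val i) a \in S by rewrite (acts_act GS) // enum_valP.
pose l0 := enum_rank_in iS (to (enum_val i) a).
have l0E : enum_val l0 = to (enum_val i) a by rewrite enum_rankK_in.
rewrite (bigD1 l0) //= !mxE l0E eqxx mul1r -actM big1 ?addr0 // => l ll0.
by rewrite !mxE -l0E (inj_eq enum_val_inj) eq_sym (negbTE ll0) mul0r.
Qed.

Definition permrep : representation k G := Representation (MxRepresentation permrep_mx_repr).

End PermRep.

Section CompRep.

Variables (Y : youngSet) (X : finType) (triv : X) (N : finSet).
Implicit Types (F : {ffun Y N -> X}) (a : seq nat).

Definition CompN a : {set (size a).-tuple {set N}} :=
  [set t : (size a).-tuple {set N} | [&& set0 \notin t,
               [forall i, forall j, (i != j) ==> [disjoint tnth t i & tnth t j]],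
               \bigcup_i tnth t i == setT
             & [forall i : 'I_(size a), #|tnth t i| == nth 0%N a i]]].

Definition ytuple l (t : l.-tuple {set N}) : {set Y N} := \bigcup_i ysub Y (tnth t i).

Definition CompF F a : {set (size a).-tuple {set N}} :=
  [set t : (size a).-tuple {set N} in CompN a | supp triv F :&: ytuple t == set0].

Definition tuple_act l (t : l.-tuple {set N}) (w : {perm N}) : l.-tuple {set N} :=
  [tuple w @: tnth t i | i < l].

Fact tuple_act_is_action l : is_action [set: {perm N}] (@tuple_act l).
Proof.
split=> [w t t' e|t v w _ _]; apply: eq_from_tnth => i.
  have := congr1 (fun u => tnth u i) e; rewrite !tnth_mktuple.
  exact/imset_inj/perm_inj.
rewrite !tnth_mktuple -imset_comp; apply: eq_imset => x.
by rewrite permM.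
Qed.

Definition tuple_action l := Action (@tuple_act_is_action l).

Lemma ysub_perm (K : {set N}) (w : {perm N}) :
  ysub Y (w @: K) = ymap Y (perm_inj_of w) @: ysub Y K.
Proof.
suff sub (L : {set N}) v : ymap Y (perm_inj_of v) @: ysub Y L \subset ysub Y (v @: L).
  apply/eqP; rewrite eqEsubset sub andbT.
  apply/subsetP => y yK; rewrite -[y](ymap_permK w); apply: imset_f.
  have -> : K = (w^-1)%g @: (w @: K).
    by rewrite -imset_comp -[LHS]imset_id; apply: eq_imset => x /=; rewrite permK.
  by apply: (subsetP (sub _ _)); apply: imset_f.
apply/subsetP => _ /imsetP[_ /imsetP[u _ ->] ->].
have fS (x : subF L) : v (sval x) \in v @: L.
  by apply: imset_f; exact: (valP (x : {x | x \in L})).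
pose f (x : subF L) : subF (v @: L) := exist (fun y => y \in v @: L) _ (fS x).
have fI : injective f.
  by move=> x y /(congr1 (fun z : subF (v @: L) => sval z)) /= /perm_inj /val_inj.
rewrite (@ymap_square Y _ _ _ _ _ _ (mkInj fI) (incl (v @: L))) ?imset_f //.
by move=> x; rewrite !mkInjE.
Qed.

Fact CompF_acts F a : [acts autF F, on CompF F a | tuple_action (size a)]%g.
Proof.
suff sub w t : w \in autF F -> t \in CompF F a -> tuple_act t w \in CompF F a.
  apply/subsetP => w wF; rewrite inE in_setT /= inE.
  by apply/subsetP => t tF; rewrite inE; exact: sub.
move=> /autFP wF; rewrite !inE => /andP[/and4P[t0 tD tU tC] tS].
have tn i : tnth (tuple_act t w) i = w @: tnth t i by rewrite tnth_mktuple.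
apply/andP; split; first (apply/and4P; split).
- apply/negP => /tnthP[i]; rewrite tn => /esym/eqP; rewrite imset_eq0 => /eqP ti.
  by move/negP: t0; apply; apply/tnthP; exists i.
- apply/forallP => i; apply/forallP => j; apply/implyP => ij.
  rewrite !tn imset_disjoint; last exact: perm_inj.
  by move/forallP/(_ i)/forallP/(_ j)/implyP: tD; apply.
- apply/eqP/setP => x; rewrite inE; apply/bigcupP.
  have : (w^-1)%g x \in \bigcup_i tnth t i by rewrite (eqP tU) inE.
  case/bigcupP => i _ xi; exists i => //; rewrite tn; apply/imsetP.
  by exists ((w^-1)%g x); rewrite ?permKV.
- by apply/forallP => i; rewrite tn card_imset; [exact: (forallP tC) | exact: perm_inj].
apply/eqP/setP => y; rewrite [RHS]inE; apply/negP => /setIP[ys /bigcupP[i _]].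
rewrite tn ysub_perm => /imsetP[z zi ey].
have : z \in supp triv F :&: ytuple t.
  by rewrite inE; apply/andP; split;
     [move: ys; rewrite !inE ey wF | apply/bigcupP; exists i].
by rewrite (eqP tS) inE.
Qed.

Definition rho (k : fieldType) F a : representation k (autF F) :=
  permrep k (CompF_acts F a).

End CompRep.

Section Hopf.

Variables (k : closedFieldType) (Y : youngSet) (H : finZmodType).
Implicit Types (N K L M : finSet).

(* Representatives of the irreducible representations of H. *)
Definition Hhat : finType := DecSocleType (regular_repr k [set: H]%G).
Definition trivH : Hhat := principal_comp (DecSocleType (regular_repr k [set: H]%G)).

Notation funY N := {ffun Y N -> Hhat}.

Section Ad.

Variables (N M : finSet) (w : bij N M) (F : funY N).

Fact conj_bij_inj (v : {perm M}) : injective (fun x : N => bij_inv w (v (w x))).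
Proof. by move=> x y /inj_inj /perm_inj /inj_inj. Qed.

Definition conj_bij (v : {perm M}) : {perm N} := perm (@conj_bij_inj v).

Lemma conj_bij_aut v : v \in autF (wact w F) -> conj_bij v \in autF F.
Proof.
move=> /autFP vF; apply/autFP => y.
have e z : F z = wact w F (ymap Y w z).
  rewrite ffunE; congr (F _); apply/esym.
  rewrite -(@ymap_comp_eq Y _ _ _ _ _ (id_inj N)) ?ymap_id ?mkInjE // => x.
  by rewrite mkInjE bijK.
rewrite !e -[RHS]vF; congr (wact w F _).
by apply: ymap_square => x; rewrite !mkInjE permE bijKV.
Qed.

Section AdRep.

Variable V : representation k (autF F).

Fact Ad_mx_repr : mx_repr (autF (wact w F)) (fun v => V (conj_bij v)).
Proof.
split=> [|u v uG vG].
  by rewrite (_ : conj_bij 1 = 1%g) ?repr_mx1 //; apply/permP => x;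
     rewrite permE !perm1 bijK.
rewrite -repr_mxM ?conj_bij_aut //; congr (V _); apply/permP => x.
by rewrite !permE /= !permE bijKV.
Qed.

Definition Adrep : representation k (autF (wact w F)) :=
  Representation (MxRepresentation Ad_mx_repr).

End AdRep.

Definition Ad : Rgroup k (autF F) -> Rgroup k (autF (wact w F)) :=
  rlift (fun V => rcls (Adrep V)).

End Ad.

Record Mgen := MGen {
  mg_set : finSet; mg_fun : funY mg_set; mg_rep : Rgroup k (autF mg_fun) }.

Inductive Mrel : {freeg {classic Mgen}} -> Prop :=
| MrelAdd N (F : funY N) (x y : Rgroup k (autF F)) :
    Mrel (fgen (MGen (x + y)) - fgen (MGen x) - fgen (MGen y))
| MrelAd N M (w : bij N M) (F : funY N) (x : Rgroup k (autF F)) :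
    Mrel (fgen (MGen x) - fgen (MGen (Ad w x))).

Definition Mcar : zmodType := presented Mrel.

Definition Min N (F : funY N) (x : Rgroup k (autF F)) : Mcar := pgen Mrel (MGen x).

Definition Mlift (A : zmodType)
    (f : forall N (F : funY N), Rgroup k (autF F) -> A) : Mcar -> A :=
  @plift _ Mrel A (fun g => f (mg_set g) (mg_fun g) (mg_rep g)).

Definition Mhomog n (u : Mcar) : Prop :=
  spanned (fun v => exists N (F : funY N) (x : Rgroup k (autF F)),
                      #|{: N}| = n /\ v = Min x) u.

Definition Mmul (u v : Mcar) : Mcar :=
  Mlift (fun K F x => Mlift (fun L G y =>
    Min (Rind (@sum_morph_inj Y Hhat K L F G) (@sum_morph_sub Y Hhat trivH K L F G)
              (Rext x y))) v) u.

Definition Mone : Mcar := Min (rcls (trivrep k (autF (emptyfun Y trivH)))).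

Definition Mcomul : Mcar -> tens Mcar Mcar :=
  Mlift (fun N F x =>
    \sum_(K in orbit_transversal ('P^*) (autF F) [set: {set N}])
       tmap (@Min _ (restrF F K)) (@Min _ (restrF F (~: K)))
         (Rsplit (Rind (@restr_morph_inj Y Hhat N F K) (@restr_morph_sub Y Hhat N F K)
                       (Rres (stabF_sub F K) x)))).

(* In degree 0 the group Aut F is trivial and R(Aut F) = Z. *)
Definition Mcounit : Mcar -> int :=
  Mlift (fun N F => rlift (fun V =>
    if #|{: N}| == 0%N then (rdegree V)%:Z else 0)).

Definition hopfM : gbialg := {|
  gb_car := Mcar; gb_homog := Mhomog; gb_mul := Mmul; gb_one := Mone;
  gb_comul := Mcomul; gb_counit := Mcounit |}.

(* The additive extension of zeta from Irr(Aut F) to R(Aut F): by Schur's lemma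
   the coordinates of the class of V in this basis are the dim Hom(i, V). *)
Definition zetaM : hopfM -> int :=
  Mlift (fun N F => rlift (fun V =>
    let Irr := DecSocleType (regular_repr k (autF F)) in
    \sum_(i : Irr)
      (if (supp trivH F == set0) && (i == principal_comp Irr) then 1 else 0)
        *+ dimHom (Representation (irr_repr i)) V)).

(* Fun(Y_N, H), with the pointwise group law *)
Notation FunH N := {dffun Y N -> H}.

Section Pi.

Variables (N : finSet) (F : funY N).

Lemma Hhat_degree (i : Hhat) : irr_degree i = 1%N.
Proof.
apply: irr_degree_abelian; last exact: FinRing.zmod_abelian.
exact: group_closure_closed_field.
Qed.

Lemma trHhatM (i : Hhat) (g h : H) :
  \tr (irr_repr i (g * h)%g) = \tr (irr_repr i g) * \tr (irr_repr i h).
Proof.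
rewrite repr_mxM ?inE //; have := Hhat_degree i.
move: (irr_repr i g) (irr_repr i h); case: _ / (esym (Hhat_degree i)) => A B _.
by rewrite !trace_mx11 mxE big_ord1.
Qed.

(* The representations F(y) have dimension 1, so their tensor product is the
   product of their characters. *)
Fact pi_mx_repr : mx_repr [set: FunH N]
  (fun f => (\prod_(y : Y N) \tr (irr_repr (F y) (f y)))%:M : 'M[k]_1).
Proof.
split=> [|f g _ _].
  rewrite big1 // => y _; rewrite ffunE repr_mx1 mxtrace1 Hhat_degree //.
rewrite -scalar_mxM -big_split /=; congr (_%:M); apply: eq_bigr => y _.
by rewrite ffunE trHhatM.
Qed.

Definition piF : representation k [set: FunH N]%G :=
  Representation (MxRepresentation pi_mx_repr).

End Pi.

Section BAct.

Variables (N M : finSet) (w : bij N M) (V : representation k [set: FunH N]%G).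

Fact bact_mx_repr : mx_repr [set: FunH M]
  (fun f => V [ffun y => f (ymap Y w y)]).
Proof.
split=> [|f g _ _].
  rewrite -(repr_mx1 V); congr (V _); apply/ffunP => y; by rewrite !ffunE.
rewrite -repr_mxM ?inE //; congr (V _); apply/ffunP => y; by rewrite !ffunE.
Qed.

Definition bactrep : representation k [set: FunH M]%G :=
  Representation (MxRepresentation bact_mx_repr).

End BAct.

Definition Bact N M (w : bij N M) :
    Rgroup k [set: FunH N]%G -> Rgroup k [set: FunH M]%G :=
  rlift (fun V => rcls (bactrep w V)).

Record Bgen := BGen { bg_set : finSet; bg_rep : Rgroup k [set: FunH bg_set]%G }.

Inductive Brel : {freeg {classic Bgen}} -> Prop :=
| BrelAdd N (x y : Rgroup k [set: FunH N]%G) :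
    Brel (fgen (BGen (x + y)) - fgen (BGen x) - fgen (BGen y))
| BrelAct N M (w : bij N M) (x : Rgroup k [set: FunH N]%G) :
    Brel (fgen (BGen x) - fgen (BGen (Bact w x))).

Definition Bcar : zmodType := presented Brel.

Definition Bin N (x : Rgroup k [set: FunH N]%G) : Bcar := pgen Brel (BGen x).

Definition Bpi N (F : funY N) : Bcar := Bin (rcls (piF F)).

(* The additive map with prescribed values on the classes of the pi_F; by Schur's
   lemma the coordinates of the class of V in the basis of the pi_F are the
   dim Hom(pi_F, V). *)
Definition Blift (A : zmodType) (f : forall N, funY N -> A) : Bcar -> A :=
  @plift _ Brel A (fun g => rlift (fun V =>
    \sum_(F : funY (bg_set g)) f _ F *+ dimHom (piF F) V) (bg_rep g)).

Definition Bhomog n (u : Bcar) : Prop :=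
  spanned (fun v => exists N (F : funY N), #|{: N}| = n /\ v = Bpi F) u.

Definition Bmul (u v : Bcar) : Bcar :=
  Blift (fun K F => Blift (fun L G => Bpi (joinF trivH F G)) v) u.

Definition Bone : Bcar := Bpi (emptyfun Y trivH).

Definition Bcomul : Bcar -> tens Bcar Bcar :=
  Blift (fun N F =>
    \sum_(K : {set N}) tpure (Bpi (restrF F K)) (Bpi (restrF F (~: K)))).

Definition Bcounit : Bcar -> int :=
  Blift (fun N F => if #|{: N}| == 0%N then 1 else 0 : int).

Definition hopfB : gbialg := {|
  gb_car := Bcar; gb_homog := Bhomog; gb_mul := Bmul; gb_one := Bone;
  gb_comul := Bcomul; gb_counit := Bcounit |}.

Definition zetaB : hopfB -> int :=
  Blift (fun N F => if supp trivH F == set0 then 1 else 0 : int).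

End Hopf.

(* Main.v *)
Require Import Defs.
From HB Require Import structures.
From mathcomp Require Import all_boot all_order all_algebra all_fingroup all_field all_character.
From mathcomp Require Import boolp freeg mpoly.
From mathcomp Require pgroup.

Set Implicit Arguments.
Unset Strict Implicit.
Unset Printing Implicit Defensive.

Import GRing.Theory.
Local Open Scope ring_scope.

(** For F in Fun(Y_N, H^) and a permutation w of N, let theta F w be the
    generating function

      sum of prod_(v in N) x_(c v)

    over the colourings c of N by x_0, x_1, ... that are constant on the cycles
    of w and proper: no y in supp F lies in Y_L for L a colour class. The list
    of nonempty colour classes of a colouring is an element of Comp_(F, a), so
    the coefficient of M_a in theta F w is the number of fixed points of w on
    Comp_(F, a), which is the trace of w on rho_(F, a) (lcoef_theta). Hence the
    two right-hand sides of the statement are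

      Psi_B(pi_F) = theta F 1   and
      Psi_M(gamma) = |Aut F|^-1 sum_(w in Aut F) chi_gamma(w) theta F w,

    the second one after extending scalars from Z to k, where the character
    formula for dim Hom holds because k has characteristic zero.

    Everything is then read off from properties of colourings. Colouring a
    disjoint union is colouring both parts independently (theta_join); a
    colouring by two alphabets x and y is a subset K, coloured by x, and its
    complement, coloured by y (theta_split_part and theta_part_ext); both are
    cases of sum_split. Colouring with one colour is possible exactly when
    supp F is empty (theta_eval1). Frobenius reciprocity (avg_ind) turns the
    inductions in the product and the coproduct of M into restrictions of
    theta, and the sum over orbit representatives K into a sum over all K
    (sum_orbit_transversal). This makes both maps morphisms of graded
    bialgebras which induce the given characters.

    Such a morphism is unique (induced_by_unique): comultiplication gives the
    value of Psi x in n + 1 variables from values in n variables and in one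
    variable, and in one variable a homogeneous function is determined by its
    value at 1, that is by the character.

    Elements of the Grothendieck groups, of the tensor products and of M and B
    are classes of formal sums, and maps out of these groups are computed on a
    chosen formal sum. The composite of such a map with an additive map g can
    be compared with any additive map on generators alone (plift_morph). Two
    inverses of isomorphisms have to be unfolded as well: Sym (x) Sym is the
    group of symmetric functions in two alphabets (tlift_ext_inj,
    sym_double_ext), and R(G1) (x) R(G2) maps onto R(G1 x G2)
    (tlift_Rext_surj). *)

(** * Abelian groups given by generators and relations *)

Section Additive.

Variables (A B : zmodType) (f : A -> B).
Hypothesis fD : {morph f : x y / x + y}.

Lemma morphD0 : f 0 = 0.
Proof. by apply: (addIr (f 0)); rewrite add0r -fD addr0. Qed.

Lemma morphDN : {morph f : x / - x}.
Proof. by move=> x; apply: (addIr (f x)); rewrite -fD !addNr morphD0. Qed.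

Lemma morphD_sum I (r : seq I) (P : pred I) (F : I -> A) :
  f (\sum_(i <- r | P i) F i) = \sum_(i <- r | P i) f (F i).
Proof. by elim/big_rec2: _ => [|i x y _ <-]; rewrite ?morphD0. Qed.

Lemma morphDMn n : {morph f : x / x *+ n}.
Proof. by move=> x; elim: n => [|n IH]; rewrite ?morphD0 // !mulrS fD IH. Qed.

Lemma morphDMz n : {morph f : x / x *~ n}.
Proof. by move=> x; case: n => n; rewrite /intmul ?morphDN morphDMn. Qed.

End Additive.


Section PresentedTheory.

Lemma zquot_eqP (V : zmodType) (Q : V -> Prop) x y :
  \pi_(zquot Q)%qT x = \pi_(zquot Q)%qT y <-> spanned Q (x - y).
Proof.
have e : (x == y %[mod {ideal_quot (span_pred Q)}])%qT = (x - y \in span_pred Q).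
  by rewrite Quotient.idealrBE.
split=> [/eqP|h]; last apply/eqP; rewrite [_ == _]e inE; last exact/asboolP.
by move/asboolP.
Qed.

Lemma zquot_piD (V : zmodType) (Q : V -> Prop) :
  {morph \pi_(zquot Q)%qT : x y / x + y}.
Proof. exact: (raddfD (\pi_{ideal_quot (span_pred Q)}%qT)). Qed.

Variables (X : Type) (P : {freeg {classic X}} -> Prop).

(** The formal sum from which [plift] computes; every later evaluation of a lifted map starts here. *)
Lemma presented_expand (u : presented P) :
  u = \sum_(x <- dom (generic_quotient.repr u))
        pgen P x *~ coeff x (generic_quotient.repr u).
Proof.
rewrite -[LHS]generic_quotient.reprK -[X in \pi_(_)%qT X]freeg_sumE.
rewrite (morphD_sum (@zquot_piD _ P)); apply: eq_bigr => x _.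
rewrite -(morphDMz (@zquot_piD _ P)); congr (\pi_(_)%qT _).
by rewrite /fgen freegU_mulz intz.
Qed.

(** Both sides are computed from the same formal sum representing u, so they
    agree as soon as they agree on generators. This evaluates composites with
    a lift of f before f is known to respect the relations. *)
Lemma plift_morph (A B : zmodType) (f : X -> A) (g : A -> B) (h : presented P -> B) :
    {morph g : x y / x + y} -> {morph h : x y / x + y} ->
    (forall x, g (f x) = h (pgen P x)) ->
  forall u, g (plift f u) = h u.
Proof.
move=> gD hD gf u; rewrite [in RHS](presented_expand u) /plift !morphD_sum //.
by apply: eq_bigr => x _; rewrite !morphDMz // gf.
Qed.

Lemma presented_span (Q : presented P -> Prop) :
    Q 0 -> (forall x y, Q x -> Q y -> Q (x - y)) -> (forall x, Q (pgen P x)) ->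
  forall u, Q u.
Proof.
move=> Q0 QB Qx u.
have QN x : Q x -> Q (- x) by rewrite -sub0r; exact: QB.
have QD x y : Q x -> Q y -> Q (x + y).
  by move=> hx /QN hy; rewrite -[y]opprK; exact: QB.
rewrite (presented_expand u); apply: (big_ind Q) => // x _.
suff Qn y n : Q y -> Q (y *+ n) by case: (coeff _ _) => n; [exact: Qn | apply: QN; exact: Qn].
by move=> Qy; elim: n => [|n IH]; rewrite ?mulr0n // mulrS; exact: QD.
Qed.

Section Lift.

Variables (A : zmodType) (f : X -> A).

(** The extension of f to the free group, before any relation is imposed. *)
Definition flift (r : {freeg {classic X}}) : A := \sum_(x <- dom r) f x *~ coeff x r.

(** Sums over the support do not add up termwise, since supports change
    under addition; over a common larger list they do. *)
Lemma flift_sub (s : seq {classic X}) r :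
  uniq s -> {subset dom r <= s} -> flift r = \sum_(x <- s) f x *~ coeff x r.
Proof.
move=> us rs; rewrite (bigID (mem (dom r))) /= [X in _ + X]big1 ?addr0; last first.
  by move=> x /coeff_outdom ->; rewrite mulr0z.
rewrite -big_filter; apply: perm_big; apply: uniq_perm; rewrite ?uniq_dom ?filter_uniq //.
by move=> x; rewrite mem_filter andb_idr //; exact: rs.
Qed.

Lemma fliftD : {morph flift : x y / x + y}.
Proof.
move=> x y; (* contains the supports of x, y and x + y *)
pose s := undup (dom x ++ dom y).
rewrite !(@flift_sub s) ?undup_uniq //; first 1 last.
- by move=> z zy; rewrite mem_undup mem_cat zy orbT.
- by move=> z zx; rewrite mem_undup mem_cat zx.
- by move=> z /domD_subset zx; rewrite mem_undup.
by rewrite -big_split /=; apply: eq_bigr => z _; rewrite coeffD mulrzDr.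
Qed.

Lemma flift_gen x : flift (fgen x) = f x.
Proof. by rewrite /flift /fgen domU1 big_seq1 coeffU eqxx mulr1 mulr1z. Qed.

Hypothesis fP : forall r, P r -> flift r = 0.

(** The chosen representative of a class differs from r by a combination of relations. *)
Lemma flift_pi r : plift f (\pi_(zquot P)%qT r : presented P) = flift r.
Proof.
rewrite -[LHS]/(flift (generic_quotient.repr (\pi_(zquot P)%qT r))).
set r' := generic_quotient.repr _; apply/eqP; rewrite -subr_eq0; apply/eqP.
have -> : flift r' - flift r = flift (r' - r) by rewrite fliftD (morphDN fliftD).
have : spanned P (r' - r) by apply/zquot_eqP; rewrite generic_quotient.reprK.
elim=> [x /fP //| |x y _ x0 _ y0]; first exact/morphD0/fliftD.
by rewrite fliftD (morphDN fliftD) x0 y0 subrr.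
Qed.

Lemma pliftD : {morph (plift f : presented P -> A) : x y / x + y}.
Proof.
move=> x y; rewrite -[x]generic_quotient.reprK -[y]generic_quotient.reprK.
by rewrite -[in LHS]zquot_piD !flift_pi fliftD.
Qed.

Lemma plift_gen x : plift f (pgen P x) = f x.
Proof. by rewrite flift_pi flift_gen. Qed.

End Lift.

Lemma pgenB_eq x y z : P (fgen x - fgen y - fgen z) -> pgen P x = pgen P y + pgen P z.
Proof.
by move=> h; rewrite /pgen -zquot_piD; apply/zquot_eqP; rewrite opprD addrA; exact: spanned_gen.
Qed.

Lemma pgen_eq x y : P (fgen x - fgen y) -> pgen P x = pgen P y.
Proof. by move=> h; apply/zquot_eqP; exact: spanned_gen. Qed.

End PresentedTheory.

Section TensorTheory.

Variables A B : zmodType.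

Lemma tpureDl (a a' : A) (b : B) : tpure (a + a') b = tpure a b + tpure a' b.
Proof. by apply: pgenB_eq; exact: TensRelL. Qed.

Lemma tpureDr (a : A) (b b' : B) : tpure a (b + b') = tpure a b + tpure a b'.
Proof. by apply: pgenB_eq; exact: TensRelR. Qed.

(** Pure tensors generate. *)
Lemma tens_ext (C : zmodType) (f g : tens A B -> C) :
    {morph f : x y / x + y} -> {morph g : x y / x + y} ->
  (forall a b, f (tpure a b) = g (tpure a b)) -> f =1 g.
Proof.
move=> fD gD fg u; rewrite (presented_expand u) !morphD_sum //.
by apply: eq_bigr => -[a b] _; rewrite !morphDMz // fg.
Qed.

Section Lift.

Variables (C : zmodType) (f : A -> B -> C).
Hypotheses (fDl : forall b, {morph f^~ b : x y / x + y})
           (fDr : forall a, {morph f a : x y / x + y}).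

Let fP r : tens_rel r -> flift (fun ab : A * B => f ab.1 ab.2) r = 0.
Proof.
have fB := morphDN (@fliftD _ _ (fun ab : A * B => f ab.1 ab.2)).
case=> [a a' b|a b b']; rewrite !fliftD !fB !flift_gen /=.
  by rewrite fDl /= -addrA -opprD subrr.
by rewrite fDr /= -addrA -opprD subrr.
Qed.

Lemma tliftD : {morph tlift f : x y / x + y}.
Proof. exact: pliftD fP. Qed.

Lemma tlift_pure a b : tlift f (tpure a b) = f a b.
Proof. exact: (plift_gen fP (a, b)). Qed.

End Lift.
End TensorTheory.

Section TensorMap.

Variables (A B A' B' : zmodType) (f : A -> A') (g : B -> B').
Hypotheses (fD : {morph f : x y / x + y}) (gD : {morph g : x y / x + y}).

Lemma tmapD : {morph tmap f g : x y / x + y}.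
Proof. by apply: tliftD => [b|a] x y; rewrite ?fD ?gD ?tpureDl ?tpureDr. Qed.

Lemma tmap_pure a b : tmap f g (tpure a b) = tpure (f a) (g b).
Proof. by apply: tlift_pure => [y|x] u v; rewrite ?fD ?gD ?tpureDl ?tpureDr. Qed.

End TensorMap.

Lemma invfK (A : zmodType) (B : Type) (f : A -> B) y :
  (exists x, f x = y) -> f (Defs.invf f y) = y.
Proof. by move=> e; rewrite /Defs.invf; case: pselect => // e'; case: cid. Qed.

(** * Symmetric functions through their coefficients *)

Section Coefficients.

Definition mon n (s : seq nat) : 'X_{1..n} := [multinom nth 0%N s i | i < n].

Lemma mon_val n (m : 'X_{1..n}) : mon n m = m.
Proof. by apply/mnmP => i; rewrite mnmE (mnm_nth 0%N). Qed.

Lemma val_mon (s : seq nat) : mon (size s) s = s :> seq nat.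
Proof.
apply: (@eq_from_nth _ 0%N) => [|i]; first by rewrite size_tuple.
rewrite size_tuple => lt; rewrite -[i]/(val (Ordinal lt)) -(mnm_nth 0%N) mnmE //.
Qed.

Lemma sumn_mdeg n (m : 'X_{1..n}) : sumn m = mdeg m.
Proof. by rewrite /mdeg sumnE. Qed.

(** Coefficients are indexed by the list of exponents rather than by a
    number of variables and a monomial: restriction to fewer variables then
    becomes the removal of a trailing zero. *)
Definition lcoef (f : symfun) (s : seq nat) : int := (f (size s))@_(mon (size s) s).

Lemma lcoef_size (f : symfun) s n : size s = n -> lcoef f s = (f n)@_(mon n s).
Proof. by move=> <-. Qed.

Lemma mcoeff_lcoef (f : symfun) n (m : 'X_{1..n}) : (f n)@_m = lcoef f m.
Proof. by rewrite (@lcoef_size _ _ n) ?size_tuple // mon_val. Qed.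

Lemma lcoefD f g s : lcoef (f + g) s = lcoef f s + lcoef g s.
Proof. exact: mcoeffD. Qed.

Lemma symfun_ext f g : lcoef f =1 lcoef g -> f = g.
Proof.
move=> fg; apply/val_inj/functional_extensionality_dep => n; apply/mpolyP => m.
by rewrite !mcoeff_lcoef.
Qed.

Lemma symfunP (f : symfun) : is_symfun (sym_val f).
Proof. exact/symfun_predP/(valP f). Qed.

Lemma lcoef_perm (f : symfun) s t : perm_eq s t -> lcoef f s = lcoef f t.
Proof.
case: (symfunP f) => fS _ _ st; have /perm_size sz := st.
rewrite (@lcoef_size f s (size t)) //.
have /tuple_permP[p /= e] : perm_eq s (mon (size t) t) by rewrite val_mon.
(* t is read along p in s, so the exponents are permuted back by its inverse *)
have /issymP/(_ (p^-1)%g) fp := fS (size t).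
rewrite -[in LHS](_ : msym (p^-1)%g (f (size t)) = f (size t)) // mcoeff_sym.
rewrite /lcoef; congr (_@__); apply/mnmP => i; rewrite !mnmE e.
rewrite (nth_map i) ?size_enum_ord // nth_ord_enum permKV (tnth_nth 0%N) /=.
by rewrite val_mon.
Qed.

Lemma mcoeff_set_last0 n (p : {mpoly int[n.+1]}) m :
  (set_last0 p)@_m = p@_(mnmwiden m).
Proof.
rewrite [in RHS](mpolyE p) /set_last0 [in LHS](mpolyE p) (raddf_sum (comp_mpoly _)) !raddf_sum /=.
apply: eq_bigr => m' _; rewrite comp_mpolyZ !mcoeffZ; congr (_ * _).
rewrite comp_mpolyX big_ord_recr /= tnth_mktuple unlift_none mcoeffX.
under eq_bigr => i _.
  rewrite tnth_mktuple (_ : widen_ord _ i = fintype.lift ord_max i); last first.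
    by apply: val_inj; rewrite /= /bump leqNgt ltn_ord.
  rewrite fintype.liftK; over.
pose m1 := [multinom m' (fintype.lift ord_max i) | i < n].
rewrite (_ : \prod_(i < n) _ = 'X_[m1]); last first.
  by rewrite mpolyXE_id; apply: eq_bigr => i _; rewrite mnmE.
have wE i : mnmwiden m (fintype.lift ord_max i) = m i.
  rewrite -[RHS](mnmwiden_widen m i); congr (fun_of_multinom _ _).
  by apply: val_inj; rewrite /= /bump leqNgt ltn_ord.
have -> : (m' == mnmwiden m) = (m1 == m) && (m' ord_max == 0%N).
  apply/eqP/andP=> [e|[/eqP e1 /eqP e]].
    by rewrite e mnmwiden_ordmax eqxx; split=> //; apply/eqP/mnmP => i; rewrite mnmE e wE.
  apply/mnmP => i; case: (unliftP ord_max i) => [j ->|->]; last first.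
    by rewrite mnmwiden_ordmax.
  by rewrite wE -e1 mnmE.
rewrite expr0n; case: (m' ord_max == 0%N); rewrite ?mulr1 ?mulr0 ?andbT ?andbF ?mcoeff0 //.
by rewrite mcoeffX.
Qed.

Lemma lcoef_rcons0 (f : symfun) s : lcoef f (rcons s 0%N) = lcoef f s.
Proof.
case: (symfunP f) => _ f0 _; rewrite (@lcoef_size f _ (size s).+1) ?size_rcons //.
rewrite /lcoef -[f (size s)]f0 mcoeff_set_last0; congr (_@__).
apply: val_inj; apply: val_inj => /=; rewrite val_mon.
by rewrite -(size_rcons s 0%N) val_mon.
Qed.

Lemma lcoef_bounded (f : symfun) : exists d, forall s, (d <= sumn s)%N -> lcoef f s = 0.
Proof.
case: (symfunP f) => _ _ [d fd]; exists d => s ds; apply: memN_msupp_eq0.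
apply: msize_mdeg_ge; apply: leq_trans (fd _) _.
by rewrite -sumn_mdeg val_mon.
Qed.

Lemma sym_mulDl (g : symfun) : {morph sym_mul^~ g : a b / a + b}.
Proof. by move=> a b; apply/val_inj/functional_extensionality_dep => n; exact: mulrDl. Qed.

Lemma sym_mulDr (g : symfun) : {morph sym_mul g : a b / a + b}.
Proof. by move=> a b; apply/val_inj/functional_extensionality_dep => n; exact: mulrDr. Qed.

End Coefficients.

Section MkSym.

Variables (c : seq nat -> int) (d : nat).
Hypotheses (c_perm : forall s t, perm_eq s t -> c s = c t)
  (c_rcons0 : forall s, c (rcons s 0%N) = c s)
  (c_bounded : forall s, (d <= sumn s)%N -> c s = 0).

(** Conversely, a bounded function of exponent lists which ignores the
    order and trailing zeros comes from a symmetric function. *)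
Definition mksym_fam : pfam := fun n => \sum_(m : 'X_{1..n < d}) c m *: 'X_[m].

Lemma mcoeff_mksym n (m : 'X_{1..n}) : (mksym_fam n)@_m = c m.
Proof.
case: (ltnP (mdeg m) d) => [lt|le].
  exact: (mcoeff_mpoly (fun m : 'X_{1..n} => c m) lt).
rewrite c_bounded ?sumn_mdeg // raddf_sum big1 //= => m' _.
rewrite mcoeffZ mcoeffX; case: eqP => [e|_]; last by rewrite mulr0.
by have := bmdeg m'; rewrite e ltnNge le.
Qed.

Fact mksym_subproof : mksym_fam \in symfun_pred.
Proof.
apply/symfun_predP; split=> [n|n|].
- apply/issymP => s; apply/mpolyP => m; rewrite mcoeff_sym !mcoeff_mksym.
  apply: c_perm; apply/tuple_permP; exists s; congr map.
- apply/mpolyP => m; rewrite mcoeff_set_last0 !mcoeff_mksym -[RHS]c_rcons0.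
  by congr c.
exists d => n; apply: leq_trans (msize_sum _ _ _) _; apply/bigmax_leqP => m _.
by apply: leq_trans (msizeZ_le _ _) _; rewrite msizeX bmdeg.
Qed.

Definition mksym : symfun := SymFun mksym_subproof.

Lemma lcoef_mksym s : lcoef mksym s = c s.
Proof. by rewrite /lcoef [LHS]mcoeff_mksym val_mon. Qed.

End MkSym.

Section Monomials.

Definition nz (s : seq nat) := [seq x <- s | x != 0%N].

Lemma nz_perm s : perm_eq s (nz s ++ nseq (count_mem 0%N s) 0%N).
Proof.
elim: s => //= x s; rewrite /nz /=; case: x => [|x] /= IH; last by rewrite perm_cons.
rewrite add0n -[0%N :: nseq _ _]/([:: 0%N] ++ nseq _ _) perm_sym perm_catCA /=.
by rewrite perm_cons perm_sym.
Qed.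

Lemma lcoef_cat_nseq0 (f : symfun) s n : lcoef f (s ++ nseq n 0%N) = lcoef f s.
Proof.
elim: n => [|n IH]; first by rewrite cats0.
by rewrite -addn1 nseqD catA cats1 lcoef_rcons0.
Qed.

Lemma lcoef_nz (f : symfun) s : lcoef f (nz s) = lcoef f s.
Proof. by rewrite (lcoef_perm f (nz_perm s)) lcoef_cat_nseq0. Qed.

Lemma sumn_nz s : sumn (nz s) = sumn s.
Proof. by elim: s => //= -[|x] s IH /=; rewrite -?IH. Qed.

(** The partition underlying an exponent list: the orbits of exponent lists
    under reordering and padding by zeros are indexed by partitions. *)
Definition part s := sort geq (nz s).

Lemma part_perm s t : perm_eq s t -> part s = part t.
Proof.
move=> st; apply/perm_sortP; last exact: perm_filter.
- by move=> x y; apply: leq_total.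
- by move=> x y z xy yz; apply: leq_trans yz xy.
- by move=> x y /andP[/= yx xy]; apply/eqP; rewrite eqn_leq xy.
Qed.

Lemma part_rcons0 s : part (rcons s 0%N) = part s.
Proof. by rewrite /part /nz filter_rcons. Qed.

Lemma sumn_part s : sumn (part s) = sumn s.
Proof. by rewrite -[RHS]sumn_nz; apply: perm_sumn; rewrite perm_sort. Qed.

Lemma lcoef_part (f : symfun) s : lcoef f (part s) = lcoef f s.
Proof. by rewrite -[RHS]lcoef_nz; apply: lcoef_perm; rewrite perm_sort. Qed.

Lemma part_nz s : part (nz s) = part s.
Proof. by rewrite /part /nz filter_id. Qed.

Lemma part_id s : part (part s) = part s.
Proof. by rewrite -[RHS]part_nz; apply: part_perm; rewrite perm_sort. Qed.

Fact msymfun_perm l s t : perm_eq s t -> (part s == l)%:R = (part t == l)%:R :> int.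
Proof. by move=> /part_perm ->. Qed.

Fact msymfun_rcons0 l s : (part (rcons s 0%N) == l)%:R = (part s == l)%:R :> int.
Proof. by rewrite part_rcons0. Qed.

Fact msymfun_bounded l s : (sumn l < sumn s)%N -> (part s == l)%:R = 0 :> int.
Proof. by rewrite -[sumn s]sumn_part; case: eqP => // ->; rewrite ltnn. Qed.

(** The monomial symmetric functions, in place of another basis of Sym because
    their coefficients are the simplest possible. *)
Definition msymfun l : symfun :=
  mksym (@msymfun_perm l) (@msymfun_rcons0 l) (@msymfun_bounded l).

Lemma lcoef_msymfun l s : lcoef (msymfun l) s = (part s == l)%:R.
Proof. exact: lcoef_mksym. Qed.

(** Sorting the compositions of numbers below d gives every partition of such
    a number, possibly several times. *)
Definition parts d := undup [seq part a | a <- flatten [seq comps i | i <- iota 0 d]].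

Lemma mem_parts d s : (sumn s < d)%N -> part s \in parts d.
Proof.
move=> sd; rewrite mem_undup; apply/mapP; exists (nz s); last by rewrite part_nz.
apply/flatten_mapP; exists (sumn s); first by rewrite mem_iota.
by rewrite mem_comps /is_comp sumn_nz eqxx mem_filter.
Qed.

Lemma msymfun_expand f d : (forall s, (d <= sumn s)%N -> lcoef f s = 0) ->
  f = \sum_(l <- parts d) msymfun l *~ lcoef f l.
Proof.
move=> fd; apply: symfun_ext => s.
have lD : {morph lcoef^~ s : x y / x + y} by move=> x y; rewrite lcoefD.
rewrite (morphD_sum lD) /=.
have lE l : lcoef (msymfun l *~ lcoef f l) s = (part s == l)%:R * lcoef f l.
  by rewrite (morphDMz lD) lcoef_msymfun mulrzz.
under eq_bigr do rewrite lE.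
case: (ltnP (sumn s) d) => sd; last first.
  rewrite fd // big1 // => l _; case: eqP => [<-|_]; last by rewrite mul0r.
  by rewrite lcoef_part fd ?mulr0.
rewrite (bigD1_seq (part s)) ?undup_uniq ?mem_parts //= eqxx mul1r lcoef_part.
by rewrite big1 ?addr0 // => l; rewrite eq_sym => /negbTE ->; rewrite mul0r.
Qed.

End Monomials.

(** * Symmetric functions in two alphabets *)

Section TensorSquare.

(** The analogue of [lcoef] in two alphabets. *)
Definition pcoef (p : pfam2) (s t : seq nat) : int :=
  (p (size s, size t))@_(mon (size s + size t) (s ++ t)).

Lemma pcoefD p q s t : pcoef (p + q) s t = pcoef p s t + pcoef q s t.
Proof. exact: mcoeffD. Qed.

(** Juxtaposition of exponents, matching the substitution of x and y for the two blocks of variables. *)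
Definition mcat m n (u : 'X_{1..m}) (v : 'X_{1..n}) : 'X_{1..m + n} := mon (m + n) (u ++ v).

Lemma mcat_lshift m n (u : 'X_{1..m}) (v : 'X_{1..n}) i : mcat u v (lshift n i) = u i.
Proof. by rewrite mnmE /= nth_cat size_tuple ltn_ord (mnm_nth 0%N). Qed.

Lemma mcat_rshift m n (u : 'X_{1..m}) (v : 'X_{1..n}) i : mcat u v (rshift m i) = v i.
Proof.
by rewrite mnmE /= nth_cat size_tuple ltnNge leq_addr addKn (mnm_nth 0%N).
Qed.

Lemma mcat_inj m n (u u' : 'X_{1..m}) (v v' : 'X_{1..n}) :
  (mcat u v == mcat u' v') = (u == u') && (v == v').
Proof.
apply/eqP/andP=> [e|[/eqP-> /eqP-> //]].
split; apply/eqP/mnmP => i; first by rewrite -(mcat_lshift u v) e mcat_lshift.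
by rewrite -(mcat_rshift u v) e mcat_rshift.
Qed.

Lemma mon_cat m n (w : 'X_{1..m + n}) :
  exists u v, w = @mcat m n u v.
Proof.
exists [multinom w (lshift n i) | i < m], [multinom w (rshift m i) | i < n].
apply/mnmP => i; case: (split_ordP i) => j ->.
  by rewrite mcat_lshift mnmE.
by rewrite mcat_rshift mnmE.
Qed.

Lemma mcoeff_pcoef (p : pfam2) m n (u : 'X_{1..m}) (v : 'X_{1..n}) :
  (p (m, n))@_(mcat u v) = pcoef p u v.
Proof.
rewrite /pcoef /mcat; move: (size_tuple u) (size_tuple v).
by move: (val u : seq nat) (val v : seq nat) => s t /= <- <-.
Qed.

Lemma pfam2_ext (p q : pfam2) : (forall s t, pcoef p s t = pcoef q s t) -> p = q.
Proof.
move=> pq; apply/functional_extensionality_dep => -[m n]; apply/mpolyP => w.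
by have [u [v ->]] := mon_cat w; rewrite !mcoeff_pcoef.
Qed.

Lemma mpolyX_lshift m n (u : 'X_{1..m}) :
  'X_[u] \mPo [tuple 'X_(lshift n i) | i < m] = 'X_[mcat u 0%MM] :> {mpoly int[m + n]}.
Proof.
rewrite comp_mpolyX mpolyXE_id big_split_ord /= [X in _ = _ * X]big1 ?mulr1.
  by apply: eq_bigr => i _; rewrite tnth_mktuple mcat_lshift.
by move=> i _; rewrite mcat_rshift mnm0E.
Qed.

Lemma mpolyX_rshift m n (v : 'X_{1..n}) :
  'X_[v] \mPo [tuple 'X_(rshift m j) | j < n] = 'X_[mcat 0%MM v] :> {mpoly int[m + n]}.
Proof.
rewrite comp_mpolyX mpolyXE_id big_split_ord /= [X in _ = X * _]big1 ?mul1r.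
  by apply: eq_bigr => i _; rewrite tnth_mktuple mcat_rshift.
by move=> i _; rewrite mcat_lshift mnm0E.
Qed.

Lemma mcatD m n (u : 'X_{1..m}) (v : 'X_{1..n}) :
  (mcat u 0%MM + mcat 0%MM v)%MM = mcat u v.
Proof.
apply/mnmP => i; rewrite mnmDE; case: (split_ordP i) => j ->.
  by rewrite !mcat_lshift mnm0E addn0.
by rewrite !mcat_rshift mnm0E.
Qed.

Lemma mcoeff_mul_shift m n (p : {mpoly int[m]}) (q : {mpoly int[n]}) u v :
  ((p \mPo [tuple 'X_(lshift n i) | i < m])
   * (q \mPo [tuple 'X_(rshift m j) | j < n]))@_(mcat u v) = p@_u * q@_v.
Proof.
rewrite [in RHS](mpolyE p) [in RHS](mpolyE q) [in LHS](mpolyE p) [in LHS](mpolyE q).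
rewrite !(raddf_sum (comp_mpoly _)) /= mulr_suml raddf_sum /=.
rewrite [X in _ = X * _]raddf_sum mulr_suml; apply: eq_bigr => a _.
rewrite mulr_sumr !raddf_sum mulr_sumr; apply: eq_bigr => b _ /=.
rewrite !comp_mpolyZ mpolyX_lshift mpolyX_rshift -scalerAl -scalerAr -mpolyXD mcatD.
rewrite !mcoeffZ !mcoeffX mcat_inj -mulnb natrM.
by rewrite !mulrA; congr (_ * _); rewrite -!mulrA; congr (_ * _); rewrite mulrC.
Qed.

Lemma pcoef_ext (f g : symfun) s t : pcoef (sym_ext f g) s t = lcoef f s * lcoef g t.
Proof.
rewrite /pcoef /sym_ext /= /lcoef -mcoeff_mul_shift; congr (_@__).
by rewrite /mcat !val_mon.
Qed.

Lemma sym_extDl (g : symfun) : {morph sym_ext^~ g : x y / x + y}.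
Proof. by move=> x y; apply: pfam2_ext => s t; rewrite pcoefD !pcoef_ext lcoefD mulrDl. Qed.

Lemma sym_extDr (f : symfun) : {morph sym_ext f : x y / x + y}.
Proof. by move=> x y; apply: pfam2_ext => s t; rewrite pcoefD !pcoef_ext lcoefD mulrDr. Qed.

Lemma tlift_extD : {morph tlift sym_ext : x y / x + y}.
Proof. exact: (tliftD sym_extDl sym_extDr). Qed.

Lemma tlift_ext_pure f g : tlift sym_ext (tpure f g) = sym_ext f g.
Proof. exact: (tlift_pure sym_extDl sym_extDr). Qed.

Lemma tpure0l (g : symfun) : tpure (0 : symfun) g = 0.
Proof. by rewrite (morphD0 (f := fun x => tpure x g)) // => x y; rewrite tpureDl. Qed.

Lemma tpureNl (f g : symfun) : tpure (- f) g = - tpure f g.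
Proof. by rewrite (morphDN (f := fun x => tpure x g)) // => x y; rewrite tpureDl. Qed.

Lemma tpureMzl (f g : symfun) n : tpure (f *~ n) g = tpure f g *~ n.
Proof. by rewrite (morphDMz (f := fun x => tpure x g)) // => x y; rewrite tpureDl. Qed.

(** Expand all right factors in monomial symmetric functions and collect.
    The bound d0 is left open so that two tensors can be put over the same list
    of partitions. *)
Lemma tens_msymfun (t : tens symfun symfun) :
  exists d0, forall d, (d0 <= d)%N ->
    exists h, t = \sum_(l <- parts d) tpure (h l) (msymfun l).
Proof.
elim/(@presented_span _ (@tens_rel symfun symfun)): t => [|x y [d1 h1] [d2 h2]|[f g]].
- exists 0%N => d _; exists (fun=> 0); by rewrite big1 // => l _; rewrite tpure0l.
- exists (maxn d1 d2) => d; rewrite geq_max => /andP[/h1[h ->] /h2[h' ->]].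
  exists (fun l => h l - h' l); rewrite -sumrB; apply: eq_bigr => l _.
  by rewrite tpureDl tpureNl.
have [d0 gd] := lcoef_bounded g; exists d0 => d dd.
exists (fun l => f *~ lcoef g l); rewrite -[LHS]/(tpure f g).
rewrite {1}(@msymfun_expand g d) => [|s sd]; last by rewrite gd // (leq_trans dd).
have tDr : {morph (fun z : symfun => tpure f z) : x y / x + y} by move=> ? ? /=; rewrite tpureDr.
rewrite (morphD_sum tDr); apply: eq_bigr => l _.
by rewrite (morphDMz tDr) tpureMzl.
Qed.

Lemma pcoef_tlift h d s t :
  pcoef (tlift sym_ext (\sum_(l <- parts d) tpure (h l) (msymfun l))) s t
    = \sum_(l <- parts d) lcoef (h l) s * (part t == l)%:R.
Proof.
rewrite (morphD_sum tlift_extD) (morphD_sum (f := fun p => pcoef p s t)); last first.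
  by move=> p q; exact: pcoefD.
by apply: eq_bigr => l _; rewrite tlift_ext_pure pcoef_ext lcoef_msymfun.
Qed.

Lemma parts_part d l : l \in parts d -> part l = l.
Proof. by rewrite mem_undup => /mapP[s _ ->]; rewrite part_id. Qed.

(** In the normal form of [tens_msymfun], the coefficient of y^l in the image
    is the left factor attached to m_l; if the image vanishes, so does every left
    factor. *)
Lemma tlift_ext_inj : injective (tlift sym_ext).
Proof.
move=> x y exy; apply/eqP; rewrite -subr_eq0; apply/eqP.
have : tlift sym_ext (x - y) = 0.
  by rewrite tlift_extD (morphDN tlift_extD) exy subrr.
move: (x - y) => t; have [d /(_ d (leqnn d))[h ->]] := tens_msymfun t => t0.
rewrite big_seq big1 // => l ld.
suff -> : h l = 0 by rewrite tpure0l.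
apply: symfun_ext => s; rewrite [RHS]mcoeff0.
have := congr1 (fun p : pfam2 => pcoef p s l) t0; rewrite /= pcoef_tlift.
rewrite (bigD1_seq l) ?undup_uniq //= (parts_part ld) eqxx mulr1 big1 ?addr0.
  by move=> ->; rewrite /pcoef mcoeff0.
by move=> l' nl; rewrite eq_sym (negbTE nl) mulr0.
Qed.

(** The substitution of the union of the alphabets x and y for the variables of f. *)
Definition sym_double (f : symfun) : pfam2 := fun mn => f (mn.1 + mn.2)%N.

Lemma pcoef_double f s t : pcoef (sym_double f) s t = lcoef f (s ++ t).
Proof. by rewrite (@lcoef_size _ _ (size s + size t)) ?size_cat. Qed.

(** The coefficient of y^l in f(x, y) is again a symmetric function of x, and
    depends only on the partition underlying l, so f(x, y) is a combination of
    the m_l(y) with coefficients in Sym(x). *)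
Lemma sym_double_ext (f : symfun) : exists t, tlift sym_ext t = sym_double f.
Proof.
have [d fd] := lcoef_bounded f.
(* the coefficient of y^l in f(x, y), as a function of the exponents s of x *)
pose c l s := lcoef f (l ++ s).
have cp l s t : perm_eq s t -> c l s = c l t.
  by move=> st; apply: lcoef_perm; rewrite perm_cat2l.
have c0 l s : c l (rcons s 0%N) = c l s by rewrite /c -rcons_cat lcoef_rcons0.
have cd l s : (d <= sumn s)%N -> c l s = 0.
  by move=> ds; apply: fd; rewrite sumn_cat (leq_trans ds) ?leq_addl.
pose h l := mksym (cp l) (c0 l) (cd l).
exists (\sum_(l <- parts d) tpure (h l) (msymfun l)).
apply: pfam2_ext => s t; rewrite pcoef_tlift pcoef_double.
have hE : lcoef (h (part t)) s = lcoef f (s ++ t).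
  rewrite {1}/h lcoef_mksym /c -lcoef_nz -[RHS]lcoef_nz; apply: lcoef_perm.
  rewrite /nz !filter_cat perm_catC perm_cat2l.
  have /(perm_filter (fun x => x != 0%N)) : perm_eq (part t) (nz t) by rewrite perm_sort.
  by rewrite filter_id.
case: (ltnP (sumn t) d) => td.
  rewrite (bigD1_seq (part t)) ?undup_uniq ?mem_parts //= eqxx mulr1 hE.
  by rewrite big1 ?addr0 // => l; rewrite eq_sym => /negbTE ->; rewrite mulr0.
rewrite -hE {1}/h lcoef_mksym /c big1 ?fd // => [|l _].
  by rewrite sumn_cat sumn_part (leq_trans td) ?leq_addr.
case: eqP => [e|_]; last by rewrite mulr0.
by rewrite -e hE fd ?mul0r // sumn_cat (leq_trans td) ?leq_addl.
Qed.

Lemma sym_comulK f : tlift sym_ext (sym_comul f) = sym_double f.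
Proof. exact/invfK/sym_double_ext. Qed.

End TensorSquare.

(** * Uniqueness of the induced morphism *)

Section Uniqueness.

(** In one variable there is a single monomial of each degree. *)
Lemma dhomog1_eval (p : {mpoly int[1]}) d :
  p \is d.-homog -> p = p.@[fun=> 1] *: 'X_[[multinom d | i < 1]].
Proof.
move=> /dhomogP pd; rewrite [LHS]mpolyE mevalE scaler_suml.
apply: eq_big_seq => m /pd /= md; rewrite big1 ?mulr1 => [|i _]; last by rewrite expr1n.
congr (_ *: 'X_[_]); apply/mnmP => i; rewrite mnmE -md mdegE big_ord1.
by rewrite (ord1 i).
Qed.

Variables (A : gbialg) (zeta : A -> int).
Hypothesis homogA : forall x : A, spanned (fun v => exists n, gb_homog n v) x.

(** Induction on the number of variables. In one variable the character decides.
    In n + 1 variables, Psi x and Phi x are the values at gb_comul x of two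
    additive functions on A (x) A, which agree on pure tensors by the induction
    hypothesis and the case of one variable. *)
Lemma induced_by_unique (Psi Phi : A -> SymHopf) :
  induced_by zeta Psi -> induced_by zeta Phi -> Psi = Phi.
Proof.
move=> [PsiH Psiz] [PhiH Phiz]; apply: functional_extensionality_dep => x.
case: (PsiH) => PsiD Psih _ _ Psic Psie; case: (PhiH) => PhiD Phih _ _ Phic Phie.
have deg1 y : Psi y 1%N = Phi y 1%N.
  elim: (homogA y) => [z [d zd]| |u v _ eu _ ev].
  - rewrite (dhomog1_eval (Psih _ _ zd 1%N)) (dhomog1_eval (Phih _ _ zd 1%N)).
    by congr (_ *: _); rewrite [LHS]Psiz [RHS]Phiz.
  - by rewrite (morphD0 PsiD) (morphD0 PhiD).
  rewrite PsiD PhiD (morphDN PsiD) (morphDN PhiD).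
  by rewrite -[LHS]/(Psi u 1%N - Psi v 1%N) eu ev.
apply: val_inj; apply: functional_extensionality_dep => n /=.
elim: n x => [|n IH] x.
  rewrite [LHS]nvar0_mpolyC [RHS]nvar0_mpolyC; congr (_%:MP).
  have e (p : {mpoly int[0]}) : p@_0%MM = p.@[fun=> 0].
    by rewrite [in RHS](nvar0_mpolyC p) mevalC.
  by rewrite !e [LHS]Psie [RHS]Phie.
have comulE (Xi : A -> SymHopf) : graded_hopf_morphism Xi ->
    forall y, Xi y (n + 1)%N = tlift sym_ext (tmap Xi Xi (gb_comul y)) (n, 1%N).
  by case=> _ _ _ _ Xic _ y; rewrite -Xic [gb_comul _]/(sym_comul (Xi y)) sym_comulK.
rewrite -addn1 [LHS]comulE // [RHS]comulE //.
pose ev (f : A -> SymHopf) t := tlift sym_ext (tmap f f t) (n, 1%N).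
have evD (f : A -> SymHopf) : {morph f : u v / u + v} -> {morph ev f : u v / u + v}.
  by move=> fD u v; rewrite /ev tmapD // tlift_extD.
apply: (tens_ext (evD _ PsiD) (evD _ PhiD)) => a b.
have IHt y : Psi y n = Phi y n by exact: IH.
by rewrite /ev !tmap_pure // !tlift_ext_pure /sym_ext /= deg1 IHt.
Qed.

End Uniqueness.

(** * Subsets of Young sets *)

Section YoungSubsets.

Variable Y : youngSet.
Implicit Types K L M N : finSet.

Lemma comp_injE K L M (w : inj L M) (v : inj K L) x : comp_inj w v x = w (v x).
Proof. exact: mkInjE. Qed.

Section Bijection.

Variables (N M : finSet) (w : bij N M).

Lemma ymap_bijK : cancel (ymap Y w) (ymap Y (bij_inv w)).
Proof.
move=> y; rewrite -(@ymap_comp_eq Y _ _ _ _ _ (id_inj N)) ?ymap_id ?mkInjE // => x.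
by rewrite mkInjE bijK.
Qed.

Lemma ymap_bijKV : cancel (ymap Y (bij_inv w)) (ymap Y w).
Proof.
move=> y; rewrite -(@ymap_comp_eq Y _ _ _ _ _ (id_inj M)) ?ymap_id ?mkInjE // => x.
by rewrite mkInjE bijKV.
Qed.

End Bijection.

(** Y_K, Y_S and the intersection axiom: an element of Y_N that comes both from
    K and from S comes from Y of their intersection. *)
Lemma ysub_preim K N (i : inj K N) (S : {set N}) u :
  (ymap Y i u \in ysub Y S) = (u \in ysub Y (i @^-1: S)).
Proof.
apply/idP/idP=> [yS|/imsetP[z _ ->]]; last first.
  have hS (x : subF (i @^-1: S)) : i (sval x) \in S by have := valP x; rewrite inE.
  pose g (x : subF (i @^-1: S)) : subF S := exist (fun v => v \in S) _ (hS x).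
  have gI : injective g.
    by move=> a b /(congr1 (fun v : subF S => sval v)) /= /inj_inj /val_inj.
  rewrite (@ymap_square Y _ _ _ _ _ _ (mkInj gI) (incl S)) ?imset_f //.
  by move=> x; rewrite !mkInjE.
pose I := i @: [set: K].
have hI (x : K) : i x \in I by exact: imset_f.
pose gI (x : K) : subF I := exist (fun v => v \in I) _ (hI x).
have gII : injective gI.
  by move=> a b /(congr1 (fun v : subF I => sval v)) /= /inj_inj.
have : ymap Y i u \in ysub Y I :&: ysub Y S.
  rewrite inE yS andbT (@ymap_comp_eq Y _ _ _ (incl I) (mkInj gII)) ?imset_f // => x.
  by rewrite !mkInjE.
rewrite {1}/ysub ys_cap => /imsetP[z _ ez].
have hx (x : subF (I :&: S)) : {k : K | i k == sval x}.
  have := valP x; rewrite inE => /andP[/imsetP xI _]; apply: sigW.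
  by case: xI => k _ e; exists k; rewrite -e.
have hk x : sval (hx x) \in i @^-1: S.
  by rewrite inE (eqP (svalP (hx x))); have := valP x; rewrite inE => /andP[].
pose g x : subF (i @^-1: S) := exist (fun v => v \in i @^-1: S) _ (hk x).
have gJ : injective g.
  move=> a b /(congr1 (fun v : subF (i @^-1: S) => sval v)) /= e.
  by apply: val_inj; rewrite /= -(eqP (svalP (hx a))) -(eqP (svalP (hx b))) e.
suff -> : u = ymap Y (incl (i @^-1: S)) (ymap Y (mkInj gJ) z) by exact: imset_f.
apply: (@inj_inj _ _ (ymap Y i)); rewrite ez.
rewrite -(@ymap_comp_eq Y _ _ _ _ _ (comp_inj (incl (i @^-1: S)) (mkInj gJ))).
  apply: ymap_comp_eq => x; rewrite !mkInjE /=.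
  by rewrite !mkInjE /= (eqP (svalP (hx x))).
by move=> x; rewrite comp_injE.
Qed.

Lemma ysub_im K N (i : inj K N) u : ymap Y i u \in ysub Y (i @: [set: K]).
Proof.
rewrite ysub_preim (_ : i @^-1: _ = setT); last first.
  by apply/setP => x; rewrite !inE imset_f.
have hx (x : K) : x \in [set: K] by rewrite inE.
pose g (x : K) : subF [set: K] := exist (fun v => v \in [set: K]) _ (hx x).
have gI : injective g.
  by move=> a b /(congr1 (fun v : subF [set: K] => sval v)).
have wE : comp_inj (incl [set: K]) (mkInj gI) =1 id.
  by move=> x; rewrite comp_injE !mkInjE.
by rewrite -[u](ymap_id_eq wE) ymap_comp comp_injE imset_f.
Qed.

Lemma ysubT N : ysub Y [set: N] = setT.
Proof.
apply/setP => y; rewrite inE; have idE := mkInjE (@inj_id N).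
rewrite -[y](ymap_id_eq idE).
have <- : id_inj N @: [set: N] = setT; last exact: ysub_im.
by apply/setP => x; rewrite inE -[x]idE imset_f.
Qed.

Lemma ysub_sub N (S T : {set N}) : S \subset T -> ysub Y S \subset ysub Y T.
Proof.
move=> ST; apply/subsetP => _ /imsetP[u _ ->]; rewrite ysub_preim.
have -> : incl S @^-1: T = setT; last by rewrite ysubT inE.
by apply/setP => x; rewrite !inE mkInjE (subsetP ST) ?(valP x).
Qed.

(** Functoriality carries the axiom for the chosen empty set to all empty sets. *)
Lemma young_card0 N : #|{: N}| = 0%N -> #|{: Y N}| = 0%N.
Proof.
move=> N0; have nN (x : N) : False by have := fintype0 x N0.
pose g (x : N) : emptyF := match nN x with end.
have gI : injective g by move=> x; case: (nN x).
apply/eqP; rewrite -leqn0 -(ys_empty Y).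
exact: leq_card (@inj_inj _ _ (ymap Y (mkInj gI))).
Qed.

Lemma ysub0 N : ysub Y set0 = set0 :> {set Y N}.
Proof.
apply/setP => y; rewrite inE; apply/negP => /imsetP[u _ _].
have := young_card0 (N := subF (set0 : {set N})); move/(_ _)/fintype0; apply=> //.
by apply: eq_card0 => x; have := valP x; rewrite inE.
Qed.

Lemma mem_ysub_im K N (i : inj K N) y :
  y \in ysub Y (i @: [set: K]) -> exists u, y = ymap Y i u.
Proof.
case/imsetP => z _ ->.
have hx (x : subF (i @: [set: K])) : {k : K | i k == sval x}.
  by apply: sigW; have /imsetP[k _ e] := valP x; exists k; rewrite -e.
have gI : injective (fun x => sval (hx x)).
  move=> a b e; apply: val_inj.
  by rewrite /= -(eqP (svalP (hx a))) -(eqP (svalP (hx b))) e.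
exists (ymap Y (mkInj gI) z); apply: ymap_comp_eq => x.
by rewrite !mkInjE (eqP (svalP (hx x))).
Qed.

End YoungSubsets.

(** * Generating functions of proper colourings *)

Section Colorings.

Variables (Y : youngSet) (X : finType) (triv : X).
Implicit Types K L M N : finSet.

(** The condition depends on c only through its nonempty colour classes, written
    as the classes of the points v. So it does not see unused colours, and an
    injective renaming of colours preserves it trivially ([cols_rename]). *)
Definition proper N (F : {ffun Y N -> X}) (T : eqType) (c : N -> T) : bool :=
  [forall y in supp triv F, forall v, y \notin ysub Y [set u | c u == c v]].

Lemma properP N (F : {ffun Y N -> X}) (T : eqType) (c : N -> T) :
  reflect (forall y v, y \in supp triv F -> y \notin ysub Y [set u | c u == c v])
          (proper F c).
Proof.
apply: (iffP forall_inP) => h y; first by move=> v /h/forallP.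
by move=> ys; apply/forallP => v; exact: h.
Qed.

Definition cols N (F : {ffun Y N -> X}) (w : {perm N}) n : {set {ffun N -> 'I_n}} :=
  [set c : {ffun N -> 'I_n} | proper F c && [forall v, c (w v) == c v]].

Lemma colsP N (F : {ffun Y N -> X}) (w : {perm N}) n (c : {ffun N -> 'I_n}) :
  reflect ((forall y v, y \in supp triv F -> y \notin ysub Y [set u | c u == c v])
           /\ forall v, c (w v) = c v) (c \in cols F w n).
Proof.
rewrite inE; apply: (iffP andP) => -[/properP h1 h2]; split=> //.
  by move=> v; apply/eqP/(forallP h2).
by apply/forallP => v; apply/eqP.
Qed.

Lemma cols_rename N (F : {ffun Y N -> X}) (w : {perm N}) m n (e : 'I_m -> 'I_n)
    (c : {ffun N -> 'I_m}) :
  injective e -> ([ffun v => e (c v)] \in cols F w n) = (c \in cols F w m).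
Proof.
move=> eI; pose ec := [ffun v => e (c v)].
have kE v : [set u | ec u == ec v] = [set u | c u == c v].
  by apply/setP => u; rewrite !inE !ffunE (inj_eq eI).
apply/colsP/colsP => -[h1 h2]; split=> [y v /(h1 y v)|v]; rewrite -?/ec ?kE //.
  by apply: eI; have := h2 v; rewrite !ffunE.
by rewrite !ffunE h2.
Qed.

Definition theta_poly N (F : {ffun Y N -> X}) (w : {perm N}) : pfam := fun n =>
  \sum_(c in cols F w n) \prod_v 'X_(c v).

(** The monomial of a colouring records the sizes of the colour classes. *)
Lemma colorprodE N n (c : N -> 'I_n) :
  \prod_v 'X_(c v) = 'X_[[multinom #|[set v | c v == i]| | i < n]] :> {mpoly int[n]}.
Proof.
rewrite mprodXE; congr 'X_[_]; apply/mnmP => i; rewrite mnmE mnm_sumE.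
by rewrite -sum1_card [RHS]big_mkcond; apply: eq_bigr => v _; rewrite mnm1E inE; case: eqP.
Qed.

Lemma mcoeff_theta_poly N (F : {ffun Y N -> X}) (w : {perm N}) n (m : 'X_{1..n}) :
  (theta_poly F w n)@_m
    = #|[set c in cols F w n | [forall i, #|[set v | c v == i]| == m i]]|%:R.
Proof.
rewrite raddf_sum -sum1_card natr_sum.
rewrite (bigID (fun c : {ffun N -> 'I_n} => [forall i, #|[set v | c v == i]| == m i])) /=.
rewrite [X in _ + X]big1 ?addr0 => [|c /andP[_ /negbTE nc]].
  rewrite (eq_bigl (fun c => c \in [set c in cols F w n | [forall i, #|[set v | c v == i]| == m i]])); last first.
    by move=> c; rewrite !inE.
  apply: eq_bigr => c; rewrite inE => /andP[_ /forallP h].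
  rewrite colorprodE mcoeffX; case: eqP => // -[]; apply/mnmP => i.
  by rewrite mnmE; apply/eqP.
rewrite colorprodE mcoeffX; case: eqP => // e; case/negP: (negbT nc).
by apply/forallP => i; rewrite -e mnmE.
Qed.

Lemma theta_homog N (F : {ffun Y N -> X}) (w : {perm N}) n :
  theta_poly F w n \is #|{: N}|.-homog.
Proof.
apply: rpred_sum => c _; rewrite colorprodE dhomogX; apply/eqP => /=.
rewrite mdegE -sum1_card (partition_big (fun v => c v) xpredT) //=.
by apply: eq_bigr => i _; rewrite mnmE -sum1_card; apply: eq_bigl => v; rewrite inE.
Qed.

(** Permuting the colours permutes the proper colourings; putting the last
    variable to 0 removes exactly the colourings that use the last colour. *)
Fact theta_subproof N (F : {ffun Y N -> X}) (w : {perm N}) :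
  theta_poly F w \in symfun_pred.
Proof.
apply/symfun_predP; split=> [n|n|].
- apply/issymP => s; rewrite raddf_sum /=.
  pose h (c : {ffun N -> 'I_n}) := [ffun v => s (c v)].
  rewrite [RHS](reindex h) /=; last first.
    exists (fun c => [ffun v => (s^-1)%g (c v)]) => c _;
      by apply/ffunP => v; rewrite !ffunE ?permK ?permKV.
  rewrite [RHS](eq_bigl (fun c => c \in cols F w n)) => [|c]; last exact/cols_rename/perm_inj.
  apply: eq_bigr => c _; rewrite rmorph_prod; apply: eq_bigr => v _.
  rewrite /= msymX ffunE; congr 'X_[_]; apply/mnmP => i; rewrite !mnmE.
  by rewrite (canF_eq (permK s)).
- rewrite /set_last0 raddf_sum /=.
  pose h (c : {ffun N -> 'I_n}) := [ffun v => fintype.lift ord_max (c v)].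
  have hI : {in cols F w n &, injective h}.
    move=> c c' _ _ /ffunP e; apply/ffunP => v; have := e v; rewrite !ffunE.
    exact: lift_inj.
  rewrite (bigID (fun c => c \in h @: cols F w n)) /= [X in _ + X]big1 ?addr0.
    rewrite (eq_bigl (fun c => c \in h @: cols F w n)); last first.
      move=> c; rewrite andb_idl // => /imsetP[c' c'F ->].
      by rewrite cols_rename //; exact: lift_inj.
    rewrite big_imset //=; apply: eq_bigr => c _; rewrite rmorph_prod.
    apply: eq_bigr => v _; rewrite /= comp_mpolyXU -tnth_nth tnth_mktuple ffunE.
    by rewrite fintype.liftK.
  move=> c /andP[cF ch].
  have [v cv|nv] := pickP (fun v => c v == ord_max).
    rewrite rmorph_prod (bigD1 v) //= comp_mpolyXU -tnth_nth tnth_mktuple (eqP cv).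
    by rewrite unlift_none mul0r.
  have hv v : {i | c v = fintype.lift ord_max i}.
    case: (unliftP ord_max (c v)) => [i ->|e]; first by exists i.
    by have := nv v; rewrite e eqxx.
  case/negP: ch; apply/imsetP; exists [ffun v => sval (hv v)].
    rewrite -(cols_rename _ _ _ (@lift_inj _ ord_max)).
    rewrite (_ : finfun _ = c) //; apply/ffunP => v.
    by rewrite !ffunE -(svalP (hv v)).
  by apply/ffunP => v; rewrite !ffunE -(svalP (hv v)).
exists #|{: N}|.+1 => n; apply/bigmax_leqP_seq => m mt _.
by rewrite ltnS (dhomog_mf (theta_homog F w n) mt).
Qed.

Definition theta N (F : {ffun Y N -> X}) (w : {perm N}) : symfun := SymFun (theta_subproof F w).

Lemma thetaE N (F : {ffun Y N -> X}) (w : {perm N}) n :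
  theta F w n = \sum_(c in cols F w n) \prod_v 'X_(c v).
Proof. by []. Qed.

End Colorings.

(** * Colourings of a decomposed set *)

Section Split.

Variables (Y : youngSet) (X : finType) (triv : X) (K L N : finSet).
Variables (i : inj K N) (j : inj L N) (b : N -> K + L).
Hypotheses (bi : forall k, b (i k) = inl k) (bj : forall l, b (j l) = inr l)
  (bK : forall v, match b v with inl k => i k | inr l => j l end = v).
Variables (F : {ffun Y N -> X}) (F1 : {ffun Y K -> X}) (F2 : {ffun Y L -> X}).
Hypotheses (F1E : forall u, F (ymap Y i u) = F1 u) (F2E : forall u, F (ymap Y j u) = F2 u).
Variables (w : {perm N}) (w1 : {perm K}) (w2 : {perm L}).
Hypotheses (w1E : forall k, w (i k) = i (w1 k)) (w2E : forall l, w (j l) = j (w2 l)).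
Variables (m n p : nat) (e1 : 'I_m -> 'I_p) (e2 : 'I_n -> 'I_p).
Hypotheses (e1I : injective e1) (e2I : injective e2).
Hypothesis sep :
  (forall y, F y != triv ->
     (exists u, y = ymap Y i u) \/ (exists u, y = ymap Y j u))
  \/ (forall c d, e1 c <> e2 d).

(** b tells for each point of N from which part it comes, and the two parts are
    coloured through e1 and e2. *)
Definition glue (c : {ffun K -> 'I_m} * {ffun L -> 'I_n}) : {ffun N -> 'I_p} :=
  [ffun v => match b v with inl k => e1 (c.1 k) | inr l => e2 (c.2 l) end].

Lemma glue_l c k : glue c (i k) = e1 (c.1 k).
Proof. by rewrite ffunE bi. Qed.

Lemma glue_r c l : glue c (j l) = e2 (c.2 l).
Proof. by rewrite ffunE bj. Qed.

Lemma glue_inj : injective glue.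
Proof.
move=> [c d] [c' d'] /ffunP e; congr pair; apply/ffunP => x.
  by have := e (i x); rewrite !glue_l => /e1I.
by have := e (j x); rewrite !glue_r => /e2I.
Qed.

Lemma prod_split (R : comNzRingType) (f : N -> R) :
  \prod_v f v = (\prod_k f (i k)) * (\prod_l f (j l)).
Proof.
rewrite (reindex (fun x : K + L => match x with inl k => i k | inr l => j l end)) /=.
  by rewrite big_sumType.
exists b => [[k|l] _|v _]; by rewrite ?bi ?bj ?bK.
Qed.

(** The elements of Y_N that could spoil the properness of a glued colouring
    already come from Y_K or from Y_L: either because all of supp F does, or
    because the two parts use different colours, so that each colour class lies
    in one part. *)
Lemma fiber_im c v y : F y != triv -> y \in ysub Y [set u | glue c u == glue c v] ->
  (exists u, y = ymap Y i u) \/ (exists u, y = ymap Y j u).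
Proof.
case: sep => [h Fy _|e12 _]; first exact: h.
rewrite -[v in glue c v]bK; case: (b v) => [k|l] yv; [left|right];
  apply: mem_ysub_im; apply: subsetP (ysub_sub Y _) _ yv; apply/subsetP => u;
  rewrite inE ?glue_l ?glue_r -[u]bK; case: (b u) => z; rewrite ?glue_l ?glue_r ?imset_f //.
  by move/eqP/esym/e12.
by move/eqP/e12.
Qed.

(** By [ysub_preim], a colour class of c spoils properness at an element coming
    from Y_K exactly when its trace on K does. *)
Lemma glue_cols c :
  (glue c \in cols triv F w p) = (c.1 \in cols triv F1 w1 m) && (c.2 \in cols triv F2 w2 n).
Proof.
have preK k : i @^-1: [set u | glue c u == glue c (i k)] = [set u | c.1 u == c.1 k].
  by apply/setP => u; rewrite !inE !glue_l (inj_eq e1I).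
have preL l : j @^-1: [set u | glue c u == glue c (j l)] = [set u | c.2 u == c.2 l].
  by apply/setP => u; rewrite !inE !glue_r (inj_eq e2I).
apply/colsP/andP => [[h1 h2]|[/colsP[h1 h2] /colsP[h1' h2']]].
  split; apply/colsP; split=> [y v ys|v].
  - rewrite -preK -ysub_preim h1 //; move: ys; by rewrite !inE F1E.
  - by apply: e1I; rewrite -!glue_l -w1E h2.
  - rewrite -preL -ysub_preim h1 //; move: ys; by rewrite !inE F2E.
  by apply: e2I; rewrite -!glue_r -w2E h2.
split=> [y v|v]; last first.
  by rewrite -[v]bK; case: (b v) => x; rewrite ?w1E ?w2E ?glue_l ?glue_r ?h2 ?h2'.
rewrite inE => Fy; apply/negP => yv; case: (fiber_im Fy yv) => -[u yu]; move: yv Fy.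
  rewrite yu F1E ysub_preim => yv Fy.
  have [x xv|x0] := pickP (fun x => x \in i @^-1: [set u | glue c u == glue c v]).
    have e : glue c (i x) = glue c v by move: xv; rewrite !inE => /eqP.
    by have := h1 u x; rewrite inE Fy -preK e yv => /(_ isT).
  move: yv; rewrite (_ : i @^-1: _ = set0) ?ysub0 ?inE //.
  by apply/setP => x; rewrite [RHS]inE; exact: x0.
rewrite yu F2E ysub_preim => yv Fy.
have [x xv|x0] := pickP (fun x => x \in j @^-1: [set u | glue c u == glue c v]).
  have e : glue c (j x) = glue c v by move: xv; rewrite !inE => /eqP.
  by have := h1' u x; rewrite inE Fy -preL e yv => /(_ isT).
move: yv; rewrite (_ : j @^-1: _ = set0) ?ysub0 ?inE //.
by apply/setP => x; rewrite [RHS]inE; exact: x0.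
Qed.

(** The common source of multiplicativity (e1 and e2 are identities) and of
    the coproduct formula (e1 and e2 are the inclusions of two alphabets). *)
Lemma sum_split :
  \sum_(c in cols triv F w p | [forall k, c (i k) \in codom e1]
                            && [forall l, c (j l) \in codom e2])
     \prod_v ('X_(c v) : {mpoly int[p]})
  = (\sum_(c in cols triv F1 w1 m) \prod_k 'X_(e1 (c k)))
    * (\sum_(c in cols triv F2 w2 n) \prod_l 'X_(e2 (c l))).
Proof.
rewrite big_distrlr /= pair_big /=.
pose A := [set c : {ffun K -> 'I_m} * {ffun L -> 'I_n} |
            (c.1 \in cols triv F1 w1 m) && (c.2 \in cols triv F2 w2 n)].
rewrite [RHS](eq_bigl (fun c => c \in A)) => [|c]; last by rewrite [RHS]in_set.
transitivity (\sum_(c in glue @: A) \prod_v ('X_(c v) : {mpoly int[p]})); last first.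
  rewrite big_imset /=; last by move=> c d _ _; exact: glue_inj.
  apply: eq_bigr => c _; rewrite prod_split.
  by congr (_ * _); apply: eq_bigr => x _; rewrite ?glue_l ?glue_r.
apply: eq_bigl => c; apply/idP/imsetP => [/and3P[cF /forallP h1 /forallP h2]|].
  pose d := ([ffun k => iinv (h1 k)], [ffun l => iinv (h2 l)]).
  have cd : c = glue d.
    apply/ffunP => v; rewrite -[v]bK; case: (b v) => x.
      by rewrite glue_l ffunE f_iinv.
    by rewrite glue_r ffunE f_iinv.
  by exists d => //; rewrite in_set -glue_cols -cd.
case=> d; rewrite in_set -glue_cols => dF ->; rewrite dF /=.
apply/andP; split; apply/forallP => x; first by rewrite glue_l codom_f.
by rewrite glue_r codom_f.
Qed.

End Split.

Section ThetaTheory.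

Variables (Y : youngSet) (X : finType) (triv : X).
Implicit Types K L M N : finSet.

Section Join.

Variables (K L : finSet) (F : {ffun Y K -> X}) (G : {ffun Y L -> X}).

Lemma joinF_inl u : joinF triv F G (ymap Y (inlI K L) u) = F u.
Proof.
rewrite ffunE; case: pickP => [u' /eqP /inj_inj -> //|/(_ u)].
by rewrite eqxx.
Qed.

(** Y_K and Y_L meet in Y of the empty set, which is empty. *)
Lemma ymap_inl_inr u v : ymap Y (inlI K L) u <> ymap Y (inrI K L) v.
Proof.
move=> e; have := ysub_im (inlI K L) u; rewrite e ysub_preim.
rewrite (_ : _ @^-1: _ = set0) ?ysub0 ?inE //.
by apply/setP => x; rewrite !inE !mkInjE; apply/negP => /imsetP[z _]; rewrite mkInjE.
Qed.

Lemma joinF_inr v : joinF triv F G (ymap Y (inrI K L) v) = G v.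
Proof.
rewrite ffunE; case: pickP => [u /eqP /ymap_inl_inr//|_].
case: pickP => [u' /eqP /inj_inj -> //|/(_ v)].
by rewrite eqxx.
Qed.

Lemma joinF_supp y : joinF triv F G y != triv ->
  (exists u, y = ymap Y (inlI K L) u) \/ (exists u, y = ymap Y (inrI K L) u).
Proof.
rewrite ffunE; case: pickP => [u /eqP <- _|_]; first by left; exists u.
by case: pickP => [u /eqP <- _|_]; [right; exists u | rewrite eqxx].
Qed.

Lemma theta_join v w :
  theta triv (joinF triv F G) (sum_perm (v, w)) = sym_mul (theta triv F v) (theta triv G w).
Proof.
apply/val_inj/functional_extensionality_dep => n.
rewrite -[LHS]/(theta triv (joinF triv F G) (sum_perm (v, w)) n).
rewrite -[RHS]/(theta triv F v n * theta triv G w n) !thetaE.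
rewrite -(@sum_split _ _ triv _ _ (sumF K L) (inlI K L) (inrI K L) id _ _ _
            (joinF triv F G) _ _ _ _ (sum_perm (v, w)) _ _ _ _ _ _ _ id id) //.
- apply: eq_bigl => c; rewrite andb_idr // => _.
  by apply/andP; split; apply/forallP => x; apply/codomP; eexists.
- by move=> k; rewrite mkInjE.
- by move=> k; rewrite mkInjE.
- by case=> x; rewrite mkInjE.
- exact: joinF_inl.
- exact: joinF_inr.
- by move=> k; rewrite !mkInjE permE.
- by move=> k; rewrite !mkInjE permE.
by left; exact: joinF_supp.
Qed.

End Join.

Section Restrict.

Variables (N : finSet) (F : {ffun Y N -> X}) (w : {perm N}).

(** The colourings whose set of points coloured by the first alphabet is S. *)
Definition theta_part (S : {set N}) m n : {mpoly int[m + n]} :=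
  \sum_(c in cols triv F w (m + n) | [set v | (c v < m)%N] == S) \prod_v 'X_(c v).

(** For a colouring constant on the cycles of w, the set of points coloured by
    the first alphabet is stable under w. *)
Lemma theta_split_part m n :
  theta triv F w (m + n)%N = \sum_(S : {set N} | w @: S == S) theta_part S m n.
Proof.
rewrite thetaE (partition_big (fun c : {ffun N -> 'I_(m + n)} => [set v | (c v < m)%N])
                  (fun S : {set N} => w @: S == S)) //= => c /colsP[_ cw].
apply/eqP/setP => v; rewrite -[v](permKV w) mem_imset ?inE ?cw //; exact: perm_inj.
Qed.

Lemma theta_part_ext (S : {set N}) m n : (forall y, (w y \in S) = (y \in S)) ->
  theta_part S m n = sym_ext (theta triv (restrF F S) (sub_perm S w))
                             (theta triv (restrF F (~: S)) (sub_perm (~: S) w)) (m, n).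
Proof.
move=> wS; have wC y : (w y \in ~: S) = (y \in ~: S) by rewrite !inE wS.
pose b v : subF S + subF (~: S) :=
  match decP (@idP (v \in S)) with
  | left h => inl (exist (fun v => v \in S) v h)
  | right h => inr (exist (fun v => v \in ~: S) v (etrans (in_setC v S) (introN idP h)))
  end.
have bK v : match b v with inl k => incl S k | inr l => incl (~: S) l end = v.
  by rewrite /b; case: (decP _) => h; rewrite mkInjE.
have bi k : b (incl S k) = inl k.
  rewrite /b; case: (decP _) => h; first by congr inl; apply: val_inj; rewrite /= mkInjE.
  by case: h; rewrite mkInjE; exact: (valP k).
have bj k : b (incl (~: S) k) = inr k.
  have := valP k; rewrite inE => kS.
  rewrite /b; case: (decP _) => h; last by congr inr; apply: val_inj; rewrite /= mkInjE.
  by exfalso; case/negP: kS; have := h; rewrite {1}mkInjE.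
have colE1 (c : {ffun subF S -> 'I_m}) :
  (\prod_k 'X_(c k)) \mPo [tuple 'X_(lshift n i) | i < m]
    = \prod_k 'X_(lshift n (c k)) :> {mpoly int[m + n]}.
  by rewrite rmorph_prod; apply: eq_bigr => k _; rewrite /= comp_mpolyXU -tnth_nth tnth_mktuple.
have colE2 (c : {ffun subF (~: S) -> 'I_n}) :
  (\prod_k 'X_(c k)) \mPo [tuple 'X_(rshift m i) | i < n]
    = \prod_k 'X_(rshift m (c k)) :> {mpoly int[m + n]}.
  by rewrite rmorph_prod; apply: eq_bigr => k _; rewrite /= comp_mpolyXU -tnth_nth tnth_mktuple.
rewrite /sym_ext !thetaE !(raddf_sum (comp_mpoly _)) /=.
under eq_bigr do rewrite colE1; under [X in _ = _ * X]eq_bigr do rewrite colE2.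
rewrite -(@sum_split _ _ triv _ _ N (incl S) (incl (~: S)) b bi bj bK F _ _ _ _ w _ _ _ _
            _ _ _ (@lshift m n) (@rshift m n)).
- apply: eq_bigl => c; case: (c \in cols _ _ _ _) => //=.
  apply/eqP/andP => [<-|[/forallP h1 /forallP h2]].
    split; apply/forallP => k; have := valP k; rewrite !inE /= => ck.
      by apply/codomP; exists (Ordinal ck); rewrite mkInjE; apply: val_inj.
    rewrite mkInjE; case: (split_ordP (c (sval k))) => d e; last by rewrite e codom_f.
    by rewrite e /= ltn_ord in ck.
  apply/setP => v; rewrite inE; case: (boolP (v \in S)) => vS.
    have /codomP[d] := h1 (exist (fun v => v \in S) v vS).
    by rewrite mkInjE /= => ->; rewrite /= ltn_ord.
  have vC : v \in ~: S by rewrite inE.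
  have /codomP[d] := h2 (exist (fun v => v \in ~: S) v vC).
  by rewrite mkInjE /= => ->; rewrite /= ltnNge leq_addr.
- by move=> u; rewrite ffunE.
- by move=> u; rewrite ffunE.
- by move=> k; rewrite !mkInjE sub_permE.
- by move=> k; rewrite !mkInjE sub_permE.
- exact: lshift_inj.
- exact: rshift_inj.
by right=> c d /eqP; rewrite eq_lrshift.
Qed.

End Restrict.

Section Transport.

Variables (N M : finSet) (i : bij N M) (F : {ffun Y N -> X}) (G : {ffun Y M -> X}).
Hypothesis FG : forall u, G (ymap Y i u) = F u.
Variables (w : {perm N}) (v : {perm M}).
Hypothesis wv : forall x, v (i x) = i (w x).

Lemma cols_transport n (c : {ffun M -> 'I_n}) :
  ([ffun x => c (i x)] \in cols triv F w n) = (c \in cols triv G v n).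
Proof.
have pre x : i @^-1: [set u | c u == c (i x)]
    = [set u | [ffun x => c (i x)] u == [ffun x => c (i x)] x].
  by apply/setP => u; rewrite !inE !ffunE.
have yE y : y = ymap Y i (ymap Y (bij_inv i) y) by rewrite ymap_bijKV.
apply/colsP/colsP => -[h1 h2]; split=> [y x ys|x].
- rewrite -[x](bijKV i) [y]yE ysub_preim pre h1 //.
  by move: ys; rewrite !inE [y in G y]yE FG.
- by rewrite -[x](bijKV i) wv; have := h2 (bij_inv i x); rewrite !ffunE.
- by rewrite -pre -ysub_preim h1 //; move: ys; rewrite !inE FG.
by rewrite !ffunE -wv h2.
Qed.

Lemma reindex_transport (R : comNzRingType) n (P : pred {ffun M -> 'I_n}) (f : 'I_n -> R) :
  \sum_(c in cols triv G v n | P c) \prod_x f (c x)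
  = \sum_(c in cols triv F w n | P [ffun x => c (bij_inv i x)]) \prod_x f (c x).
Proof.
rewrite (reindex (fun c : {ffun N -> 'I_n} => [ffun x => c (bij_inv i x)])) /=; last first.
  exists (fun c => [ffun x => c (i x)]) => c _; apply/ffunP => x; rewrite !ffunE ?bijK //.
  by rewrite bijKV.
apply: eq_big => [c|c _].
  rewrite -cols_transport (_ : [ffun x => _] = c) //.
  by apply/ffunP => x; rewrite !ffunE bijK.
rewrite (reindex i) /=; last by exists (bij_inv i) => x _; rewrite ?bijK ?bijKV.
by apply: eq_bigr => x _; rewrite ffunE bijK.
Qed.

Lemma theta_transport : theta triv G v = theta triv F w.
Proof.
apply/val_inj/functional_extensionality_dep => n.
have e := @reindex_transport {mpoly int[n]} n xpredT (fun i => 'X_i).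
rewrite -[LHS]/(theta triv G v n) -[RHS]/(theta triv F w n) !thetaE.
rewrite -[LHS](eq_bigl _ _ (fun c => andbT (c \in _))) [LHS]e.
by apply: eq_bigl => c; rewrite andbT.
Qed.

End Transport.

Lemma theta_conj N (F : {ffun Y N -> X}) (w x : {perm N}) : x \in autF F ->
  theta triv F (w ^ x)%g = theta triv F w.
Proof.
move=> /autFP xF; apply: (@theta_transport _ _ (perm_bij x)) => [//|y] /=.
by rewrite !mkInjE conjgE !permM permK.
Qed.

Lemma theta_part_conj N (F : {ffun Y N -> X}) (w x : {perm N}) (S : {set N}) m n :
  x \in autF F -> theta_part F (w ^ x)%g (x @: S) m n = theta_part F w S m n.
Proof.
move=> /autFP xF; rewrite /theta_part.
have wx y : (w ^ x)%g (perm_bij x y) = perm_bij x (w y).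
  by rewrite !mkInjE conjgE !permM permK.
rewrite (@reindex_transport _ _ (perm_bij x) F F xF w (w ^ x)%g wx {mpoly int[(m + n)]}
  _ (fun c => [set v | (c v < m)%N] == x @: S) (fun i => 'X_i)) /=.
apply: eq_bigl => c; congr (_ && _); rewrite -[RHS](inj_eq (imset_inj (@perm_inj _ x))).
congr (_ == _); apply/setP => v; rewrite -[v](permKV x) mem_imset; last exact: perm_inj.
by rewrite !inE !ffunE mkInjE permK.
Qed.

End ThetaTheory.

(** * Few colours, and coefficients *)

Section ThetaValues.

Variables (Y : youngSet) (X : finType) (triv : X).
Implicit Types N : finSet.

Lemma cols_supp0 N (F : {ffun Y N -> X}) (w : {perm N}) n (c : {ffun N -> 'I_n}) :
  supp triv F = set0 -> (forall v, c (w v) = c v) -> c \in cols triv F w n.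
Proof. by move=> F0 cw; apply/colsP; split=> // y v; rewrite F0 inE. Qed.

Lemma supp_card0 N (F : {ffun Y N -> X}) : #|{: N}| = 0%N -> supp triv F = set0.
Proof.
by move/(young_card0 Y) => N0; apply/setP => y; have := fintype0 y N0.
Qed.

(** There is one colouring of the empty set, and it is proper. *)
Lemma theta_card0 N (F : {ffun Y N -> X}) (w : {perm N}) :
  #|{: N}| = 0%N -> theta triv F w = sym_one.
Proof.
move=> N0; apply/val_inj/functional_extensionality_dep => n.
rewrite -[LHS]/(theta triv F w n) -[RHS]/(1 : {mpoly int[n]}) thetaE.
have c0 (x : N) : 'I_n by have := fintype0 x N0.
rewrite (big_pred1 (finfun c0)) => [|c].
  by rewrite big1 // => v; have := fintype0 v N0.
have -> : c = finfun c0 by apply/ffunP => x; have := fintype0 x N0.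
rewrite /= eqxx cols_supp0 ?supp_card0 // => v; by have := fintype0 v N0.
Qed.

Lemma theta_eval0 N (F : {ffun Y N -> X}) (w : {perm N}) :
  (theta triv F w 0%N).@[fun=> 0] = if #|{: N}| == 0%N then 1 else 0.
Proof.
case: eqP => [/theta_card0 ->|/eqP N0]; first by rewrite -[X in X.@[_]]/(1 : {mpoly int[0]}) meval1.
rewrite thetaE big1 ?meval0 // => c _; move: N0; rewrite -lt0n => /card_gt0P[v _].
by case: (c v).
Qed.

(** The constant colouring is proper exactly when supp F does not meet Y_N,
    that is when it is empty. *)
Lemma theta_eval1 N (F : {ffun Y N -> X}) (w : {perm N}) :
  (theta triv F w 1%N).@[fun=> 1] = if supp triv F == set0 then 1 else 0.
Proof.
rewrite thetaE raddf_sum /=.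
under eq_bigr => c _.
  rewrite rmorph_prod big1 /=; last by move=> v _; rewrite mevalXU.
  over.
have c1 v (c : {ffun N -> 'I_1}) : c v = ord0 by rewrite [c v]ord1.
case: eqP => [F0|/eqP/set0Pn[y yF]].
  rewrite (big_pred1 [ffun=> ord0]) // => c; rewrite cols_supp0 //; last by move=> v; rewrite !c1.
  by apply/esym/eqP/ffunP => v; rewrite c1 ffunE.
rewrite big1 // => c /colsP[h _].
have [v _|N0] := pickP (fun _ : N => true).
  have /negP := h y v yF; case; rewrite (_ : [set u | _] = setT) ?ysubT ?inE //.
  by apply/setP => u; rewrite !inE !c1 eqxx.
by move: yF; rewrite supp_card0 ?inE //; apply: eq_card0 => v; exact: N0.
Qed.

(** For positive exponents, a colouring with colour classes of sizes a is the
    list of its colour classes. Positivity is what makes the list an element of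
    Comp, whose blocks are nonempty. *)
Lemma lcoef_theta N (F : {ffun Y N -> X}) (w : {perm N}) (a : seq nat) : 0%N \notin a ->
  lcoef (theta triv F w) a = #|[set t in CompF triv F a | tuple_act t w == t]|%:R.
Proof.
move=> a0; rewrite /lcoef [LHS]mcoeff_theta_poly; congr (_%:R).
pose n := size a.
pose h (c : {ffun N -> 'I_n}) : n.-tuple {set N} := [tuple [set v | c v == i] | i < n].
have tnh c i : tnth (h c) i = [set v | c v == i] by rewrite tnth_mktuple.
have hI : injective h.
  move=> c d e; apply/ffunP => v; have := tnh c (c v); rewrite e tnh => /setP/(_ v).
  by rewrite !inE eqxx => /eqP.
rewrite -(card_imset _ hI); apply: eq_card => t.
apply/imsetP/setIdP => [[c]|[tF tw]].
  rewrite inE => /andP[/colsP[cp cw] /forallP cm] ->.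
  have fib0 i : [set v | c v == i] != set0.
    rewrite -card_gt0 (eqP (cm i)) mnmE lt0n; apply: contraNneq a0 => <-.
    by rewrite mem_nth.
  have fibE i : exists v, [set u | c u == i] = [set u | c u == c v].
    by have /set0Pn[v] := fib0 i; rewrite inE => /eqP <-; exists v.
  split; last first.
    apply/eqP/eq_from_tnth => i; rewrite tnth_mktuple !tnh; apply/setP => v.
    by rewrite -[v](permKV w) mem_imset ?inE ?cw //; exact: perm_inj.
  rewrite !inE; apply/andP; split; first (apply/and4P; split).
  - by apply/negP => /tnthP[i]; rewrite tnh => /esym/eqP; rewrite (negbTE (fib0 i)).
  - apply/forallP => i; apply/forallP => j; apply/implyP => ij.
    rewrite !tnh -setI_eq0; apply/eqP/setP => v; rewrite !inE.
    by apply/negP => /andP[/eqP -> ]; rewrite (negbTE ij).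
  - apply/eqP/setP => v; rewrite inE; apply/bigcupP; exists (c v) => //.
    by rewrite tnh inE.
  - by apply/forallP => i; rewrite tnh (eqP (cm i)) mnmE.
  apply/eqP/setP => y; rewrite [RHS]inE; apply/negP => /setIP[ys /bigcupP[i _]].
  by rewrite tnh; have [v ->] := fibE i; apply/negP; exact: cp.
move: tF; rewrite !inE => /andP[/and4P[t0 /forallP tD /eqP tU /forallP tC] /eqP tS].
have hv v : {i : 'I_n | v \in tnth t i}.
  by apply: sigW; have : v \in \bigcup_i tnth t i by [rewrite tU inE]; case/bigcupP => i _ ?; exists i.
have hu v i : v \in tnth t i -> sval (hv v) = i.
  move=> vi; apply/eqP/negPn/negP => ne; have := forallP (tD (sval (hv v))) i.
  rewrite ne /= => /disjoint_setI0/setP/(_ v); by rewrite !inE vi (svalP (hv v)).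
pose c : {ffun N -> 'I_n} := [ffun v => sval (hv v)].
have cE i : [set v | c v == i] = tnth t i.
  apply/setP => v; rewrite inE ffunE; apply/eqP/idP => [<-|/hu //]; exact: (svalP (hv v)).
exists c; last by apply: eq_from_tnth => i; rewrite tnh cE.
rewrite inE; apply/andP; split; last by apply/forallP => i; rewrite cE mnmE tC.
apply/colsP; split=> [y v ys|v].
  rewrite cE; apply/negP => yv.
  have : y \in supp triv F :&: ytuple Y t by rewrite inE ys; apply/bigcupP; exists (c v).
  by rewrite tS inE.
rewrite !ffunE; apply: hu.
have /(congr1 (fun u : n.-tuple {set N} => tnth u (sval (hv v)))) := eqP tw.
by rewrite tnth_mktuple => <-; apply: imset_f; exact: (svalP (hv v)).
Qed.

End ThetaValues.

Section MonomialQsym.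

Lemma nz_pos (a : seq nat) : 0%N \notin nz a.
Proof. by rewrite mem_filter. Qed.

Lemma nz_mon n (m : 'X_{1..n}) :
  nz m = [seq m i | i <- [seq i <- enum 'I_n | m i != 0%N]].
Proof.
transitivity [seq x <- [seq m i | i <- enum 'I_n] | x != 0%N]; last exact: filter_map.
congr filter; apply: (@eq_from_nth _ 0%N).
  by rewrite size_map size_tuple size_enum_ord.
rewrite size_tuple => i lt; rewrite (nth_map (Ordinal lt)) ?size_enum_ord //.
by rewrite (mnm_nth 0%N) nth_enum_ord.
Qed.

(** A monomial occurs in M_a at most once: the increasing sequence of indices
    must be the list of positions of its nonzero exponents. *)
Lemma mcoeff_Mqsym (a : seq nat) n (m : 'X_{1..n}) : 0%N \notin a ->
  (Mqsym a n)@_m = (nz m == a)%:R.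
Proof.
move=> a0; rewrite /Mqsym raddf_sum /=.
have apos j : (j < size a)%N -> nth 0%N a j != 0%N.
  by move=> lt; apply: contraNneq a0 => <-; rewrite mem_nth.
pose z (t : (size a).-tuple 'I_n) := (\sum_(j < size a) U_(tnth t j) *+ nth 0%N a j)%MM.
have zE (t : (size a).-tuple 'I_n) :
    \prod_(j < size a) 'X_(tnth t j) ^+ nth 0%N a j = 'X_[z t] :> {mpoly int[n]}.
  exact: mprodXnE.
under eq_bigr do rewrite zE mcoeffX.
have z_nth (t : (size a).-tuple 'I_n) j : uniq t -> z t (tnth t j) = nth 0%N a j.
  move=> ut; rewrite mnm_sumE (bigD1 j) //= mulmnE mnm1E eqxx mul1n big1 ?addn0 // => l lj.
  rewrite mulmnE mnm1E; case: eqP => // /eqP.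
  by rewrite (inj_eq (tuple_uniqP _ ut)) (negbTE lj).
have z_out (t : (size a).-tuple 'I_n) i : i \notin t -> z t i = 0%N.
  move=> it; rewrite mnm_sumE big1 // => l _; rewrite mulmnE mnm1E; case: eqP => // e.
  by rewrite -e mem_tnth in it.
have tE (t : (size a).-tuple 'I_n) : sorted ltn (map val t) ->
    t = [seq i <- enum 'I_n | z t i != 0%N] :> seq _.
  move=> st; have ut : uniq t.
    by rewrite -(map_inj_uniq val_inj) (sorted_uniq ltn_trans ltnn).
  apply: (inj_map val_inj); apply: (irr_sorted_eq ltn_trans ltnn) => //.
    apply: (subseq_sorted ltn_trans (s2 := map val (enum 'I_n))).
      exact/map_subseq/filter_subseq.
    by rewrite val_enum_ord iota_ltn_sorted.
  move=> x; apply/mapP/mapP => -[i it ->]; exists i => //.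
    rewrite mem_filter mem_enum andbT; case/tnthP: it => j ->.
    by rewrite z_nth // apos.
  move: it; rewrite mem_filter => /andP[+ _].
  by apply: contraR => it; rewrite z_out.
have zN (t : (size a).-tuple 'I_n) : sorted ltn (map val t) -> nz (z t) = a.
  move=> st; rewrite nz_mon -tE //; apply: (@eq_from_nth _ 0%N); rewrite size_map size_tuple // => j lt.
  have ut : uniq t by rewrite -(map_inj_uniq val_inj) (sorted_uniq ltn_trans ltnn).
  by rewrite (nth_map (tnth t (Ordinal lt))) ?size_tuple // -[X in nth _ _ X]/(val (Ordinal lt)) -tnth_nth z_nth.
case: eqP => [ma|ma]; last first.
  by rewrite big1 // => t st; case: eqP => // zt; case: ma; rewrite -zt zN.
have ts : size [seq i <- enum 'I_n | m i != 0%N] == size a.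
  by rewrite -ma nz_mon size_map.
pose t0 : (size a).-tuple 'I_n := Tuple ts.
have st0 : sorted ltn (map val t0).
  apply: (subseq_sorted ltn_trans (s2 := map val (enum 'I_n))).
    exact/map_subseq/filter_subseq.
  by rewrite val_enum_ord iota_ltn_sorted.
have ut0 : uniq t0 by rewrite -(map_inj_uniq val_inj) (sorted_uniq ltn_trans ltnn).
have zt0 : z t0 = m.
  apply/mnmP => i; case: (boolP (i \in t0)) => it.
    have /tnthP[j ej] := it; rewrite ej z_nth // -{1}ma nz_mon.
    by rewrite (nth_map (tnth t0 j)) ?(eqP ts) // -[[seq i <- _ | _]]/(tval t0) -tnth_nth.
  rewrite z_out //; apply/esym/eqP; move: it; rewrite mem_filter mem_enum andbT negbK //.
rewrite (bigD1 t0) //= zt0 eqxx big1 ?addr0 // => t /andP[st tt0].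
case: eqP => // zt; case/negP: tt0; apply/eqP/val_inj.
by rewrite /= (tE t st) zt.
Qed.

Lemma Mqsym_sumE N (d : seq nat -> nat) n (m : 'X_{1..n}) :
  ((\sum_(a <- comps N) Mqsym a *+ d a : pfam) n)@_m
    = if sumn m == N then (d (nz m))%:R else 0.
Proof.
rewrite (morphD_sum (f := fun f : pfam => (f n)@_m)) => [|f g]; last exact: mcoeffD.
have E a : a \in comps N -> ((Mqsym a *+ d a) n)@_m = (nz m == a)%:R *+ d a.
  rewrite mem_comps => /andP[a0 _].
  rewrite (morphDMn (f := fun f : pfam => (f n)@_m)) => [|f g]; last exact: mcoeffD.
  by rewrite /= mcoeff_Mqsym.
rewrite (eq_big_seq _ E); case: eqP => [mN|mN].
  rewrite (bigD1_seq (nz m)) ?comps_uniq //=; last first.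
    by rewrite mem_comps /is_comp nz_pos sumn_nz mN /=.
  by rewrite eqxx big1 ?addr0 // => a /negbTE an; rewrite eq_sym an mul0rn.
rewrite big_seq big1 // => a; rewrite mem_comps => /andP[_ /eqP aN].
by case: eqP => [e|_]; rewrite ?mul0rn //; case: mN; rewrite -aN -e sumn_nz.
Qed.

End MonomialQsym.

(** * Characters in characteristic zero *)

Section HomTrace.

Variables (k : fieldType) (gT : finGroupType) (G : {group gT}).
Implicit Types V W : representation k G.

(** The kernels in the definition of homrep are those of linfun, which agrees
    with its argument only once that is known to be linear. *)
Lemma memv_homrep V W (A : 'M_(rdegree V, rdegree W)) :
  A \in homrep V W <-> forall g, g \in G -> V g *m A = A *m W g.
Proof.
pose f g (A : 'M_(rdegree V, rdegree W)) := V g *m A - A *m W g.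
have f_lin g : linear (f g).
  move=> c B C; rewrite /f mulmxDr mulmxDl -scalemxAr -scalemxAl scalerBr.
  by rewrite opprD addrACA.
have fE g : linfun (f g) A = f g A.
  pose Lf := HB.pack_for {linear 'M_(rdegree V, rdegree W) -> 'M_(rdegree V, rdegree W)}
    (f g) (GRing.isLinear.Build k _ _ *:%R (f g) (f_lin g)).
  exact: (lfunE Lf).
rewrite /homrep; split=> [/subv_bigcapP h g gG|h].
  have := h g gG; rewrite -memvE memv_ker => /eqP; rewrite fE => /eqP.
  by rewrite subr_eq0 => /eqP.
apply/subv_bigcapP => g gG; rewrite -memvE memv_ker.
by rewrite -/(f g) fE /f h // subrr.
Qed.

(** Averaging over G is a projector P onto the intertwiners. Its trace in the
    basis of elementary matrices is the right-hand side; expanding P in a basis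
    T of the intertwiners, it is the number of elements of T. *)
Lemma dimHom_trace V W : (#|G|%:R : k) != 0 ->
  (dimHom V W)%:R = (#|G|%:R)^-1 * \sum_(g in G) \tr (V g^-1%g) * \tr (W g).
Proof.
move=> G0; set H := homrep V W; pose c := (#|G|%:R : k)^-1.
pose P (A : 'M_(rdegree V, rdegree W)) := c *: \sum_(g in G) V g^-1%g *m A *m W g.
have PH A : P A \in H.
  apply/memv_homrep => x xG; rewrite -scalemxAr -scalemxAl; congr (_ *: _).
  rewrite mulmx_sumr mulmx_suml (reindex_inj (mulIg x)) /=.
  rewrite (eq_bigl (fun g => g \in G)) => [|g]; last by rewrite groupMr.
  apply: eq_bigr => g gG; rewrite invMg !repr_mxM ?groupV // !mulmxA.
  by rewrite -repr_mxM ?groupV // mulgV repr_mx1 mul1mx.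
have P_id A : A \in H -> P A = A.
  move/memv_homrep => AH; rewrite /P (eq_bigr (fun=> A)) => [|g gG].
    by rewrite sumr_const -scaler_nat scalerA mulVf // scale1r.
  by rewrite -mulmxA -AH // mulmxA -repr_mxM ?groupV // mulVg repr_mx1 mul1mx.
have P_lin : linear P.
  move=> a A B; rewrite /P scalerA mulrC -scalerA -scalerDr; congr (_ *: _).
  rewrite scaler_sumr -big_split; apply: eq_bigr => g _ /=.
  by rewrite mulmxDr mulmxDl -scalemxAr -scalemxAl.
(* P is the sum of the rank one maps A |-> co s A *: T`_s *)
pose T := vbasis H; pose co s (A : 'M[k]_(rdegree V, rdegree W)) : k^o := coord T s (P A).
have co_lin s : linear (co s).
  by move=> a A B; rewrite /co P_lin linearP.
have PE A : P A = \sum_s co s A *: T`_s by rewrite [LHS](coord_vbasis (PH A)).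
have trP : \sum_i \sum_j P (delta_mx i j) i j
         = c * \sum_(g in G) \tr (V g^-1%g) * \tr (W g).
  rewrite mulr_sumr.
  have E i j : P (delta_mx i j) i j = \sum_(g in G) c * (V g^-1%g i i * W g j j).
    rewrite mxE summxE mulr_sumr; apply: eq_bigr => g _; congr (_ * _).
    rewrite mxE (bigD1 j) //= big1 ?addr0 => [|l lj].
      rewrite mxE (bigD1 i) //= big1 ?addr0 => [|l li]; first by rewrite mxE !eqxx mulr1.
      by rewrite mxE (negbTE li) mulr0.
    by rewrite mxE big1 ?mul0r // => l' _; rewrite mxE (negbTE lj) andbF mulr0.
  under eq_bigr do under eq_bigr do rewrite E.
  under eq_bigr do rewrite exchange_big /=.
  rewrite exchange_big /=; apply: eq_bigr => g _.
  rewrite /mxtrace mulr_suml mulr_sumr; apply: eq_bigr => i _.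
  by rewrite mulr_sumr mulr_sumr.
rewrite -trP; transitivity (\sum_(s < \dim H) (1 : k)).
  by rewrite sumr_const card_ord.
under [RHS]eq_bigr do under eq_bigr do rewrite PE summxE.
under [RHS]eq_bigr do rewrite exchange_big /=.
rewrite exchange_big /=; apply: eq_bigr => s _.
pose L := HB.pack_for {linear 'M_(rdegree V, rdegree W) -> k^o}
    (co s) (GRing.isLinear.Build k _ _ *:%R (co s) (co_lin s)).
have Ts : T`_s \in H by apply: vbasis_mem; rewrite mem_nth ?size_tuple.
have : L T`_s = 1.
  by rewrite /= /co P_id // coord_free ?eqxx // (basis_free (vbasisP _)).
rewrite [X in L X](matrix_sum_delta T`_s) linear_sum => <-; apply: eq_bigr => i _.
rewrite linear_sum; apply: eq_bigr => j _.
by rewrite linearZ /= mxE mulrC.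
Qed.

End HomTrace.

Section Characters.

Variables (k : fieldType) (gT : finGroupType) (G : {group gT}).
Implicit Types V W : representation k G.

(** Outside G a representation takes arbitrary values, hence the value 0 there. *)
Definition chrep V : {ffun gT -> k} := [ffun g => if g \in G then \tr (V g) else 0].

Definition chR : Rgroup k G -> {ffun gT -> k} := rlift chrep.

Let chP r : groth_rel r -> flift chrep r = 0.
Proof.
have fB := morphDN (@fliftD _ _ chrep).
case=> [V W VW|V U modU]; rewrite !fliftD !fB !flift_gen; apply/ffunP => g; rewrite !ffunE.
  by case: ifP => gG; rewrite ?(mxtrace_rsim VW) ?subrr.
case: ifP => gG; rewrite ?subr0 //.
by rewrite -addrA -opprD [X in X + _]/= mxtrace_sub_fact_mod subrr.
Qed.

Lemma chRD : {morph chR : x y / x + y}.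
Proof. exact: pliftD chP. Qed.

Lemma chR_rcls V : chR (rcls V) = chrep V.
Proof. exact: plift_gen chP V. Qed.

Lemma rcls_rsim V W : mx_rsim V W -> rcls V = rcls W.
Proof. by move=> VW; apply: pgen_eq; exact: GrothIso. Qed.

Lemma rcls_ses V (U : 'M_(rdegree V)) (modU : mxmodule V U) :
  rcls V = rcls (Representation (submod_repr modU)) + rcls (Representation (factmod_repr modU)).
Proof. by apply: pgenB_eq; exact: GrothSes. Qed.

(** The form of [plift_morph] used for R(G): h is a function of the character,
    hence additive on R(G) without further proof. *)
Lemma rlift_char (A B : zmodType) (f : representation k G -> A) (g : A -> B)
    (h : {ffun gT -> k} -> B) :
    {morph g : x y / x + y} -> {morph h : x y / x + y} ->
    (forall V, g (f V) = h (chrep V)) ->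
  forall x : Rgroup k G, g (rlift f x) = h (chR x).
Proof.
move=> gD hD gf x; apply: (plift_morph (h := fun x => h (chR x)) gD) => [u v|V].
  by rewrite chRD hD.
by rewrite -[pgen _ V]/(rcls V) chR_rcls.
Qed.

End Characters.

Section ResExt.

Variable k : fieldType.

Lemma ffunDE (aT : finType) (R : zmodType) (f g : {ffun aT -> R}) x : (f + g) x = f x + g x.
Proof. by rewrite ffunE. Qed.

Lemma chR_res (gT : finGroupType) (G K : {group gT}) (sKG : K \subset G)
    (x : Rgroup k G) g : g \in K -> chR (Rres sKG x) g = chR x g.
Proof.
move=> gK; apply: (rlift_char (g := fun x => chR x g) (h := fun c : {ffun gT -> k} => c g)).
- by move=> u v; rewrite chRD ffunDE.
- by move=> u v; rewrite ffunDE.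
by move=> V; rewrite chR_rcls !ffunE gK (subsetP sKG).
Qed.

Lemma chR_ext (gT1 gT2 : finGroupType) (G1 : {group gT1}) (G2 : {group gT2})
    (x : Rgroup k G1) (y : Rgroup k G2) g1 g2 :
  g1 \in G1 -> g2 \in G2 -> chR (Rext x y) (g1, g2) = chR x g1 * chR y g2.
Proof.
move=> h1 h2; have hG : (g1, g2) \in setX_group G1 G2 by rewrite in_setX h1.
apply: (rlift_char (g := fun x => chR x (g1, g2))
          (h := fun c : {ffun gT1 -> k} => c g1 * chR y g2)).
- by move=> u v; rewrite chRD ffunDE.
- by move=> u v; rewrite ffunDE mulrDl.
move=> V; apply: (rlift_char (g := fun x => chR x (g1, g2))
          (h := fun c : {ffun gT2 -> k} => chrep V g1 * c g2)).
- by move=> u v; rewrite chRD ffunDE.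
- by move=> u v; rewrite ffunDE mulrDr.
by move=> W; rewrite chR_rcls !ffunE hG h1 h2 -mxtrace_prod.
Qed.

(** A function of tensors that depends only on the character of the associated
    representation of G1 x G2 takes the same value on all preimages of that
    representation. This evaluates the coproduct of M, where one preimage is
    chosen. *)
Lemma chR_tlift_ext (gT1 gT2 : finGroupType) (G1 : {group gT1}) (G2 : {group gT2})
    (B : zmodType) (f : tens (Rgroup k G1) (Rgroup k G2) -> B)
    (h : {ffun gT1 * gT2 -> k} -> B) :
    {morph f : x y / x + y} -> {morph h : x y / x + y} ->
    (forall x y, f (tpure x y) = h (chR (Rext x y))) ->
  forall t, f t = h (chR (tlift (@Rext k _ _ G1 G2) t)).
Proof.
move=> fD hD fh t.
rewrite -(plift_morph (P := @tens_rel (Rgroup k G1) (Rgroup k G2))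
  (f := fun ab => Rext ab.1 ab.2) (g := fun x => h (chR x)) (h := f)) //.
  by move=> u v; rewrite chRD hD.
by case=> x y; rewrite -fh.
Qed.

End ResExt.

Section Average.

Variables (k : fieldType) (gT : finGroupType) (G : {group gT}) (M : lmodType k).
Implicit Type c : {ffun gT -> k}.

(** For T a class function with values in a vector space, the pairing of the
    characters c and T, up to replacing g by its inverse in one of them. *)
Definition avg c (T : gT -> M) : M := (#|G|%:R)^-1 *: \sum_(g in G) c g *: T g.

Lemma avgD T : {morph avg^~ T : c d / c + d}.
Proof.
move=> c d; rewrite /avg -scalerDr -big_split; congr (_ *: _).
by apply: eq_bigr => g _; rewrite ffunDE scalerDl.
Qed.

Lemma eq_avg c (d : {ffun gT -> k}) T U : {in G, c =1 d} -> {in G, T =1 U} -> avg c T = avg d U.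
Proof. by move=> cd TU; congr (_ *: _); apply: eq_bigr => g gG; rewrite cd // TU. Qed.

End Average.

Section Frobenius.

Variables (k : fieldType) (gT aT : finGroupType) (G : {group gT}) (A : {group aT}).
Variables (f : {morphism G >-> aT}) (injf : ('injm f)%g) (sfA : (f @* G)%g \subset A).
Hypothesis A0 : (#|A|%:R : k) != 0.

Local Notation cosets := ({C : {set aT} | C \in rcosets (f @* G)%g A}).

(** The induced character, in the form given by the trace of the matrices that
    define the induced representation: a fixes the coset C and acts on it
    through h. *)
Definition ind_fun (c : {ffun gT -> k}) : {ffun aT -> k} :=
  [ffun a => \sum_(C : cosets) \sum_(h in G | (f h * repr (val C) == repr (val C) * a)%g) c h].

Lemma ind_funD : {morph ind_fun : c d / c + d}.
Proof.
move=> c d; apply/ffunP => a; rewrite !ffunE -big_split; apply: eq_bigr => C _ /=.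
by rewrite -big_split; apply: eq_bigr => h _; rewrite ffunDE.
Qed.

Lemma chR_ind (x : Rgroup k G) a : a \in A -> chR (Rind injf sfA x) a = ind_fun (chR x) a.
Proof.
move=> aA; apply: (rlift_char (g := fun x => chR x a) (h := fun c => ind_fun c a)).
- by move=> u v; rewrite chRD ffunDE.
- by move=> u v; rewrite ind_funD ffunDE.
move=> V; rewrite chR_rcls !ffunE aA /=.
rewrite /mxtrace (reindex (@enum_rank (ind_index A f V))) /=; last first.
  exact/onW_bij/enum_rank_bij.
transitivity (\sum_(p : cosets * 'I_(rdegree V))
   \sum_(h in G | (f h * repr (val p.1) == repr (val p.1) * a)%g) V h p.2 p.2).
  by apply: eq_bigr => -[C i] _; rewrite mxE enum_rankK.
rewrite -(pair_bigA _ (fun (C : cosets) i =>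
  \sum_(h in G | (f h * repr (val C) == repr (val C) * a)%g) V h i i)) /=.
apply: eq_bigr => C _; rewrite exchange_big /=; apply: eq_bigr => h /andP[hG _].
by rewrite ffunE hG.
Qed.

Lemma repr_coset (C : cosets) : repr (val C) \in A.
Proof.
have /rcosetsP[d dA ->] := valP C.
have /rcosetP[g fg ->] : repr ((f @* G) :* d)%g \in ((f @* G) :* d)%g by apply: mem_repr_rcoset.
by rewrite groupM // (subsetP sfA).
Qed.

(** Frobenius reciprocity. For each coset C, the elements a that fix C correspond
    to the h in G, and T does not distinguish a from f h; the number of cosets is
    the ratio of the two orders. *)
Lemma avg_ind (M : lmodType k) (c : {ffun gT -> k}) (T : aT -> M) :
  (forall a x, a \in A -> x \in A -> T (a ^ x)%g = T a) ->
  avg A (ind_fun c) T = avg G c (fun g => T (f g)).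
Proof.
move=> Tc; rewrite /avg.
have cardA : (#|A| = #|{: cosets}| * #|G|)%N.
  rewrite -(card_injm injf) // -(Lagrange sfA) mulnC; congr muln.
  by rewrite card_sig; apply: eq_card => C; rewrite inE.
have step (C : cosets) :
  \sum_(a in A) (\sum_(h in G | (f h * repr (val C) == repr (val C) * a)%g) c h) *: T a
    = \sum_(h in G) c h *: T (f h).
  under eq_bigr do rewrite scaler_suml.
  rewrite (exchange_big_dep (fun h => h \in G)) /=; last by move=> a h _ /andP[].
  apply: eq_bigr => h hG; pose r := repr (val C).
  have rA : r \in A := repr_coset C.
  have fA : f h \in A by rewrite (subsetP sfA) // mem_morphim.
  rewrite (big_pred1 (f h ^ r)%g) ?Tc // => a; rewrite hG /= /conjg.
  apply/andP/eqP => [[aA /eqP e]|->]; last by rewrite !groupM ?groupV // mulKVg.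
  by rewrite -(mulKg r a) -e.
under eq_bigr do rewrite ffunE scaler_suml.
rewrite exchange_big /= (eq_bigr _ (fun C _ => step C)) sumr_const.
rewrite -scaler_nat scalerA; congr (_ *: _).
have : (#|A|%:R : k) = #|{: cosets}|%:R * #|G|%:R by rewrite cardA natrM.
move=> e; move: A0; rewrite e mulf_eq0 negb_or => /andP[C0 G0].
by rewrite invfM mulrAC mulVf // mul1r.
Qed.

End Frobenius.

(** * Representations of a product of two groups *)

Section TensorEntries.

Variable k : fieldType.

Fact pidx_subproof m n (i : 'I_m) (j : 'I_n) : (i * n + j < m * n)%N.
Proof.
by apply: leq_trans (leq_mul (ltn_ord i) (leqnn n)); rewrite mulSn addnC ltn_add2r.
Qed.

(** The position of (i, j) in the Kronecker product, following the recursive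
    definition of [tprod] by rows. *)
Definition pidx m n (i : 'I_m) (j : 'I_n) : 'I_(m * n) := Ordinal (pidx_subproof i j).

Lemma pidx_surj m n (p : 'I_(m * n)) : exists i j, p = pidx i j.
Proof.
have n0 : (0 < n)%N by case: n p => // p; have := ltn_ord p; rewrite {2}muln0.
have hi : (p %/ n < m)%N by rewrite ltn_divLR.
exists (Ordinal hi), (Ordinal (ltn_pmod p n0)); apply: val_inj => /=.
exact: divn_eq.
Qed.

Lemma trow_entry n1 (A : 'rV[k]_n1) m2 n2 (B : 'M_(m2, n2)) i (j : 'I_n1) (l : 'I_n2) :
  trow A B i (pidx j l) = A 0 j * B i l.
Proof.
elim: n1 A j => [|n1 IH] A j; first by case: j.
rewrite /=; case: (unliftP ord0 j) => [j' ->|->].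
  have -> : pidx (fintype.lift ord0 j') l = rshift n2 (pidx j' l).
    by apply: val_inj; rewrite /= /bump leq0n add1n mulSn addnA.
  rewrite (row_mxEr (lsubmx (A : 'rV_(1 + n1)) 0 0 *: B)) IH mxE.
  by congr (A 0 _ * _); apply: val_inj.
have -> : pidx (ord0 : 'I_n1.+1) l = lshift (n1 * n2) l by apply: val_inj.
rewrite (row_mxEl (lsubmx (A : 'rV_(1 + n1)) 0 0 *: B)) !mxE.
by congr (A 0 _ * _); apply: val_inj.
Qed.

Lemma tprod_entry m1 n1 (A : 'M[k]_(m1, n1)) m2 n2 (B : 'M_(m2, n2)) i i' j j' :
  tprod A B (pidx i i') (pidx j j') = A i j * B i' j'.
Proof.
elim: m1 A i => [|m1 IH] A i; first by case: i.
rewrite /=; case: (unliftP ord0 i) => [i0 ->|->].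
  have -> : pidx (fintype.lift ord0 i0) i' = rshift m2 (pidx i0 i').
    by apply: val_inj; rewrite /= /bump leq0n add1n mulSn addnA.
  rewrite (col_mxEd (trow (usubmx (A : 'M_(1 + m1, n1))) B)) IH mxE.
  by congr (A _ _ * _); apply: val_inj.
have -> : pidx (ord0 : 'I_m1.+1) i' = lshift (m1 * m2) i' by apply: val_inj.
rewrite (col_mxEu (trow (usubmx (A : 'M_(1 + m1, n1))) B)) trow_entry mxE.
by congr (A _ _ * _); apply: val_inj.
Qed.

Lemma pidx_inj m n (i i' : 'I_m) (j j' : 'I_n) : pidx i j = pidx i' j' -> i = i' /\ j = j'.
Proof.
move/(congr1 val) => /= e; have jn := ltn_ord j; have jn' := ltn_ord j'.
have n0 : (0 < n)%N by apply: leq_ltn_trans jn.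
split; apply: val_inj.
  by have := congr1 (divn^~ n) e; rewrite /= !divnMDl // !divn_small ?addn0.
by have := congr1 (modn^~ n) e; rewrite /= !modnMDl !modn_small.
Qed.

Lemma sum_pidx m n (R : nmodType) (F : 'I_(m * n) -> R) :
  \sum_p F p = \sum_i \sum_j F (pidx i j).
Proof.
rewrite pair_bigA (reindex (fun p : 'I_m * 'I_n => pidx p.1 p.2)) //=.
apply: onW_bij; apply: inj_card_bij; last by rewrite card_prod !card_ord.
by move=> [i j] [i' j'] /= /pidx_inj[-> ->].
Qed.

End TensorEntries.

Section ExtSurjective.

Variables (k : closedFieldType) (gT1 gT2 : finGroupType) (G1 : {group gT1}) (G2 : {group gT2}).
Local Notation G := (setX_group G1 G2).

Section Step.

Variable V : representation k G.

Lemma mem_setX g h : g \in G1 -> h \in G2 -> (g, h) \in G.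
Proof. by move=> gG hG; rewrite in_setX gG. Qed.

Fact left_repr : mx_repr G1 (fun g => V (g, 1%g)).
Proof.
split=> [|x y xG yG]; first exact: repr_mx1.
rewrite -repr_mxM ?mem_setX //; congr (V _).
by rewrite -[RHS]/((x * y)%g, (1 * 1)%g) mulg1.
Qed.
(** The restriction to the first factor. *)
Definition leftrep := MxRepresentation left_repr.

Lemma left_right g h : g \in G1 -> h \in G2 -> V (g, h) = V (g, 1%g) *m V (1%g, h).
Proof.
move=> gG hG; rewrite -repr_mxM ?mem_setX //; congr (V _).
by rewrite -[RHS]/((g * 1)%g, (1 * h)%g) mulg1 mul1g.
Qed.

Lemma right_left g h : g \in G1 -> h \in G2 -> V (g, h) = V (1%g, h) *m V (g, 1%g).
Proof.
move=> gG hG; rewrite -repr_mxM ?mem_setX //; congr (V _).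
by rewrite -[RHS]/((1 * g)%g, (h * 1)%g) mulg1 mul1g.
Qed.

Lemma rightM h h' : h \in G2 -> h' \in G2 -> V (1%g, (h * h')%g) = V (1%g, h) *m V (1%g, h').
Proof.
move=> hG hG'; rewrite -repr_mxM ?mem_setX //; congr (V _).
by rewrite -[RHS]/((1 * 1)%g, (h * h')%g) mulg1.
Qed.

Hypothesis V0 : (0 < rdegree V)%N.

(** Take a simple submodule S of the restriction to G1, and for D the space of
    G1-morphisms S -> V, on which G2 acts. The evaluation map S (x) D -> V is
    injective because S is absolutely irreducible, so that the operators of G1
    on S span all endomorphisms. *)
Lemma extrep_submod_exists : exists (S : representation k G1) (D : representation k G2)
    (U : 'M_(rdegree V)) (modU : mxmodule V U),
  (0 < \rank U)%N /\ mx_rsim (extrep S D) (submod_repr modU).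
Proof.
have [|U0 simU0 _] := dec_mxsimple_exists (mxmodule1 leftrep).
  by rewrite -mxrank_eq0 mxrank1 -lt0n.
have modU0 := mxsimple_module simU0.
pose S := Representation (submod_repr modU0).
have irrS : mx_irreducible (submod_repr modU0) by exact/submod_mx_irr.
have absS : mx_absolutely_irreducible (submod_repr modU0).
  exact: group_closure_closed_field irrS.
have {absS} [u0 [a_ a_S]] := mx_abs_irrP absS.
pose W := Representation leftrep.
pose H := homrep S W; pose d := \dim H; pose T := vbasis H.
have TH s : T`_s \in H.
  case: (ltnP s d) => sd; last by rewrite nth_default ?size_tuple // mem0v.
  by apply: vbasis_mem; rewrite mem_nth ?size_tuple.
have HP (A : 'M_(rdegree S, rdegree W)) :
   A \in H <-> forall g, g \in G1 -> S g *m A = A *m V (g, 1%g) by exact: memv_homrep.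
have Hr A h : h \in G2 -> A \in H -> A *m V (1%g, h) \in H.
  move=> hG /HP AH; apply/HP => g gG; rewrite mulmxA AH // -!mulmxA; congr (_ *m _).
  by rewrite -left_right // right_left.
(* the right action on the multiplicity space, in the basis T *)
pose Dm h : 'M[k]_d := \matrix_(s, t) coord T t (T`_s *m V (1%g, h)).
have DE h s : h \in G2 -> T`_(s : 'I_d) *m V (1%g, h) = \sum_t Dm h s t *: T`_t.
  move=> hG; rewrite [LHS](coord_vbasis (Hr _ _ hG (TH s))).
  by apply: eq_bigr => t _; rewrite mxE.
have freeT : free T by rewrite (basis_free (vbasisP _)).
have Dm_repr : mx_repr G2 Dm.
  split=> [|x y xG yG]; apply/matrixP => s t.
    rewrite !mxE -[(1%g, 1%g)]/(1%g : gT1 * gT2) repr_mx1 mulmx1.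
    by rewrite coord_free // eq_sym.
  rewrite mxE rightM // mulmxA DE // mulmx_suml.
  under eq_bigr do rewrite -scalemxAl DE //.
  rewrite linear_sum mxE; apply: eq_bigr => r _.
  rewrite linearZ linear_sum (bigD1 t) //= linearZ /= coord_free // eqxx mulr1.
  rewrite big1 ?addr0 // => q qt; rewrite linearZ /= coord_free // (negbTE qt) mulr0 //.
pose D := Representation (MxRepresentation Dm_repr).
pose E : 'M[k]_(rdegree S * d, rdegree V) := \matrix_(p, q)
  \sum_i \sum_(s < d) (p == pidx i s)%:R * (T`_s : 'M_(rdegree S, rdegree W)) i q.
have EE i (s : 'I_d) q : E (pidx i s) q = (T`_s : 'M_(rdegree S, rdegree W)) i q.
  rewrite mxE (bigD1 i) //= (bigD1 s) //= eqxx mul1r big1 ?addr0 => [|t ts].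
    rewrite big1 ?addr0 // => i' ii'; apply: big1 => t _; case: eqP => [/pidx_inj[e _]|_].
      by rewrite -e eqxx in ii'.
    by rewrite mul0r.
  case: eqP => [/pidx_inj[_ e]|_]; last by rewrite mul0r.
  by rewrite e eqxx in ts.
(* the isotypic component is the tensor product of S and its multiplicity space *)
have freeE : row_free E.
  apply: inj_row_free => v vE.
  pose a (s : 'I_d) : 'rV[k]_(rdegree S) := \row_i v 0 (pidx i s).
  have aT M : \sum_(s < d) a s *m (M *m (T`_s : 'M_(rdegree S, rdegree W))) = 0.
    rewrite [M]a_S.
    transitivity (\sum_(x in G1) a_ x M *: \sum_(s < d)
                    a s *m (S x *m (T`_s : 'M_(rdegree S, rdegree W)))).
      under eq_bigr do rewrite mulmx_suml mulmx_sumr.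
      rewrite exchange_big /=; apply: eq_bigr => x xG; rewrite scaler_sumr.
      by apply: eq_bigr => s _; rewrite -scalemxAl -scalemxAr.
    apply: big1 => x xG.
    have -> : \sum_(s < d) a s *m (S x *m (T`_s : 'M_(rdegree S, rdegree W)))
              = (v *m E) *m V (x, 1%g).
      rewrite (_ : v *m E = \sum_(s < d) a s *m (T`_s : 'M_(rdegree S, rdegree W))).
        rewrite mulmx_suml; apply: eq_bigr => s _.
        by have /HP TS := TH s; rewrite TS // mulmxA.
      apply/rowP => q; rewrite mxE sum_pidx summxE exchange_big /=; apply: eq_bigr => s _.
      by rewrite mxE; apply: eq_bigr => i _; rewrite EE mxE.
    by rewrite vE mul0mx scaler0.
  apply/rowP => p; have [j [t ->]] := pidx_surj p; rewrite [RHS]mxE.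
  suff : \sum_(s < d) a s 0 j *: T`_s = 0.
    by move/freeP: freeT => fr /fr/(_ t); rewrite mxE.
  apply/matrixP => l q; have /matrixP/(_ 0 q) := aT (delta_mx j l).
  rewrite [X in _ = X -> _]mxE summxE => aT0.
  rewrite summxE [RHS]mxE -[RHS]aT0; apply: eq_bigr => s _.
  have aD l' : (a s *m delta_mx j l) 0 l' = a s 0 j * (l' == l)%:R.
    rewrite [LHS]mxE (bigD1 j) //= [delta_mx _ _ _ _]mxE eqxx big1 ?addr0 // => j' jj'.
    by rewrite [delta_mx _ _ _ _]mxE (negbTE jj') mulr0.
  rewrite mulmxA [LHS]mxE [RHS]mxE (bigD1 l) //= aD eqxx mulr1 big1 ?addr0 // => l' ll'.
  by rewrite aD (negbTE ll') mulr0 mul0r.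
have homE g h : g \in G1 -> h \in G2 -> tprod (S g) (D h) *m E = E *m V (g, h).
  move=> gG hG; apply/matrixP => p q; have [i [s ->]] := pidx_surj p.
  transitivity ((S g *m ((T`_s : 'M_(rdegree S, rdegree W)) *m V (1%g, h))) i q).
    rewrite mxE sum_pidx mxE; apply: eq_bigr => j _; rewrite DE // summxE mulr_sumr.
    apply: eq_bigr => t _; rewrite tprod_entry EE -mulrA; congr (_ * _).
    by rewrite [RHS]mxE.
  have /HP TS := TH s.
  rewrite mulmxA TS // -mulmxA -left_right // [LHS]mxE [RHS]mxE.
  by apply: eq_bigr => r _; rewrite EE.
have modU : mxmodule V <<E>>%MS.
  rewrite (eqmx_module _ (genmxE E)); apply/mxmoduleP => -[g h].
  by rewrite in_setX => /andP[gG hG]; rewrite -homE // submxMl.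
exists S, D, <<E>>%MS, modU; split.
  rewrite genmxE (eqP freeE) muln_gt0 u0 /=.
  have iH : val_submod (1%:M : 'M_(\rank U0)) \in H.
    apply/HP => g gG; have := val_submodJ modU0 (1%:M : 'M_(\rank U0)) gG.
    by rewrite mul1mx val_submodE => <-.
  rewrite lt0n dimv_eq0; apply/eqP => H0; move: iH; rewrite H0 memv0 => /eqP v0.
  by case: simU0 => _ + _; rewrite -(eqmx_eq0 (val_submod1 U0)) v0 eqxx.
exists (in_submod <<E>>%MS E) => [||[g h]]; first by rewrite genmxE (eqP freeE).
  by rewrite /row_free mxrank_in_submod ?genmxE // (eqP freeE).
rewrite in_setX => /andP[gG hG].
have EU : (E <= <<E>>)%MS by rewrite genmxE.
have e : in_submod <<E>>%MS (E *m V (g, h)) = in_submod <<E>>%MS E *m submod_repr modU (g, h).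
  exact: in_submodJ.
apply: etrans e; rewrite -homE // in_submodE [in RHS]in_submodE mulmxA.
by [].
Qed.

End Step.
End ExtSurjective.

(** * Representations are determined by their characters *)

Section Devissage.

Variables (k : fieldType) (gT : finGroupType) (G : {group gT}).
Implicit Types V W : representation k G.

(** The zero submodule gives [V] = [0] + [V / 0], where all three are isomorphic. *)
Lemma rcls_deg0 V : rdegree V = 0%N -> rcls V = 0.
Proof.
move=> V0; have modU : mxmodule V (0 : 'M_(rdegree V)) by rewrite mxmodule0.
have rs W : rdegree W = 0%N -> mx_rsim V W.
  move=> W0; exists 0 => [||x _]; first by rewrite V0.
    by rewrite /row_free mxrank0 V0.
  by rewrite mulmx0 mul0mx.
apply: (addIr (rcls V)); rewrite add0r; apply/esym.
rewrite {1}(rcls_ses modU); congr (_ + _); apply/esym/rcls_rsim/rs => /=.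
  by rewrite mxrank0.
by rewrite mxrank_coker mxrank0 subn0.
Qed.

(** Induction on the degree, passing to the quotient by the given submodule. *)
Lemma rgroup_devissage (Q : Rgroup k G -> Prop) :
    Q 0 -> (forall x y, Q x -> Q y -> Q (x + y)) ->
    (forall V, (0 < rdegree V)%N -> exists (U : 'M_(rdegree V)) (modU : mxmodule V U),
        (0 < \rank U)%N /\ Q (rcls (Representation (submod_repr modU)))) ->
  forall V, Q (rcls V).
Proof.
move=> Q0 QD Qs V; have [n] := ubnP (rdegree V); elim: n V => // n IH V Vn.
have [V0|Vpos] := posnP (rdegree V); first by rewrite rcls_deg0.
have [U [modU [U0 QU]]] := Qs V Vpos.
rewrite (rcls_ses modU); apply: QD => //; apply: IH => /=.
rewrite mxrank_coker -ltnS; apply: leq_trans Vn.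
by rewrite ltnS -subSn ?rank_leq_row // leq_subLR -addn1 addnC leq_add2r.
Qed.

Lemma rcls_span (Q : Rgroup k G -> Prop) :
    Q 0 -> (forall x y, Q x -> Q y -> Q (x - y)) -> (forall V, Q (rcls V)) -> forall x, Q x.
Proof. exact: presented_span. Qed.

End Devissage.

Section Irreducibles.

Variables (k : closedFieldType) (char0 : [pchar k] =i pred0).

Lemma natr_neq0 n : (0 < n)%N -> (n%:R : k) != 0.
Proof. by move=> n0; rewrite ((pcharf0P k).1 char0) -lt0n. Qed.

Lemma intr_inj0 (n : int) : (n%:~R : k) = 0 -> n = 0.
Proof.
case: n => [n|n]; rewrite ?NegzE ?mulrNz => /eqP; rewrite ?oppr_eq0.
  by rewrite -pmulrn ((pcharf0P k).1 char0) => /eqP ->.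
by rewrite -pmulrn (negbTE (natr_neq0 _)).
Qed.

Lemma pchar0_group (gT : finGroupType) (G : {group gT}) : pgroup.pgroup (negn [pchar k]) G.
Proof. by apply/pgroup.pgroupP => p _ _; rewrite inE /= char0. Qed.

Lemma card_neq0 (gT : finGroupType) (G : {group gT}) : (#|G|%:R : k) != 0.
Proof. exact/natr_neq0/cardG_gt0. Qed.

Variables (gT : finGroupType) (G : {group gT}).
Implicit Types V W : representation k G.

(** The linear extension of dim Hom(V, -) to virtual representations, with values in k. *)
Definition homsum V (x : Rgroup k G) : k :=
  (#|G|%:R)^-1 * \sum_(g in G) \tr (V g^-1%g) * chR x g.

Lemma homsumD V : {morph homsum V : x y / x + y}.
Proof.
move=> x y; rewrite /homsum -mulrDr -big_split; congr (_ * _).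
by apply: eq_bigr => g _ /=; rewrite chRD ffunDE mulrDr.
Qed.

Lemma homsum_rcls V W : homsum V (rcls W) = (dimHom V W)%:R.
Proof.
rewrite dimHom_trace ?card_neq0 // /homsum; congr (_ * _); apply: eq_bigr => g gG.
by rewrite chR_rcls ffunE gG.
Qed.

Lemma simple_submod V : (0 < rdegree V)%N -> exists (U : 'M_(rdegree V)) (modU : mxmodule V U),
  (0 < \rank U)%N /\ mx_irreducible (submod_repr modU).
Proof.
move=> V0; have [|U simU _] := dec_mxsimple_exists (mxmodule1 V).
  by rewrite -mxrank_eq0 mxrank1 -lt0n.
have modU := mxsimple_module simU; exists U, modU.
have irrU : mx_irreducible (submod_repr modU) by exact/submod_mx_irr.
by split=> //; case/mx_irrP: irrU.
Qed.

Lemma Schur_rsim V W : mx_irreducible V -> mx_irreducible W -> (0 < dimHom V W)%N -> mx_rsim V W.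
Proof.
move=> /mx_irrP[V0 irrV] /mx_irrP[W0 irrW]; rewrite lt0n dimv_eq0 => hom0.
pose A := vpick (homrep V W).
have /memv_homrep AH : A \in homrep V W by apply: memv_pick.
have A0 : A != 0 by rewrite vpick0.
have freeA : row_free A.
  rewrite -kermx_eq0; apply: contraT => ker0; case/negP: A0.
  have modK : mxmodule V (kermx A).
    apply/mxmoduleP => g gG; apply/sub_kermxP.
    by rewrite -mulmxA AH // mulmxA mulmx_ker mul0mx.
  have /row_fullP[B BK] := irrV _ modK ker0.
  by rewrite -[A]mul1mx -BK -mulmxA mulmx_ker mulmx0.
have fullA : row_full A.
  have modA : mxmodule W <<A>>%MS.
    rewrite (eqmx_module _ (genmxE A)); apply/mxmoduleP => g gG.
    by rewrite -AH // submxMl.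
  have := irrW _ modA; rewrite -mxrank_eq0 genmxE mxrank_eq0 => /(_ A0).
  by rewrite /row_full genmxE.
by exists A => //; rewrite -(eqP freeA); exact/eqP.
Qed.

Lemma dimHom_rsim_gt0 V W : (0 < rdegree V)%N -> mx_rsim V W -> (0 < dimHom V W)%N.
Proof.
move=> V0 [B e freeB BH]; rewrite lt0n dimv_eq0; apply/eqP => H0.
have : B \in homrep V W by apply/memv_homrep => g gG; rewrite BH.
rewrite H0 memv0 => /eqP B0; move: freeB; rewrite B0 /row_free mxrank0.
by rewrite eq_sym; apply/negP; rewrite -lt0n.
Qed.

Local Notation sG := (DecSocleType (regular_repr k G)).
Local Notation irrep i := (Representation (irr_repr (i : sG))).

Lemma irrep_irr (i : sG) : mx_irreducible (irrep i).
Proof. exact: socle_irr. Qed.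

Lemma irrep_deg (i : sG) : (0 < rdegree (irrep i))%N.
Proof. by have /mx_irrP[] := irrep_irr i. Qed.

Lemma rcls_irr_span (x : Rgroup k G) :
  exists n : sG -> int, x = \sum_(i : sG) rcls (irrep i) *~ n i.
Proof.
elim/rcls_span: x => [|x y [m ->] [n ->]|].
- by exists (fun=> 0); rewrite big1.
- by exists (fun i => m i - n i); rewrite -sumrB; apply: eq_bigr => i _; rewrite mulrzBr.
apply: (rgroup_devissage (Q := fun x => exists n : sG -> int, x = \sum_(i : sG) rcls (irrep i) *~ n i))
  => [|x y [m ->] [n ->]|V V0].
- by exists (fun=> 0); rewrite big1.
- by exists (fun i => m i + n i); rewrite -big_split; apply: eq_bigr => i _; rewrite mulrzDr.
have [U [modU [U0 irrU]]] := simple_submod V0; exists U, modU; split=> //.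
exists (fun i => (i == irr_comp sG (submod_repr modU))%:R).
rewrite (bigD1 (irr_comp sG (submod_repr modU))) //= eqxx mulr1z big1 ?addr0.
  apply: rcls_rsim => /=; exact: (rsim_irr_comp_pchar sG (pchar0_group G) irrU).
by move=> i /negbTE ->; rewrite mulr0z.
Qed.

(** The classes of the irreducible representations generate R(G), and by Schur's
    lemma their pairings with each other vanish off the diagonal. On the diagonal
    they are positive integers, which are nonzero in k. *)
Lemma chR_inj : injective (@chR k gT G).
Proof.
move=> x y exy; apply/eqP; rewrite -subr_eq0; apply/eqP.
have : chR (x - y) = 0 by rewrite chRD (morphDN (@chRD k gT G)) exy subrr.
move: (x - y) => {x y exy} z; have [n ->] := rcls_irr_span z => z0.
rewrite big1 // => j _; suff -> : n j = 0 by rewrite mulr0z.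
have : homsum (irrep j) (\sum_i rcls (irrep i) *~ n i) = 0.
  by rewrite /homsum big1 ?mulr0 // => g _; rewrite z0 ffunE mulr0.
rewrite (morphD_sum (@homsumD _)) (bigD1 j) //= big1 ?addr0.
  rewrite (morphDMz (@homsumD _)) homsum_rcls -mulrzr => /eqP.
  rewrite mulf_eq0 (negbTE (natr_neq0 _)) /= => [/eqP/intr_inj0 //|].
  exact: dimHom_rsim_gt0 (irrep_deg j) (mx_rsim_refl _).
move=> i ij; rewrite (morphDMz (@homsumD _)) homsum_rcls.
rewrite (_ : dimHom _ _ = 0%N) ?mul0rz //; apply/eqP; rewrite -leqn0 leqNgt.
apply/negP => h; case/negP: ij; rewrite eq_sym; apply/socle_rsimP.
exact: Schur_rsim (irrep_irr j) (irrep_irr i) h.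
Qed.

End Irreducibles.

Section TensorDecomposition.

Variables (k : closedFieldType) (char0 : [pchar k] =i pred0).
Variables (gT1 gT2 : finGroupType) (G1 : {group gT1}) (G2 : {group gT2}).

Let Rext_eq (z z' : Rgroup k (setX_group G1 G2)) :
  (forall g1 g2, g1 \in G1 -> g2 \in G2 -> chR z (g1, g2) = chR z' (g1, g2)) -> z = z'.
Proof.
have out (x : Rgroup k (setX_group G1 G2)) g : g \notin setX_group G1 G2 -> chR x g = 0.
  move=> gG; rewrite (rlift_char (g := fun c : {ffun gT1 * gT2 -> k} => c g)
    (h := fun c : {ffun gT1 * gT2 -> k} => 0)) //.
  - by move=> u v; rewrite ffunDE.
  - by move=> u v; rewrite addr0.
  by move=> V; rewrite ffunE (negbTE gG).
move=> e; apply: (chR_inj char0); apply/ffunP => -[g1 g2].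
case: (boolP ((g1, g2) \in setX_group G1 G2)) => gG; last by rewrite !out.
by move: gG; rewrite in_setX => /andP[]; exact: e.
Qed.

(** The external product is defined on representatives; it respects the relations
    because its character is the product of the characters, and characters
    separate the elements of R(G1 x G2). *)
Lemma RextDl (y : Rgroup k G2) : {morph (@Rext k _ _ G1 G2)^~ y : x x' / x + x'}.
Proof.
by move=> x x'; apply: Rext_eq => g1 g2 h1 h2; rewrite chRD ffunDE !chR_ext // chRD ffunDE mulrDl.
Qed.

Lemma RextDr (x : Rgroup k G1) : {morph (@Rext k _ _ G1 G2) x : y y' / y + y'}.
Proof.
by move=> y y'; apply: Rext_eq => g1 g2 h1 h2; rewrite chRD ffunDE !chR_ext // chRD ffunDE mulrDr.
Qed.

Lemma Rext_rcls (S : representation k G1) (D : representation k G2) :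
  Rext (rcls S) (rcls D) = rcls (extrep S D).
Proof.
apply: Rext_eq => g1 g2 h1 h2; rewrite chR_ext // !chR_rcls !ffunE h1 h2.
by rewrite in_setX h1 h2 mxtrace_prod.
Qed.

Lemma tlift_Rext_surj (x : Rgroup k (setX_group G1 G2)) :
  exists t, tlift (@Rext k _ _ G1 G2) t = x.
Proof.
have tD := tliftD RextDl RextDr.
elim/rcls_span: x => [|x y [s <-] [t <-]|].
- by exists 0; exact: morphD0.
- by exists (s - t); rewrite tD (morphDN tD).
apply: (rgroup_devissage (Q := fun x => exists t, tlift (@Rext k _ _ G1 G2) t = x))
  => [|x y [s <-] [t <-]|V V0].
- by exists 0; exact: morphD0.
- by exists (s + t); rewrite tD.
have [S [D [U [modU [U0 sim]]]]] := extrep_submod_exists V0; exists U, modU; split=> //.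
exists (tpure (rcls S) (rcls D)); rewrite (tlift_pure RextDl RextDr) Rext_rcls.
exact: rcls_rsim.
Qed.

Lemma RsplitK (x : Rgroup k (setX_group G1 G2)) : tlift (@Rext k _ _ G1 G2) (Rsplit x) = x.
Proof. exact/invfK/tlift_Rext_surj. Qed.

End TensorDecomposition.

(** * The morphism defined on M *)

Section Scalars.

Variables (k : closedFieldType) (char0 : [pchar k] =i pred0).

Definition toK n (p : {mpoly int[n]}) : {mpoly k[n]} := map_mpoly intr p.

Lemma toKD n : {morph @toK n : p q / p + q}.
Proof. exact: raddfD. Qed.

Lemma toKM n : {morph @toK n : p q / p * q}.
Proof. exact: rmorphM. Qed.

Lemma mcoeff_toK n (p : {mpoly int[n]}) m : (toK p)@_m = (p@_m)%:~R.
Proof. exact: mcoeff_map_mpoly. Qed.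

Lemma intr_pchar0_inj : injective (intr : int -> k).
Proof.
move=> a b e; apply/eqP; rewrite -subr_eq0; apply/eqP/(intr_inj0 char0).
by rewrite rmorphB /= e subrr.
Qed.

Lemma toK_inj n : injective (@toK n).
Proof.
move=> p q e; apply/mpolyP => m; apply: intr_pchar0_inj.
by rewrite -!mcoeff_toK e.
Qed.

(** Identities between integral symmetric functions may be checked over k. *)
Lemma symfun_toK_inj (f g : symfun) : (forall n, toK (f n) = toK (g n)) -> f = g.
Proof.
move=> e; apply/val_inj/functional_extensionality_dep => n; exact: toK_inj (e n).
Qed.

Lemma meval_toK n (p : {mpoly int[n]}) (v : 'I_n -> int) :
  (p.@[v])%:~R = (toK p).@[fun i => (v i)%:~R].
Proof.
have h1 : {morph (fun q : {mpoly int[n]} => (q.@[v])%:~R : k) : p q / p + q}.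
  by move=> a b; rewrite mevalD rmorphD.
have h2 : {morph (fun q : {mpoly int[n]} => (toK q).@[fun i => (v i)%:~R]) : p q / p + q}.
  by move=> a b; rewrite toKD mevalD.
rewrite [p]mpolyE (morphD_sum h1) (morphD_sum h2); apply: eq_bigr => m _.
rewrite mevalZ mevalX rmorphM rmorph_prod /toK map_mpolyZ map_mpolyX mevalZ mevalX.
by congr (_ * _); apply: eq_bigr => i _; rewrite rmorphXn.
Qed.

Lemma toK_comp n m (t : 'I_n -> 'I_m) (p : {mpoly int[n]}) :
  toK (p \mPo [tuple 'X_(t i) | i < n]) = (toK p) \mPo [tuple 'X_(t i) | i < n].
Proof.
have h1 : {morph (fun q => toK (q \mPo [tuple 'X_(t i) | i < n])) : p q / p + q}.
  by move=> a b; rewrite comp_mpolyD toKD.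
have h2 : {morph (fun q => (toK q) \mPo [tuple 'X_(t i) | i < n]) : p q / p + q}.
  by move=> a b; rewrite toKD comp_mpolyD.
rewrite [p]mpolyE (morphD_sum h1) (morphD_sum h2); apply: eq_bigr => u _.
rewrite comp_mpolyZ /toK !map_mpolyZ map_mpolyX comp_mpolyZ !comp_mpolyX rmorph_prod.
congr (_ *: _); apply: eq_bigr => i _.
by rewrite !tnth_mktuple rmorphXn /= map_mpolyX.
Qed.

Lemma avg_linear (gT : finGroupType) (G : {group gT}) (M M' : lmodType k)
    (f : {linear M -> M'}) c (T : gT -> M) : f (avg G c T) = avg G c (fun g => f (T g)).
Proof.
by rewrite /avg linearZ linear_sum; congr (_ *: _); apply: eq_bigr => g _; rewrite linearZ.
Qed.

End Scalars.

Section PsiM.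

Variables (k : closedFieldType) (char0 : [pchar k] =i pred0) (Y : youngSet) (H : finZmodType).
Notation triv := (trivH k H).
Implicit Types (N : finSet).

Section OneF.

Variables (N : finSet) (F : {ffun Y N -> Hhat k H}).
Notation G := (autF F).

Lemma trace_permrep (aT : finGroupType) (A : {group aT}) (T : finType)
    (to : {action aT &-> T}) (S : {set T}) (GS : [acts A, on S | to]%g) a :
  \tr (permrep k GS a) = #|[set t in S | to t a == t]|%:R.
Proof.
rewrite /mxtrace; under eq_bigr do rewrite mxE.
rewrite -sum1_card natr_sum.
rewrite -[LHS](big_enum_val (fun t => (to t a == t)%:R)) /= [RHS]big_mkcond [LHS]big_mkcond /=.
by apply: eq_bigr => t _; rewrite !inE; case: (t \in S) => //=; case: eqP.
Qed.


Lemma trace_rho a w : 0%N \notin a -> \tr (rho triv k F a w) = (lcoef (theta triv F w) a)%:~R.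
Proof. by move=> a0; rewrite trace_permrep lcoef_theta // rmorph_nat. Qed.

(** Being constant on the cycles of w does not distinguish w from its inverse;
    this absorbs the inverse in [dimHom_trace]. *)
Lemma theta_inv w : theta triv F w^-1%g = theta triv F w.
Proof.
apply/val_inj/functional_extensionality_dep => n; apply: eq_bigl => c.
apply/colsP/colsP => -[h1 h2]; split=> // v.
  by rewrite -(h2 (w v)) permK.
by rewrite -(h2 ((w^-1)%g v)) permKV.
Qed.

Lemma lcoef_theta_deg w s : sumn s != #|{: N}| -> lcoef (theta triv F w) s = 0.
Proof.
move=> sN; rewrite /lcoef (dhomog_nemf_coeff (theta_homog triv F w (size s))) //=.
by rewrite -sumn_mdeg val_mon.
Qed.

Section OneV.

Variable V : representation k G.

(** The coefficient at s of the right-hand side of the formula for Psi_M. It is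
    given directly as an integer; that it is symmetric and stable is visible only
    from the character formula [psi_coefE], over k. *)
Definition psi_coef s : int :=
  if sumn s == #|{: N}| then (dimHom (rho triv k F (nz s)) V)%:Z else 0.

Lemma psi_coefE s :
  (psi_coef s)%:~R = (#|G|%:R)^-1 * \sum_(w in G) chrep V w * (lcoef (theta triv F w) s)%:~R.
Proof.
rewrite /psi_coef; case: eqP => [_|/eqP sN]; last first.
  by rewrite big1 ?mulr0 // => w _; rewrite lcoef_theta_deg // mulr0.
rewrite -pmulrn dimHom_trace ?card_neq0 //; congr (_ * _); apply: eq_bigr => w wG.
rewrite trace_rho ?nz_pos // lcoef_nz theta_inv ffunE wG.
by rewrite mulrC.
Qed.

Fact psi_perm s t : perm_eq s t -> psi_coef s = psi_coef t.
Proof.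
move=> st; apply: (intr_pchar0_inj char0); rewrite !psi_coefE.
congr (_ * _); apply: eq_bigr => w _.
by rewrite (lcoef_perm _ st).
Qed.

Fact psi_rcons0 s : psi_coef (rcons s 0%N) = psi_coef s.
Proof.
apply: (intr_pchar0_inj char0); rewrite !psi_coefE.
congr (_ * _); apply: eq_bigr => w _.
by rewrite lcoef_rcons0.
Qed.

Fact psi_bounded s : (#|{: N}| < sumn s)%N -> psi_coef s = 0.
Proof. by rewrite /psi_coef; case: eqP => // ->; rewrite ltnn. Qed.

Definition psi : symfun := mksym psi_perm psi_rcons0 psi_bounded.

Lemma psi_val : sym_val psi = \sum_(a <- comps #|{: N}|) Mqsym a *+ dimHom (rho triv k F a) V.
Proof.
apply/functional_extensionality_dep => n; apply/mpolyP => m.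
rewrite Mqsym_sumE -[sym_val psi n]/(psi n) mcoeff_lcoef lcoef_mksym /psi_coef.
by case: eqP => // _; rewrite natz.
Qed.

Lemma psi_toK n : toK k (psi n) = avg G (chrep V) (fun w => toK k (theta triv F w n)).
Proof.
apply/mpolyP => m; rewrite mcoeff_toK mcoeff_lcoef lcoef_mksym psi_coefE.
rewrite /avg mcoeffZ raddf_sum; congr (_ * _); apply: eq_bigr => w _.
by rewrite [RHS]mcoeffZ mcoeff_toK mcoeff_lcoef.
Qed.

Lemma psi_homog n : psi n \is #|{: N}|.-homog.
Proof.
apply/dhomogP => m; rewrite mcoeff_msupp mcoeff_lcoef lcoef_mksym /psi_coef.
by case: (sumn m =P _) => [e _|_]; [rewrite /= -e sumn_mdeg | rewrite eqxx].
Qed.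

End OneV.

Definition psiR : Rgroup k G -> symfun := rlift psi.

Lemma psiR_toK x n : toK k (psiR x n) = avg G (chR x) (fun w => toK k (theta triv F w n)).
Proof.
apply: (rlift_char (g := fun f : symfun => toK k (f n)) (h := fun c => avg G c (fun w => toK k (theta triv F w n)))).
- by move=> f g; rewrite -toKD.
- by move=> c d; rewrite avgD.
by move=> V; exact: psi_toK.
Qed.

Lemma psiRD : {morph psiR : x y / x + y}.
Proof.
move=> x y; apply: (symfun_toK_inj char0) => n.
rewrite -[RHS]/(toK k (psiR x n + psiR y n)).
by rewrite toKD !psiR_toK chRD avgD.
Qed.

Lemma psiR_rcls V : psiR (rcls V) = psi V.
Proof. by apply: (symfun_toK_inj char0) => n; rewrite psiR_toK psi_toK chR_rcls. Qed.

Lemma psiR_homog x n : psiR x n \is #|{: N}|.-homog.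
Proof.
elim/rcls_span: x => [|x y hx hy|V]; last by rewrite psiR_rcls psi_homog.
  by rewrite (morphD0 psiRD) rpred0.
rewrite psiRD (morphDN psiRD); exact: rpredB.
Qed.

End OneF.

Section AdInvariance.

Variables (N M : finSet) (w : bij N M) (F : {ffun Y N -> Hhat k H}).

Lemma wactE y : wact w F (ymap Y w y) = F y.
Proof.
by rewrite ffunE ymap_bijK.
Qed.

Lemma theta_Ad v : theta triv (wact w F) v = theta triv F (conj_bij w v).
Proof.
apply: (@theta_transport _ _ _ _ _ w) => [u|x]; first exact: wactE.
by rewrite permE bijKV.
Qed.

Lemma conj_bij_injective : injective (conj_bij w).
Proof.
move=> u v /permP e; apply/permP => x; have := e (bij_inv w x).
by rewrite !permE bijKV => /inj_inj.
Qed.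

(** Every automorphism of F is the conjugate of an automorphism of w F. *)
Lemma conj_bij_autF : conj_bij w @: autF (wact w F) = autF F.
Proof.
apply/setP => u; apply/imsetP/idP => [[v vG ->]|uG]; first exact: conj_bij_aut.
have fI : injective (fun x : M => w (u (bij_inv w x))).
  by move=> x y /inj_inj/perm_inj/inj_inj.
exists (perm fI); last by apply/permP => x; rewrite !permE !bijK.
apply/autFP => y.
rewrite -[y](ymap_bijKV w) wactE; move: (ymap Y (bij_inv w) y) => z.
have -> : ymap Y (perm_inj_of (perm fI)) (ymap Y w z) = ymap Y w (ymap Y (perm_inj_of u) z).
  by apply: ymap_square => x; rewrite !mkInjE permE bijK.
by rewrite wactE; exact: (autFP _ _ uG).
Qed.

Lemma chR_Ad (x : Rgroup k (autF F)) v : v \in autF (wact w F) ->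
  chR (Ad w x) v = chR x (conj_bij w v).
Proof.
move=> vG; apply: (rlift_char (g := fun x => chR x v)
  (h := fun c : {ffun {perm N} -> k} => c (conj_bij w v))).
- by move=> a b; rewrite chRD ffunDE.
- by move=> a b; rewrite ffunDE.
by move=> V; rewrite chR_rcls !ffunE vG conj_bij_aut.
Qed.

(** Conjugation by w identifies the two automorphism groups, the characters and the theta. *)
Lemma psiR_Ad x : psiR (Ad w x) = psiR (F := F) x.
Proof.
apply: (symfun_toK_inj char0) => n; rewrite !psiR_toK /avg.
rewrite -conj_bij_autF card_imset; last exact: conj_bij_injective.
rewrite big_imset; last by move=> u v _ _; exact: conj_bij_injective.
congr (_ *: _); apply: eq_bigr => v vG.
by rewrite chR_Ad // theta_Ad.
Qed.

End AdInvariance.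

Definition PsiM : hopfM k Y H -> SymHopf := Mlift (fun N F x => psiR (F := F) x).

Let PsiP r : @Mrel k Y H r ->
  flift (fun g : Mgen k Y H => psiR (F := mg_fun g) (mg_rep g)) r = 0.
Proof.
pose f (g : Mgen k Y H) := psiR (F := mg_fun g) (mg_rep g).
have fB := morphDN (@fliftD _ _ f).
case=> [N F x y|N M w F x]; rewrite !fliftD !fB !flift_gen /f /=.
  by rewrite psiRD -addrA -opprD subrr.
by rewrite psiR_Ad subrr.
Qed.

Lemma PsiMD : {morph PsiM : x y / x + y}.
Proof. exact: pliftD PsiP. Qed.

Lemma PsiM_Min N (F : {ffun Y N -> Hhat k H}) x : PsiM (Min x) = psiR (F := F) x.
Proof. exact: (plift_gen PsiP (MGen x)). Qed.

Lemma PsiM_formula N (F : {ffun Y N -> Hhat k H}) (gamma : representation k (autF F)) :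
  sym_val (PsiM (Min (rcls gamma)))
    = \sum_(a <- comps #|{: N}|) Mqsym a *+ dimHom (rho triv k F a) gamma.
Proof. by rewrite PsiM_Min psiR_rcls psi_val. Qed.

End PsiM.

Section AverageTheory.

Variable k : closedFieldType.

Lemma avg_prod (gT1 gT2 : finGroupType) (G1 : {group gT1}) (G2 : {group gT2})
    (A : comAlgType k) (c : {ffun gT1 * gT2 -> k}) (c1 : {ffun gT1 -> k}) (c2 : {ffun gT2 -> k})
    (T : gT1 -> A) (U : gT2 -> A) :
  (forall g h, g \in G1 -> h \in G2 -> c (g, h) = c1 g * c2 h) ->
  avg (setX_group G1 G2) c (fun gh => T gh.1 * U gh.2) = avg G1 c1 T * avg G2 c2 U.
Proof.
move=> cE; rewrite /avg -scalerAl -scalerAr scalerA cardsX natrM invfM; congr (_ *: _).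
rewrite big_distrlr /= pair_big /=; apply: eq_big => [[g h]|[g h]]; rewrite in_setX //=.
by case/andP=> gG hG; rewrite cE // -scalerAl -scalerAr scalerA.
Qed.

Lemma avg_const (gT : finGroupType) (G : {group gT}) (M : lmodType k) (c : {ffun gT -> k}) (T : gT -> M) t :
  (#|G|%:R : k) != 0 -> (forall g, g \in G -> c g *: T g = t) -> avg G c T = t.
Proof.
move=> G0 cT; rewrite /avg (eq_bigr _ cT) sumr_const -scaler_nat scalerA mulVf //.
exact: scale1r.
Qed.

End AverageTheory.

Section HopfM.

Variables (k : closedFieldType) (char0 : [pchar k] =i pred0) (Y : youngSet) (H : finZmodType).
Notation triv := (trivH k H).
Notation PsiM := (@PsiM k char0 Y H).
Notation psiR := (@psiR k char0 Y H).
Implicit Types (N : finSet).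

Section Product.

Variables (K L : finSet) (F : {ffun Y K -> Hhat k H}) (G : {ffun Y L -> Hhat k H}).

(** Frobenius reciprocity, and [theta_join]. *)
Lemma psiR_join (x : Rgroup k (autF F)) (y : Rgroup k (autF G)) :
  psiR (Rind (@sum_morph_inj Y (Hhat k H) K L F G)
             (@sum_morph_sub Y (Hhat k H) triv K L F G) (Rext x y))
    = sym_mul (psiR x) (psiR y).
Proof.
apply: (symfun_toK_inj char0) => n.
rewrite -[RHS]/(toK k (psiR x n * psiR y n)) toKM !psiR_toK.
rewrite -(@avg_prod _ _ _ _ _ _ (chR (Rext x y))); last first.
  by move=> g h gG hG; rewrite chR_ext.
rewrite (eq_avg (d := ind_fun (autF (joinF triv F G)) (sum_morph F G) (chR (Rext x y)))
   (U := fun w => toK k (theta triv (joinF triv F G) w n))) //; last first.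
  by move=> a aA; rewrite chR_ind.
rewrite (avg_ind (@sum_morph_inj _ _ K L F G) (@sum_morph_sub _ _ triv K L F G)
           (card_neq0 char0 _)).
  apply: eq_avg => // -[v w] _; rewrite -[sum_morph _ _ _]/(sum_perm (v, w)) theta_join.
  exact: toKM.
by move=> a b _ bA; rewrite theta_conj.
Qed.

End Product.

Lemma PsiM_mul : {morph PsiM : x y / gb_mul x y >-> gb_mul x y}.
Proof.
move=> u v; rewrite -[LHS]/(PsiM (Mmul u v)) -[RHS]/(sym_mul (PsiM u) (PsiM v)).
apply: (plift_morph (g := PsiM) (h := fun u => sym_mul (PsiM u) (PsiM v))).
- exact: PsiMD.
- by move=> a b; rewrite PsiMD sym_mulDl.
case=> K F x; rewrite -[pgen _ _]/(Min x) PsiM_Min.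
apply: (plift_morph (g := PsiM) (h := fun v => sym_mul (psiR x) (PsiM v))).
- exact: PsiMD.
- by move=> a b; rewrite PsiMD sym_mulDr.
case=> L G y; rewrite -[pgen _ _]/(Min y) !PsiM_Min.
exact: psiR_join.
Qed.

Lemma PsiM_homog n x : gb_homog n x -> gb_homog n (PsiM x).
Proof.
elim=> [u [N [F [z [<- ->]]]]| |u v _ hu _ hv] m.
- by rewrite PsiM_Min; exact: psiR_homog.
- by rewrite (morphD0 (@PsiMD k char0 Y H)) rpred0.
rewrite PsiMD (morphDN (@PsiMD k char0 Y H)); exact: rpredB (hu m) (hv m).
Qed.

Lemma PsiM_one : PsiM (gb_one (hopfM k Y H)) = gb_one SymHopf.
Proof.
rewrite -[LHS]/(PsiM (Mone k Y H)) PsiM_Min; apply: (symfun_toK_inj char0) => n.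
rewrite psiR_toK; apply: avg_const => [|w wG]; first exact: card_neq0.
rewrite chR_rcls ffunE wG mxtrace1 scale1r theta_card0 //.
by apply: eq_card0; case.
Qed.

Lemma psiR_eval N (F : {ffun Y N -> Hhat k H}) (x : Rgroup k (autF F)) n (e : int) :
  ((psiR x n).@[fun=> e])%:~R
    = (#|autF F|%:R)^-1
      * \sum_(w in autF F) chR x w * ((theta triv F w n).@[fun=> e])%:~R.
Proof.
rewrite meval_toK psiR_toK /avg mevalZ raddf_sum; congr (_ * _); apply: eq_bigr => w _.
by rewrite [LHS]mevalZ meval_toK.
Qed.

Lemma PsiM_counit x : gb_counit (PsiM x) = gb_counit x.
Proof.
rewrite -[RHS]/(Mcounit x) -[LHS]/((PsiM x 0%N).@[fun=> 0]); apply/esym.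
apply: (plift_morph (g := id) (h := fun x => (PsiM x 0%N).@[fun=> 0])) => [//|a b|].
  by rewrite PsiMD -mevalD.
case=> N F x0 /=; rewrite -[pgen _ _]/(Min x0) PsiM_Min; apply: (intr_pchar0_inj char0).
rewrite psiR_eval.
apply: (rlift_char (g := fun n : int => n%:~R) (h := fun c : {ffun {perm N} -> k} =>
   (#|autF F|%:R)^-1 * \sum_(w in autF F) c w * ((theta triv F w 0%N).@[fun=> 0])%:~R)).
- by move=> a b; rewrite rmorphD.
- move=> c d; rewrite -mulrDr -big_split; congr (_ * _); apply: eq_bigr => w _ /=.
  by rewrite ffunDE mulrDl.
move=> V; under eq_bigr do rewrite theta_eval0.
case: eqP => [N0|_]; last by rewrite big1 ?mulr0 // => w _; rewrite mulr0.
(* in degree 0 the group is trivial, and the average is the degree of V *)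
have G1 w : w \in autF F -> w = 1%g by move=> _; apply/permP => v; have := fintype0 v N0.
rewrite (eq_bigr (fun=> (rdegree V)%:R)) => [|w wG].
  by rewrite sumr_const -[X in _ * X]mulr_natl mulrA mulVf ?card_neq0 // mul1r -pmulrn.
by rewrite (G1 w wG) mulr1 ffunE group1 repr_mx1 mxtrace1.
Qed.

Lemma PsiM_zeta x : sym_ev1 (PsiM x) = zetaM x.
Proof.
rewrite -[LHS]/((PsiM x 1%N).@[fun=> 1]); apply/esym.
apply: (plift_morph (g := id) (h := fun x => (PsiM x 1%N).@[fun=> 1])) => [//|a b|].
  by rewrite PsiMD -mevalD.
case=> N F x0 /=; rewrite -[pgen _ _]/(Min x0) PsiM_Min; apply: (intr_pchar0_inj char0).
rewrite psiR_eval.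
apply: (rlift_char (g := fun n : int => n%:~R) (h := fun c : {ffun {perm N} -> k} =>
   (#|autF F|%:R)^-1 * \sum_(w in autF F) c w * ((theta triv F w 1%N).@[fun=> 1])%:~R)).
- by move=> a b; rewrite rmorphD.
- move=> c d; rewrite -mulrDr -big_split; congr (_ * _); apply: eq_bigr => w _ /=.
  by rewrite ffunDE mulrDl.
move=> V; under [X in _ = _ * X]eq_bigr do rewrite theta_eval1.
case: eqP => [F0|_]; last first.
  by rewrite !big1 ?mulr0 // => i _; rewrite ?mulr0 ?mul0rn.
set Irr := DecSocleType _; rewrite (bigD1 (principal_comp Irr)) //= eqxx big1 ?addr0.
  rewrite rmorphMn rmorph1 dimHom_trace ?card_neq0 //; congr (_ * _).
  apply: eq_bigr => w wG.
  have tr1 : \tr (irr_repr (principal_comp Irr) w^-1%g) = 1.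
    by rewrite irr1_repr ?groupV // mxtrace1 degree_irr1.
  by rewrite [X in X * _]tr1 mul1r mulr1 ffunE wG.
by move=> i /negbTE ->; rewrite mul0rn.
Qed.

End HopfM.

Section OrbitSums.

Variables (k : closedFieldType) (char0 : [pchar k] =i pred0).

Lemma chR_class (gT : finGroupType) (G : {group gT}) (z : Rgroup k G) g x :
  g \in G -> x \in G -> chR z (g ^ x)%g = chR z g.
Proof.
move=> gG xG; apply: (rlift_char (g := fun c : {ffun gT -> k} => c (g ^ x)%g)
  (h := fun c : {ffun gT -> k} => c g)).
- by move=> a b; rewrite ffunDE.
- by move=> a b; rewrite ffunDE.
move=> V; rewrite !ffunE groupJ // gG conjgE !repr_mxM ?groupM ?groupV //.
by rewrite mxtrace_mulC -mulmxA -repr_mxM ?groupV // mulgV repr_mx1 mulmx1.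
Qed.

(** The orbit of x has |G| / |C_G[x]| elements, on each of which h takes the
    value h x. *)
Lemma sum_orbit_transversal (gT : finGroupType) (G : {group gT}) (T : finType)
    (to : {action gT &-> T}) (M : lmodType k) (h : T -> M) :
    (forall a x, a \in G -> h (to x a) = h x) ->
  \sum_(x in orbit_transversal to G setT) (#|('C_G[x | to])%g|%:R)^-1 *: h x
    = (#|G|%:R)^-1 *: \sum_x h x.
Proof.
move=> hG; have actsG : [acts G, on [set: T] | to]%g.
  by apply/actsP => a _ x; rewrite !inE.
have [_ _ orbX exX] := orbit_transversalP actsG.
set X := orbit_transversal _ _ _ in orbX exX *.
have -> : \sum_x h x = \sum_(x in X) #|orbit to G x|%:R *: h x.
  transitivity (\sum_y \sum_(x in X | y \in orbit to G x) h x).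
    apply: eq_bigr => y _; have [a aG aX] := exX y (in_setT y).
    rewrite (big_pred1 (to y a)) ?hG // => x /=.
    apply/andP/eqP => [[xX yx]|->]; last by rewrite aX orbit_sym mem_orbit.
    by apply/eqP; rewrite -orbX //; case/orbitP: yx => b bG <-; rewrite -actM mem_orbit ?groupM.
  rewrite (exchange_big_dep (fun x => x \in X)) /=; last by move=> y x _ /andP[].
  apply: eq_bigr => x xX; rewrite scaler_nat -sumr_const.
  by apply: eq_bigl => y; rewrite xX.
rewrite scaler_sumr; apply: eq_bigr => x _; rewrite scalerA; congr (_ *: _).
have e : (#|G|%:R : k) = #|orbit to G x|%:R * #|('C_G[x | to])%g|%:R.
  by rewrite -natrM card_orbit_stab.
have orb0 : (#|orbit to G x|%:R : k) != 0.
  by apply: (natr_neq0 char0); apply/card_gt0P; exists x; exact: orbit_refl.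
by rewrite e invfM mulrAC mulVf // mul1r.
Qed.

End OrbitSums.

Section ComulM.

Variables (k : closedFieldType) (char0 : [pchar k] =i pred0) (Y : youngSet) (H : finZmodType).
Notation triv := (trivH k H).
Notation PsiM := (@PsiM k char0 Y H).
Notation psiR := (@psiR k char0 Y H).

Lemma toK_ext (f g : symfun) m n :
  toK k (sym_ext f g (m, n)) = ((toK k (f m)) \mPo [tuple 'X_(lshift n i) | i < m])
                               * ((toK k (g n)) \mPo [tuple 'X_(rshift m j) | j < n]).
Proof. by rewrite toKM !toK_comp. Qed.

Lemma MinD N (F : {ffun Y N -> Hhat k H}) : {morph (@Min k Y H N F) : x y / x + y}.
Proof. by move=> x y; apply: pgenB_eq; exact: MrelAdd. Qed.

Lemma tlift_ext_tmapD : {morph (fun t => tlift sym_ext (tmap PsiM PsiM t)) : x y / x + y}.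
Proof. by move=> x y; rewrite tmapD ?tlift_extD //; exact: PsiMD. Qed.

Section OneSubset.

Variables (N : finSet) (F : {ffun Y N -> Hhat k H}) (K : {set N}) (m n : nat).
Local Notation F1 := (restrF F K).
Local Notation F2 := (restrF F (~: K)).

Definition theta_pair (vw : {perm (subF K)} * {perm (subF (~: K))}) : {mpoly k[m + n]} :=
  toK k (sym_ext (theta triv F1 vw.1) (theta triv F2 vw.2) (m, n)).

(** By [chR_tlift_ext] it suffices to look at pure tensors, where both sides are
    products of averages. *)
Lemma ext_tmap_char (t : tens (Rgroup k (autF F1)) (Rgroup k (autF F2))) :
  toK k (tlift sym_ext (tmap PsiM PsiM (tmap (@Min k Y H _ F1) (@Min k Y H _ F2) t)) (m, n))
    = avg (setX_group (autF F1) (autF F2)) (chR (tlift (@Rext k _ _ _ _) t)) theta_pair.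
Proof.
apply: (chR_tlift_ext (f := fun t => toK k (tlift sym_ext (tmap PsiM PsiM
    (tmap (@Min k Y H _ F1) (@Min k Y H _ F2) t)) (m, n)))
  (h := fun c => avg (setX_group (autF F1) (autF F2)) c theta_pair)).
- move=> x y; rewrite tmapD; [|exact: MinD|exact: MinD].
  by rewrite tlift_ext_tmapD -toKD.
- by move=> c d; rewrite avgD.
move=> x y; rewrite tmap_pure; [|exact: MinD|exact: MinD].
rewrite tmap_pure; [|exact: PsiMD|exact: PsiMD].
rewrite tlift_ext_pure !PsiM_Min toK_ext !psiR_toK !avg_linear.
rewrite -(@avg_prod _ _ _ _ _ _ (chR (Rext x y))); last first.
  by move=> g h gG hG; rewrite chR_ext.
by apply: eq_avg => // -[v w] _; rewrite /theta_pair toK_ext.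
Qed.

(** The chosen preimage of the induced representation does not matter, by
    [ext_tmap_char]; Frobenius reciprocity then undoes the induction. *)
Lemma ext_tmap_split (x : Rgroup k (autF F)) :
  toK k (tlift sym_ext (tmap PsiM PsiM (tmap (@Min k Y H _ F1) (@Min k Y H _ F2)
     (Rsplit (Rind (@restr_morph_inj Y (Hhat k H) N F K) (@restr_morph_sub Y (Hhat k H) N F K)
                       (Rres (stabF_sub F K) x))))) (m, n))
    = avg (stabF F K) (chR x) (fun w => toK k (theta_part triv F w K m n)).
Proof.
rewrite ext_tmap_char RsplitK //.
rewrite (eq_avg (d := ind_fun (setX_group (autF F1) (autF F2)) (restr_morph F K)
                        (chR (Rres (stabF_sub F K) x))) (U := theta_pair)) //; last first.
  by move=> a aA; rewrite chR_ind.
rewrite (avg_ind (@restr_morph_inj _ _ N F K) (@restr_morph_sub _ _ N F K)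
           (card_neq0 char0 _)).
  apply: eq_avg => w wS; first by rewrite chR_res.
  by rewrite theta_part_ext //; exact: stabF_mem wS.
move=> [a1 a2] [b1 b2] _; rewrite in_setX => /andP[h1 h2].
by rewrite /theta_pair -[((a1, a2) ^ (b1, b2))%g]/((a1 ^ b1)%g, (a2 ^ b2)%g) /= !theta_conj.
Qed.

End OneSubset.

(** The weight of K in the sum over representatives is the inverse order of its
    stabilizer. The sum therefore becomes the average over Aut F of the sum over
    all stable K, which is theta in the joint alphabet. *)
Lemma avg_theta_part N (F : {ffun Y N -> Hhat k H}) (x : Rgroup k (autF F)) m n :
  \sum_(K in orbit_transversal ('P^*) (autF F) [set: {set N}])
     avg (stabF F K) (chR x) (fun w => toK k (theta_part triv F w K m n))
  = toK k (psiR x (m + n)%N).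
Proof.
pose h (K : {set N}) := \sum_(w in stabF F K) chR x w *: toK k (theta_part triv F w K m n).
have stabE K : ('C_(autF F)[K | 'P^*])%g = stabF F K by rewrite astab1_set.
rewrite (eq_bigr (fun K => (#|('C_(autF F)[K | 'P^*])%g|%:R)^-1 *: h K)); last first.
  by move=> K _; rewrite stabE.
have stabP K w : (w \in stabF F K) = (w \in autF F) && (w @: K == K).
  rewrite -stabE inE; congr (_ && _); apply/astab1P/eqP => [e|e]; first by rewrite -{2}e.
  by rewrite -{2}e.
rewrite (sum_orbit_transversal char0) => [|a K aG]; last first.
  rewrite -[('P^*)%act K a]/(a @: K) /h.
  rewrite (reindex_inj (conjg_inj a)) /=; apply: eq_big => [w|w].
    rewrite !stabP groupJr //; congr (_ && _).
    rewrite -(inj_eq (imset_inj (@perm_inj _ a)) (w @: K) K); congr (_ == _).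
    rewrite -!imset_comp; apply: eq_imset => v /=.
    by rewrite conjgE !permM permK.
  rewrite stabP (groupJr _ aG) => /andP[wG _].
  by rewrite (chR_class x wG aG) (theta_part_conj _ _ _ _ _ aG).
rewrite psiR_toK /avg; congr (_ *: _).
under [RHS]eq_bigr => w _.
  rewrite theta_split_part (morphD_sum (@toKD k _)) scaler_sumr.
  over.
rewrite [RHS](exchange_big_dep xpredT) //; apply: eq_bigr => K _.
by apply: eq_bigl => w; rewrite stabP.
Qed.

Lemma sym_doubleD : {morph sym_double : f g / f + g}.
Proof. by move=> f g; apply/functional_extensionality_dep. Qed.

Lemma PsiM_comul x : gb_comul (PsiM x) = tmap PsiM PsiM (gb_comul x).
Proof.
apply: tlift_ext_inj; rewrite [gb_comul _]/(sym_comul (PsiM x)) sym_comulK.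
apply/esym; rewrite -[gb_comul x]/(Mcomul x).
apply: (plift_morph (g := fun t => tlift sym_ext (tmap PsiM PsiM t))
                    (h := fun x => sym_double (PsiM x))).
- exact: tlift_ext_tmapD.
- by move=> a b; rewrite PsiMD sym_doubleD.
case=> N F z; rewrite -[pgen _ _]/(Min z) PsiM_Min /=.
rewrite (morphD_sum tlift_ext_tmapD); apply/functional_extensionality_dep => -[m n].
apply: (toK_inj char0); rewrite -[RHS]/(toK k (psiR z (m + n)%N)) -avg_theta_part.
have evD : {morph (fun p : pfam2 => toK k (p (m, n))) : p q / p + q}.
  by move=> p q; rewrite -toKD.
by rewrite (morphD_sum evD); apply: eq_bigr => K _; exact: ext_tmap_split.
Qed.

Theorem PsiM_induced : induced_by (@zetaM k Y H) PsiM.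
Proof.
split; last exact: PsiM_zeta.
split; [exact: PsiMD | exact: PsiM_homog | exact: PsiM_mul | exact: PsiM_one
       | exact: PsiM_comul | exact: PsiM_counit].
Qed.

Lemma hopfM_homog (x : hopfM k Y H) : spanned (fun v => exists n, gb_homog n v) x.
Proof.
elim/(@presented_span _ (@Mrel k Y H)): x => [|x y|[N F z]].
- exact: spanned0.
- exact: spannedB.
by apply: spanned_gen; exists #|{: N}|; apply: spanned_gen; exists N, F, z.
Qed.

End ComulM.

(** * The basis of B *)

Section LinearReps.

Variables (k : fieldType) (gT : finGroupType) (G : {group gT}).
Implicit Types V W : representation k G.

Lemma linear_rsim V W : rdegree V = 1%N -> rdegree W = 1%N ->
  {in G, forall g, \tr (V g) = \tr (W g)} -> mx_rsim V W.
Proof.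
case: V W => n rV [m rW] /= n1 m1; move: rV rW; rewrite n1 m1 => rV rW tVW.
exists 1%:M => // [|g gG]; first by rewrite row_free_unit unitmx1.
by rewrite mulmx1 mul1mx [rV g]mx11_scalar [rW g]mx11_scalar -!trace_mx11 tVW.
Qed.

Lemma linear_trM V g h : rdegree V = 1%N -> g \in G -> h \in G ->
  \tr (V (g * h)%g) = \tr (V g) * \tr (V h).
Proof.
case: V => n rV /= n1; move: rV; rewrite n1 => rV gG hG.
by rewrite repr_mxM // !trace_mx11 mxE big_ord1.
Qed.

Lemma linear_tr1 V : rdegree V = 1%N -> \tr (V 1%g) = 1.
Proof. by move=> V1; rewrite repr_mx1 mxtrace1 V1. Qed.

Lemma linear_irreducible V : rdegree V = 1%N -> mx_irreducible V.
Proof. by move=> V1; apply/mx_abs_irrW/linear_mx_abs_irr. Qed.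

End LinearReps.

Section HomFunctional.

Variables (k : closedFieldType) (char0 : [pchar k] =i pred0).
Variables (gT : finGroupType) (G : {group gT}).

Definition homs (V : representation k G) (x : Rgroup k G) : int :=
  rlift (fun W => (dimHom V W)%:Z) x.

Lemma homsE V x : (homs V x)%:~R = homsum V x.
Proof.
apply: (plift_morph (g := fun n : int => n%:~R) (h := homsum V)).
- by move=> a b; rewrite rmorphD.
- exact: homsumD.
by move=> W; rewrite -[pgen _ _]/(rcls W) (homsum_rcls char0).
Qed.

Lemma homsD V : {morph homs V : x y / x + y}.
Proof. by move=> x y; apply: (intr_pchar0_inj char0); rewrite rmorphD /= !homsE homsumD. Qed.

Lemma homs_rcls V W : homs V (rcls W) = dimHom V W.
Proof. by apply: (intr_pchar0_inj char0); rewrite homsE (homsum_rcls char0). Qed.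

End HomFunctional.

Section BLift.

Variables (k : closedFieldType) (char0 : [pchar k] =i pred0) (Y : youngSet) (H : finZmodType).
Notation triv := (trivH k H).
Notation FunH N := {dffun Y N -> H}.
Notation funY N := {ffun Y N -> Hhat k H}.
Implicit Types N M K L : finSet.

Lemma tr_piF N (F : funY N) f : \tr (piF F f) = \prod_(y : Y N) \tr (irr_repr (F y) (f y)).
Proof. exact: mxtrace_scalar. Qed.

(** The copy of H at the place y. *)
Definition single N (y : Y N) (h : H) : FunH N := [ffun z => if z == y then h else 1%g].

Lemma tr_piF_single N (F : funY N) y h : \tr (piF F (single y h)) = \tr (irr_repr (F y) h).
Proof.
rewrite tr_piF (bigD1 y) //= ffunE eqxx big1 ?mulr1 // => z /negbTE zy.
by rewrite ffunE zy repr_mx1 mxtrace1 Hhat_degree.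
Qed.

Lemma Hhat_char_inj (i j : Hhat k H) :
  (forall h, \tr (irr_repr i h) = \tr (irr_repr j h)) -> i = j.
Proof.
move=> e; apply/eqP/socle_rsimP.
apply: (linear_rsim (V := Representation (irr_repr i)) (W := Representation (irr_repr j)));
  rewrite /= ?Hhat_degree // => h _; exact: e.
Qed.

(** Restricting pi_F to the copy of H at the place y gives F(y), so that distinct
    functions F give nonisomorphic one-dimensional representations. *)
Lemma dimHom_piF N (F F' : funY N) : dimHom (piF F) (piF F') = (F == F').
Proof.
case: eqP => [<-|FF'].
  have := dimHom_trace (piF F) (piF F) (card_neq0 char0 _).
  rewrite (eq_bigr (fun=> 1)) => [|f _]; last first.
    by rewrite -linear_trM ?inE // mulVg linear_tr1.
  rewrite sumr_const mulVf ?card_neq0 // => e.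
  have : (dimHom (piF F) (piF F))%:Z = 1%:Z; last by case.
  by apply: (intr_pchar0_inj char0); rewrite -!pmulrn e.
apply/eqP; rewrite -leqn0 leqNgt; apply/negP => d0; apply: FF'.
have sim : mx_rsim (piF F) (piF F') by apply: Schur_rsim d0; apply: linear_irreducible.
apply/ffunP => y; apply: Hhat_char_inj => h.
by rewrite -!tr_piF_single (mxtrace_rsim sim) ?inE.
Qed.

Section Transport.

Variables (N M : finSet) (w : bij N M).

Definition pull (f : FunH M) : FunH N := [ffun y => f (ymap Y w y)].
Definition push (f : FunH N) : FunH M := [ffun y => f (ymap Y (bij_inv w) y)].

Lemma pushK : cancel push pull.
Proof. by move=> f; apply/ffunP => y; rewrite !ffunE ymap_bijK. Qed.

Lemma pullK : cancel pull push.
Proof. by move=> f; apply/ffunP => y; rewrite !ffunE ymap_bijKV. Qed.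

Lemma tr_piF_wact (F : funY N) f : \tr (piF (wact w F) f) = \tr (piF F (pull f)).
Proof.
rewrite !tr_piF (reindex (ymap Y w)) /=; last first.
  by exists (ymap Y (bij_inv w)) => y _; rewrite ?ymap_bijK ?ymap_bijKV.
by apply: eq_bigr => y _; rewrite wactE ffunE.
Qed.

Lemma chR_Bact (x : Rgroup k [set: FunH N]%G) f : chR (Bact w x) f = chR x (pull f).
Proof.
apply: (rlift_char (g := fun x => chR x f)
  (h := fun c : {ffun FunH N -> k} => c (pull f))).
- by move=> a b; rewrite chRD ffunDE.
- by move=> a b; rewrite ffunDE.
by move=> V; rewrite chR_rcls !ffunE !inE.
Qed.

(** Relabelling along w carries pi_F to pi_(wF). *)
Lemma homs_Bact (F : funY N) x : homs (piF (wact w F)) (Bact w x) = homs (piF F) x.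
Proof.
apply: (intr_pchar0_inj char0); rewrite !(homsE char0) /homsum.
have cE : #|[set: FunH M]| = #|[set: FunH N]|.
  by rewrite !cardsT; apply: (bij_eq_card (f := pull)); exists push; [exact: pullK|exact: pushK].
rewrite cE; congr (_ * _); rewrite [LHS](reindex push) /=; last first.
  by exists pull => f _; rewrite ?pushK ?pullK.
apply: eq_big => [f|f _]; first by rewrite !inE.
have pushV : pull (push f)^-1%g = f^-1%g.
  by apply/ffunP => y; rewrite !ffunE ymap_bijK.
by rewrite tr_piF_wact chR_Bact pushK pushV.
Qed.

Lemma wact_bij : bijective (wact w : funY N -> funY M).
Proof.
exists (fun F : funY M => [ffun y => F (ymap Y w y)]) => F; apply/ffunP => y.
  by rewrite !ffunE ymap_bijK.
by rewrite !ffunE ymap_bijKV.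
Qed.

End Transport.

(** Both sides are computed from the same formal sums. Applied to the structure
    maps of B, this reduces each identity to the elements pi_F. *)
Lemma Blift_comp (A B : zmodType) (g : A -> B) (f : forall N, funY N -> A) (u : Bcar k Y H) :
  {morph g : x y / x + y} -> g (Blift f u) = Blift (fun N F => g (f N F)) u.
Proof.
move=> gD; rewrite /Blift /plift (morphD_sum gD); apply: eq_bigr => -[N x] _.
rewrite (morphDMz gD); congr (_ *~ _); rewrite /rlift /plift (morphD_sum gD).
apply: eq_bigr => V _; rewrite (morphDMz gD); congr (_ *~ _).
rewrite (morphD_sum gD); apply: eq_bigr => F _; exact: morphDMn.
Qed.

Lemma eq_Blift (A : zmodType) (f g : forall N, funY N -> A) u :
  (forall N (F : funY N), f N F = g N F) -> Blift f u = Blift g u.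
Proof.
move=> fg; congr (Blift _ u); apply: functional_extensionality_dep => N.
by apply: functional_extensionality_dep => F; exact: fg.
Qed.

Section Invariant.

Variables (A : zmodType) (f : forall N, funY N -> A).
Hypothesis f_wact : forall N M (w : bij N M) (F : funY N), f (wact w F) = f F.

Let gen (g : Bgen k Y H) : A := rlift (fun V =>
    \sum_(F : funY (bg_set g)) f F *+ dimHom (piF F) V) (bg_rep g).

Let genE N (x : Rgroup k [set: FunH N]%G) : gen (BGen x) = \sum_(F : funY N) f F *~ homs (piF F) x.
Proof.
apply: (plift_morph (g := id) (h := fun x => \sum_(F : funY N) f F *~ homs (piF F) x)) => // [a b|V].
  by rewrite -big_split; apply: eq_bigr => F _; rewrite (homsD char0) mulrzDr.
by apply: eq_bigr => F _; rewrite -[pgen _ _]/(rcls V) (homs_rcls char0).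
Qed.

Let genP r : @Brel k Y H r -> flift gen r = 0.
Proof.
have fB := morphDN (@fliftD _ _ gen).
case=> [N x y|N M w x]; rewrite !fliftD !fB !flift_gen !genE.
  rewrite -addrA -opprD -big_split; apply/eqP; rewrite subr_eq0; apply/eqP.
  by apply: eq_bigr => F _; rewrite (homsD char0) mulrzDr.
rewrite [X in _ - X](reindex (wact w)) /=; last exact/onW_bij/wact_bij.
by rewrite (eq_bigr _ (fun F _ => congr2 _ (f_wact w F) (homs_Bact w F x))) subrr.
Qed.

Lemma BliftD : {morph Blift f : x y / x + y}.
Proof. exact: pliftD genP. Qed.

Lemma Blift_Bpi N (F : funY N) : Blift f (Bpi F) = f F.
Proof.
have -> : Blift f (Bpi F) = gen (BGen (rcls (piF F))) by exact: (plift_gen genP).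
rewrite genE (bigD1 F) //= homs_rcls // dimHom_piF eqxx mulr1z big1 ?addr0 // => F' F'F.
by rewrite homs_rcls // dimHom_piF (negbTE F'F) mulr0z.
Qed.

End Invariant.
End BLift.

(** * The morphism defined on B *)

Section HopfB.

Variables (k : closedFieldType) (char0 : [pchar k] =i pred0) (Y : youngSet) (H : finZmodType).
Notation triv := (trivH k H).
Notation FunH N := {dffun Y N -> H}.
Notation funY N := {ffun Y N -> Hhat k H}.
Implicit Types N M K L : finSet.

Definition PsiB : hopfB k Y H -> SymHopf := Blift (fun N (F : funY N) => theta triv F 1%g).

Let theta_wact N M (w : bij N M) (F : funY N) : theta triv (wact w F) 1%g = theta triv F 1%g.
Proof.
apply: (@theta_transport _ _ _ _ _ w) => [u|x]; first exact: wactE.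
by rewrite !perm1.
Qed.

Lemma PsiBD : {morph PsiB : x y / x + y}.
Proof. exact: (BliftD char0 theta_wact). Qed.

Lemma PsiB_Bpi N (F : funY N) : PsiB (Bpi F) = theta triv F 1%g.
Proof. exact: (Blift_Bpi char0 theta_wact). Qed.

Lemma PsiB_formula N (F : funY N) :
  sym_val (PsiB (Bpi F)) = \sum_(a <- comps #|{: N}|) Mqsym a *+ #|CompF triv F a|.
Proof.
rewrite PsiB_Bpi; apply/functional_extensionality_dep => n; apply/mpolyP => m.
rewrite Mqsym_sumE -[sym_val _ n]/(theta triv F 1%g n) mcoeff_lcoef.
case: eqP => [_|/eqP mN]; last by rewrite lcoef_theta_deg.
rewrite -lcoef_nz lcoef_theta ?nz_pos //; congr (_%:R); apply: eq_card => t.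
rewrite inE andb_idr // => _; apply/eqP/eq_from_tnth => i; rewrite tnth_mktuple.
by rewrite -[RHS]imset_id; apply: eq_imset => v; rewrite perm1.
Qed.

Lemma PsiB_homog n x : gb_homog n x -> gb_homog n (PsiB x).
Proof.
elim=> [u [N [F [<- ->]]]| |u v _ hu _ hv] m.
- by rewrite PsiB_Bpi; exact: theta_homog.
- by rewrite (morphD0 PsiBD) rpred0.
rewrite PsiBD (morphDN PsiBD); exact: rpredB (hu m) (hv m).
Qed.

Lemma sum_perm1 K L : sum_perm ((1, 1)%g : {perm K} * {perm L}) = 1%g.
Proof. by apply/permP => -[x|x]; rewrite permE /= !perm1. Qed.

Lemma PsiB_mul : {morph PsiB : x y / gb_mul x y >-> gb_mul x y}.
Proof.
move=> u v; rewrite -[LHS]/(PsiB (Bmul u v)) -[RHS]/(sym_mul (PsiB u) (PsiB v)).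
rewrite /Bmul (Blift_comp _ _ PsiBD) [X in _ = sym_mul X _]/PsiB.
rewrite (Blift_comp _ _ (sym_mulDl _)); apply: eq_Blift => K F.
rewrite (Blift_comp _ _ PsiBD) [X in _ = sym_mul _ X]/PsiB.
rewrite (Blift_comp _ _ (sym_mulDr _)); apply: eq_Blift => L G.
by rewrite PsiB_Bpi -theta_join sum_perm1.
Qed.

Lemma PsiB_one : PsiB (gb_one (hopfB k Y H)) = gb_one SymHopf.
Proof.
rewrite -[LHS]/(PsiB (Bone k Y H)) PsiB_Bpi theta_card0 //.
by apply: eq_card0; case.
Qed.

Lemma PsiB_eval n (e : int) u :
  (PsiB u n).@[fun=> e] = Blift (fun N (F : funY N) => (theta triv F 1%g n).@[fun=> e]) u.
Proof.
by apply: (Blift_comp _ _ (g := fun f : symfun => (f n).@[fun=> e])) => f g; rewrite -mevalD.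
Qed.

Lemma PsiB_counit x : gb_counit (PsiB x) = gb_counit x.
Proof.
rewrite -[LHS]/((PsiB x 0%N).@[fun=> 0]) PsiB_eval; apply: eq_Blift => N F.
by rewrite theta_eval0.
Qed.

Lemma PsiB_zeta x : sym_ev1 (PsiB x) = zetaB x.
Proof.
rewrite -[LHS]/((PsiB x 1%N).@[fun=> 1]) PsiB_eval; apply: eq_Blift => N F.
by rewrite theta_eval1.
Qed.

Lemma sub_perm1 N (K : {set N}) : sub_perm K 1 = 1%g.
Proof. by apply/permP => x; apply: val_inj; rewrite /= sub_permE ?perm1 // => y; rewrite perm1. Qed.

Lemma PsiB_comul x : gb_comul (PsiB x) = tmap PsiB PsiB (gb_comul x).
Proof.
apply: tlift_ext_inj; rewrite [gb_comul _]/(sym_comul (PsiB x)) sym_comulK.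
rewrite -[gb_comul x]/(Bcomul x) /Bcomul.
have tD : {morph (fun t => tlift sym_ext (tmap PsiB PsiB t)) : u v / u + v}.
  by move=> u v; rewrite tmapD ?tlift_extD //; exact: PsiBD.
rewrite [RHS](Blift_comp _ _ tD) [LHS](Blift_comp _ _ sym_doubleD); apply: eq_Blift => N F.
rewrite (morphD_sum tD); apply/functional_extensionality_dep => -[m n].
rewrite -[LHS]/(theta triv F 1%g (m + n)%N) theta_split_part.
have evD : {morph (fun p : pfam2 => p (m, n)) : p q / p + q} by [].
rewrite [RHS](morphD_sum evD); apply: eq_big => [K|K _].
  by apply/eqP; rewrite -[RHS]imset_id; apply: eq_imset => v; rewrite perm1.
rewrite tmap_pure ?tlift_ext_pure ?PsiB_Bpi; try exact: PsiBD.
by rewrite theta_part_ext ?sub_perm1 // => y; rewrite perm1.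
Qed.

Theorem PsiB_induced : induced_by (@zetaB k Y H) PsiB.
Proof.
split; last exact: PsiB_zeta.
split; [exact: PsiBD | exact: PsiB_homog | exact: PsiB_mul | exact: PsiB_one
       | exact: PsiB_comul | exact: PsiB_counit].
Qed.

Section Generation.

Variable N : finSet.
Local Notation GN := [set: FunH N]%G.

Lemma FunH_abelian : abelian [set: FunH N].
Proof. by apply/centsP => f _ g _; apply/ffunP => y; rewrite !ffunE FinRing.zmod_mulgC. Qed.

(** The group Fun(Y_N, H) is the direct product of its copies of H. *)
Lemma prod_single (f : FunH N) : (\prod_y single y (f y))%g = f.
Proof.
apply/ffunP => z.
have e (g1 g2 : FunH N) : (g1 * g2)%g z = g1 z + g2 z by rewrite ffunE.
have e1 : (1%g : FunH N) z = 0 by rewrite ffunE.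
rewrite (big_morph (fun g : FunH N => g z) e e1) (bigD1 z) //= ffunE eqxx big1 ?addr0 //.
by move=> y yz; rewrite ffunE eq_sym (negbTE yz).
Qed.

(** A linear character of a direct product is the product of its restrictions to
    the factors, and each of these is one of the representatives in H^. *)
Lemma linear_piF (V : representation k GN) : rdegree V = 1%N -> exists F : funY N, mx_rsim (piF F) V.
Proof.
move=> V1; pose l f := \tr (V f).
have lM f g : l (f * g)%g = l f * l g by rewrite /l linear_trM ?inE.
have singleM y h h' : single (Y := Y) y (h * h')%g = (single y h * single y h')%g :> FunH N.
  by apply/ffunP => z; rewrite !ffunE; case: eqP => _; rewrite ?mulg1.
have single1 y : single (Y := Y) y 1%g = 1%g :> FunH N.
  by apply/ffunP => z; rewrite !ffunE; case: eqP.
have lrepr y : mx_repr [set: H] (fun h => (l (single y h))%:M : 'M[k]_1).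
  split=> [|h h' _ _]; first by rewrite single1 /l linear_tr1.
  by rewrite singleM lM scalar_mxM.
pose W y := Representation (MxRepresentation (lrepr y)).
pose F : funY N := [ffun y => irr_comp (DecSocleType (regular_repr k [set: H]%G)) (W y)].
have FE y h : \tr (irr_repr (F y) h) = l (single y h).
  have simW : mx_rsim (W y) (irr_repr (F y)).
    rewrite ffunE; apply: rsim_irr_comp_pchar; first exact: pchar0_group.
    exact: (linear_irreducible (V := W y)).
  by rewrite -(mxtrace_rsim simW) ?inE // mxtrace_scalar.
exists F; apply: linear_rsim => // f _.
rewrite tr_piF -[in RHS](prod_single f) -/(l _).
have l1 : l 1%g = 1 by exact: linear_tr1.
by rewrite (big_morph l lM l1); apply: eq_bigr => y _; rewrite FE.
Qed.

(** A simple submodule of a representation of the abelian group Fun(Y_N, H) is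
    one-dimensional, hence isomorphic to some pi_F. *)
Lemma Bin_span (Q : Bcar k Y H -> Prop) :
    Q 0 -> (forall x y, Q x -> Q y -> Q (x - y)) -> (forall F : funY N, Q (Bpi F)) ->
  forall x : Rgroup k GN, Q (Bin x).
Proof.
have BinD : {morph (@Bin k Y H N) : x y / x + y}.
  by move=> x y; apply: pgenB_eq; exact: BrelAdd.
move=> Q0 QB Qpi x; have QN u : Q u -> Q (- u) by rewrite -sub0r; exact: QB.
elim/rcls_span: x => [|x y hx hy|].
- by rewrite (morphD0 BinD).
- by rewrite BinD (morphDN BinD); exact: QB.
apply: (rgroup_devissage (Q := fun x => Q (Bin x))) => [|x y hx hy|V V0].
- by rewrite (morphD0 BinD).
- by rewrite BinD -[Bin y]opprK; apply: QB => //; exact: QN.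
have [U [modU [U0 irrU]]] := simple_submod V0; exists U, modU; split=> //.
have U1 : rdegree (Representation (submod_repr modU)) = 1%N.
  have splitG : group_splitting_field k GN by exact: group_closure_closed_field.
  exact: (mx_irr_abelian_linear splitG irrU FunH_abelian).
have [F simF] := linear_piF U1.
by rewrite -(rcls_rsim simF); exact: Qpi.
Qed.

End Generation.

Lemma hopfB_homog (x : hopfB k Y H) : spanned (fun v => exists n, gb_homog n v) x.
Proof.
elim/(@presented_span _ (@Brel k Y H)): x => [|x y|[N z]].
- exact: spanned0.
- exact: spannedB.
apply: (@Bin_span N (fun v => spanned _ v)) => [|x y|F].
- exact: spanned0.
- exact: spannedB.
by apply: spanned_gen; exists #|{: N}|; apply: spanned_gen; exists N, F.
Qed.

End HopfB.

Theorem proposition3p32 (k : closedFieldType) (char0 : [pchar k] =i pred0)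
    (Y : youngSet) (H : finZmodType) :
  ((exists! Psi : hopfM k Y H -> SymHopf, induced_by (@zetaM k Y H) Psi) /\
   (forall Psi : hopfM k Y H -> SymHopf, induced_by (@zetaM k Y H) Psi ->
      forall (N : finSet) (F : {ffun Y N -> Hhat k H})
             (gamma : representation k (autF F)),
        sym_val (Psi (Min (rcls gamma)))
          = \sum_(a <- comps #|{: N}|)
               Mqsym a *+ dimHom (rho (trivH k H) k F a) gamma)) /\
  ((exists! Psi : hopfB k Y H -> SymHopf, induced_by (@zetaB k Y H) Psi) /\
   (forall Psi : hopfB k Y H -> SymHopf, induced_by (@zetaB k Y H) Psi ->
      forall (N : finSet) (F : {ffun Y N -> Hhat k H}),
        sym_val (Psi (Bpi F))
          = \sum_(a <- comps #|{: N}|) Mqsym a *+ #|CompF (trivH k H) F a|)).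
Proof.
have M_unique := induced_by_unique (@hopfM_homog k Y H).
have B_unique := induced_by_unique (@hopfB_homog k char0 Y H).
have M_ind := PsiM_induced char0 Y H; have B_ind := PsiB_induced char0 Y H.
split; split.
- by exists (PsiM char0 (Y := Y) (H := H)); split=> // Psi; exact: M_unique.
- move=> Psi /(M_unique _ _ _ M_ind) <- N F gamma; exact: PsiM_formula.
- by exists (@PsiB k Y H); split=> // Psi; exact: B_unique.
move=> Psi /(B_unique _ _ _ B_ind) <- N F; exact: PsiB_formula.
Qed.
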